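(* Let $\mathfrak g$ be a complex reductive Lie algebra with Cartan subalgebra $\mathfrak h$, let $\mathcal C$ be a chamber (connected component defined by the roots) of $\mathfrak h^{\mathbb R}_{\mathrm{reg}}$, and let $\mu\in\mathcal C$. Let $J_\pm=J_\pm(\mu)\in U\mathfrak g^{\otimes 2}[[\hbar]]$ be the differential twists and $S_\pm=S_\pm(\mu)\in U\mathfrak g^{\otimes 2}[[\hbar]]$ the quantum Stokes matrices of the dynamical KZ equation with parameter $\mu$, and set $$R_\pm=(J_\pm^{21})^{-1}\cdot e^{\hbar\Omega/2}\cdot J_\pm .$$ Then $$R_+=e^{\pi\iota\mathsf h\Omega_0}\cdot S_-^{-1}\qquad\text{and}\qquad R_-=e^{\pi\iota\mathsf h\Omega_0}\cdot S_+^{-1}.$$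
   Context: $\iota=\sqrt{-1}$. $\mathsf h,\hbar$ are formal parameters related by $\hbar=2\pi\iota\mathsf h$. $\Phi\subset\mathfrak h^*$ is the root system, $\mathfrak h_{\mathrm{reg}}=\mathfrak h\setminus\bigcup_{\alpha\in\Phi}\ker\alpha$, $\mathfrak h^{\mathbb R}=\{t\in\mathfrak h\mid\alpha(t)\in\mathbb R\ \forall\alpha\in\Phi\}$, $\mathfrak h^{\mathbb R}_{\mathrm{reg}}=\mathfrak h^{\mathbb R}\cap\mathfrak h_{\mathrm{reg}}$. A nondegenerate invariant symmetric bilinear form $(\cdot,\cdot)$ on $\mathfrak g$ is fixed; $\Omega\in\mathfrak g\otimes\mathfrak g$ is the corresponding invariant tensor and $\Omega_0\in\mathfrak h\otimes\mathfrak h$ its projection onto $\mathfrak h\otimes\mathfrak h$. The superscript $21$ denotes the flip of tensor factors. Let $\mathcal A=\{\sum_{k\ge0}a_k\hbar^k\in U\mathfrak g^{\otimes2}[[\hbar]]\mid a_k\in U\mathfrak g_{\le k}\otimes U\mathfrak g_{\le k}\}$, filtered by $\mathcal A_n=\mathcal A\cap\hbar^nU\mathfrak g^{\otimes2}[[\hbar]]$ (the quotients $\mathcal A/\mathcal A_n$ are finite-dimensional), and $\mathcal E=\{T\in\mathrm{End}_{\mathbb C}(\mathcal A)\mid T(\mathcal A_n)\subseteq\mathcal A_n\ \forall n\}$, filtered by $\mathcal E_n=\{T\mid \mathrm{Im}\,T\subseteq\mathcal A_n\}$. Functions with values in $\mathcal A$ or $\mathcal E$ are holomorphic if all their truncations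 to $\mathcal A/\mathcal A_n$, $\mathcal E/\mathcal E_n$ are. An element $a\in\mathcal A$ is identified with the operator of left multiplication by $a$ in $\mathcal E$. With $\mu^{(1)}=\mu\otimes1$, the dynamical KZ (DKZ) equation is $$\frac{d\Upsilon}{dz}=\Big(\mathsf h\frac{\Omega}{z}+\mathrm{ad}\,\mu^{(1)}\Big)\Upsilon .$$ Use the standard determination of $\log z$ with cut along $\mathbb R_{\le0}$, and let $\mathbb H_\pm=\{z\in\mathbb C\mid \mathrm{Im}\,z\gtrless0\}$. Canonical solutions (known to exist): (i) there is a unique holomorphic $H_0:\mathbb C\to\mathcal A$ with $H_0(0)=1$ such that $\Upsilon_0=e^{z\,\mathrm{ad}\mu^{(1)}}\cdot H_0(z)\cdot z^{\mathsf h\Omega}$ is an $\mathcal E$-valued solution; (ii) for $\mu\in\mathfrak h^{\mathbb R}_{\mathrm{reg}}$ there are unique holomorphic $H_\pm:\mathbb H_\pm\to\mathcal A$ with $H_\pm(z)\to1$ as $z\to\infty$ in any sector of $\mathbb H_\pm$ of the form $|\arg z|\in(\delta,\pi-\delta)$, $\delta>0$, such that $\Upsilon_\pm=H_\pm(z)\cdot z^{\mathsf h\Omega_0}\cdot e^{z\,\mathrm{ad}\mu^{(1)}}$ is an $\mathcal E$-valued solution. Regard $\Upsilon_0,\Upsilon_\pm$ as single-valued holomorphic functions on $\mathbb C\setminus\mathbb R_{\le0}$ by analytic continuation. Differential twist: $J_\pm=\Upsilon_0(z)^{-1}\cdot\Upsilon_\pm(z)$, which is independent of $z\in\mathbb C\setminus\mathbb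 R_{\le0}$ and is left multiplication by an element of $\mathcal A$, denoted by the same symbol. Quantum Stokes matrices: $S_\pm\in\mathcal A$ are defined by $\Upsilon_+=\Upsilon_-\cdot S_+$ and $\Upsilon_-\cdot e^{\hbar\Omega_0}=\Upsilon_+\cdot S_-$, where the first identity holds in $\mathbb H_-$ after $\Upsilon_+$ has been continued from $\mathbb H_+$ across $\mathbb R_{>0}$, and the second holds in $\mathbb H_+$ after $\Upsilon_-$ has been continued from $\mathbb H_-$ across $\mathbb R_{<0}$ (and $S_\pm$ are again identified with left multiplication operators). (Background: with $\Delta_\pm=J_\pm^{-1}\Delta_0(\cdot)J_\pm$, $\Delta_0$ the standard coproduct, $(U\mathfrak g[[\hbar]],\Delta_\pm,R_\pm)$ is a quasitriangular Hopf algebra isomorphic to the Drinfeld–Jimbo quantum group of $\mathfrak g$.) *)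

(* Defs.v *)
From HB Require Import structures.
From mathcomp Require Import all_boot all_order all_algebra.
From mathcomp Require Import all_classical all_reals all_analysis.
From mathcomp.real_closed Require Import complex.
Set Implicit Arguments. Unset Strict Implicit. Unset Printing Implicit Defensive.
Import Order.TTheory GRing.Theory Num.Theory.
Local Open Scope complex_scope.
Local Open Scope classical_set_scope.
Local Open Scope ring_scope.

Section LieAlgebras.
Variable K : fieldType.

Record lieAlgebra := LieAlgebra {
  lie_sort :> vectType K;
  br : lie_sort -> lie_sort -> lie_sort;
  br_linearr : forall x, linear (br x);
  br_linearl : forall y, linear (br^~ y);
  brxx : forall x, br x x = 0;
  br_jacobi : forall x y z,
    br x (br y z) + br y (br z x) + br z (br x y) = 0 }.

Variable g : lieAlgebra.

Definition lie_ideal (I : {vspace g}) := forall x y, y \in I -> br x y \in I.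

(* The adjoint representation is completely reducible. *)
Definition reductive := forall I : {vspace g}, lie_ideal I ->
  exists J : {vspace g},
    [/\ lie_ideal J, (I + J)%VS = fullv & (I :&: J)%VS = 0%VS].

(* Cartan subalgebras of a complex reductive Lie algebra: self-centralizing
   abelian subalgebras whose elements are ad-diagonalizable. *)
Definition cartan (h : {vspace g}) :=
  [/\ forall x y, x \in h -> y \in h -> br x y = 0,
      forall x, (forall t, t \in h -> br t x = 0) -> x \in h
    & forall t, t \in h -> exists2 e : seq g, basis_of fullv e &
        forall x, x \in e -> exists c, br t x = c *: x].

Variable h : {vspace g}.

Definition root_vector (alpha : {scalar subvs_of h}) (x : g) :=
  forall t : subvs_of h, br (vsval t) x = alpha t *: x.

Definition is_root (alpha : {scalar subvs_of h}) :=
  (exists t, alpha t != 0) /\ (exists2 x, x != 0 & root_vector alpha x).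

(* The projection of g onto h along the sum of the root spaces. *)
Definition cartan_projection (p : 'End(g)) :=
  (forall x, x \in h -> p x = x) /\
  (forall alpha x, is_root alpha -> root_vector alpha x -> p x = 0).

Record invariant_form (B : g -> g -> K) : Prop := InvariantForm {
  form_linearl : forall y, scalar (B^~ y);
  form_sym : forall x y, B x y = B y x;
  form_inv : forall x y z, B (br x y) z = B x (br y z);
  form_nondeg : forall x, (forall y, B x y = 0) -> x = 0 }.

Definition lie_morphism (A : algType K) (f : g -> A) :=
  forall x y, f (br x y) = f x * f y - f y * f x.

(* ue_sort with ue_in is the universal enveloping algebra of g. *)
Record envelopingAlgebra := EnvelopingAlgebra {
  ue_sort :> algType K;
  ue_in : {linear g -> ue_sort};
  ue_in_br : lie_morphism ue_in;
  ue_universal : forall (A : algType K) (f : {linear g -> A}),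
    lie_morphism f ->
    exists F : {lrmorphism ue_sort -> A}, (forall x, F (ue_in x) = f x) /\
      forall F' : {lrmorphism ue_sort -> A},
        (forall x, F' (ue_in x) = f x) -> F' =1 F }.

End LieAlgebras.

Section TensorSquare.
Variable K : fieldType.

Definition bilinear (A V : lmodType K) (f : A -> A -> V) :=
  (forall a, linear (f a)) /\ (forall b, linear (f^~ b)).

(* ts_sort is the algebra A (x) A, and tens a b is a (x) b. *)
Record tensorSquare (A : algType K) := TensorSquare {
  ts_sort :> algType K;
  tens : A -> A -> ts_sort;
  tens_bilinear : bilinear tens;
  tens1 : tens 1 1 = 1;
  tensM : forall a b c d, tens a b * tens c d = tens (a * c) (b * d);
  tens_universal : forall (V : lmodType K) (f : A -> A -> V), bilinear f ->
    exists F : {linear ts_sort -> V}, (forall a b, F (tens a b) = f a b) /\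
      forall F' : {linear ts_sort -> V},
        (forall a b, F' (tens a b) = f a b) -> F' =1 F }.

Variables (A : algType K) (T : tensorSquare A).

Lemma flip_exists : exists F : {linear T -> T},
  forall a b, F (tens T a b) = tens T b a.
Proof.
have [Tl Tr] := tens_bilinear T.
have [|F [FE _]] := @tens_universal A T T (fun a b => tens T b a).
  by split=> [a|b]; [exact: Tr | exact: Tl].
by exists F.
Qed.

Definition flip : {linear T -> T} := sval (cid flip_exists).

End TensorSquare.

Section ClassicalInverse.
Variable A : nzRingType.

Definition is_inverse (x y : A) := y * x = 1 /\ x * y = 1.

Definition cunit (x : A) : bool := `[< exists y, is_inverse x y >].

Definition cinv (x : A) : A := xget x [set y | is_inverse x y].

Lemma cinvP (x : A) : cunit x -> is_inverse x (cinv x).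
Proof. by move=> /asboolP[y xy]; rewrite /cinv; case: xgetP => // /(_ y). Qed.

Lemma cmulVx : {in cunit, left_inverse 1 cinv *%R}.
Proof. by move=> x /cinvP[]. Qed.

Lemma cmulxV : {in cunit, right_inverse 1 cinv *%R}.
Proof. by move=> x /cinvP[]. Qed.

Lemma cunitP (x y : A) : y * x = 1 /\ x * y = 1 -> cunit x.
Proof. by move=> xy; apply/asboolP; exists y. Qed.

Lemma cinv_out : {in [predC cunit], cinv =1 id}.
Proof.
move=> x; rewrite inE /= => /asboolPn nx; rewrite /cinv.
by case: xgetP => // y _ xy; case: nx; exists y.
Qed.

End ClassicalInverse.

(* Formal power series T[[hbar]]: the series sum_k (f k) hbar^k is encoded by
   its sequence of coefficients. *)
Definition fps (T : Type) := nat -> T.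

Section FormalSeries.
Variables (K : fieldType) (T : algType K).

HB.instance Definition _ := GRing.Lmodule.copy (fps T) (nat -> T).

Implicit Types f g : fps T.

Definition fps_one : fps T := fun n => (n == 0%N)%:R.
Definition fps_mul f g : fps T := fun n => \sum_(i < n.+1) f i * g (n - i)%N.

Let tr n f : {poly T} := \poly_(i < n.+1) f i.

Let coef_tr n f i : (i <= n)%N -> (tr n f)`_i = f i.
Proof. by move=> lein; rewrite coef_poly ltnS lein. Qed.

Let fps_mulE n f g k : (k <= n)%N -> fps_mul f g k = (tr n f * tr n g)`_k.
Proof.
move=> lekn; rewrite coefM; apply: eq_bigr => i _.
by rewrite !coef_tr ?(leq_trans (leq_subr _ _)) ?(leq_trans (leq_ord i)).
Qed.

Lemma fps_mulA : associative fps_mul.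
Proof.
move=> f g k; apply/funext => n.
transitivity ((tr n f * (tr n g * tr n k))`_n).
  rewrite coefM; apply: eq_bigr => i _.
  by rewrite coef_tr ?leq_ord // (@fps_mulE n) ?leq_subr.
rewrite mulrA coefM; apply: eq_bigr => i _.
by rewrite [X in _ * X]coef_tr ?leq_subr // (@fps_mulE n) ?leq_ord.
Qed.

Lemma fps_mul1r : left_id fps_one fps_mul.
Proof.
move=> f; apply/funext => n; rewrite /fps_mul big_ord_recl mul1r subn0.
by rewrite big1 ?addr0 // => i _; rewrite mul0r.
Qed.

Lemma fps_mulr1 : right_id fps_one fps_mul.
Proof.
move=> f; apply/funext => n; rewrite /fps_mul big_ord_recr /= subnn mulr1.
rewrite big1 ?add0r // => i _.
by rewrite /fps_one subn_eq0 leqNgt ltn_ord mulr0.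
Qed.

Lemma fps_mulDl : left_distributive fps_mul +%R.
Proof.
move=> f g k; apply/funext => n.
transitivity (\sum_(i < n.+1) (f i * k (n - i)%N + g i * k (n - i)%N)).
  by apply: eq_bigr => i _; exact: mulrDl.
exact: big_split.
Qed.

Lemma fps_mulDr : right_distributive fps_mul +%R.
Proof.
move=> f g k; apply/funext => n.
transitivity (\sum_(i < n.+1) (f i * g (n - i)%N + f i * k (n - i)%N)).
  by apply: eq_bigr => i _; exact: mulrDr.
exact: big_split.
Qed.

Lemma fps_oner_neq0 : fps_one != 0.
Proof. by apply/eqP => /(congr1 (@^~ 0%N)) /eqP; rewrite oner_eq0. Qed.

HB.instance Definition _ := GRing.Zmodule_isNzRing.Build (fps T)
  fps_mulA fps_mul1r fps_mulr1 fps_mulDl fps_mulDr fps_oner_neq0.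

Lemma fps_scaleAl (a : K) f g : a *: (f * g) = (a *: f) * g.
Proof.
apply/funext => n; rewrite [LHS]scaler_sumr.
by apply: eq_bigr => i _; rewrite scalerAl.
Qed.

Lemma fps_scaleAr (a : K) f g : a *: (f * g) = f * (a *: g).
Proof.
apply/funext => n; rewrite [LHS]scaler_sumr.
by apply: eq_bigr => i _; rewrite scalerAr.
Qed.

HB.instance Definition _ := GRing.Lmodule_isLalgebra.Build K (fps T) fps_scaleAl.
HB.instance Definition _ := GRing.Lalgebra_isAlgebra.Build K (fps T) fps_scaleAr.
HB.instance Definition _ := GRing.NzRing_hasMulInverse.Build (fps T)
  (@cmulVx _) (@cmulxV _) (@cunitP _) (@cinv_out _).

Definition fps_hbar (X : T) : fps T := fun n => if n == 1%N then X else 0.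

(* The exponential sum_j f^j / j! of a series f without constant term: then
   f^j does not contribute to the coefficient of hbar^n for j > n. *)
Definition fps_exp f : fps T :=
  fun n => \sum_(j < n.+1) (j`!%:R : K)^-1 *: (f ^+ j) n.

End FormalSeries.

Section Span.
Variables (K : fieldType) (V : lmodType K).

Inductive lspan (S : set V) : V -> Prop :=
| lspan0 : lspan S 0
| lspanZD a u v : S u -> lspan S v -> lspan S (a *: u + v).

Lemma lspan_lin S a u v : lspan S u -> lspan S v -> lspan S (a *: u + v).
Proof.
move=> + Sv; elim=> [|b w w' Sw _ IH]; first by rewrite scaler0 add0r.
by rewrite scalerDr scalerA -addrA; apply: lspanZD.
Qed.

Lemma sub_lspan S u : S u -> lspan S u.
Proof.
by move=> Su; rewrite -[u]addr0 -[u]scale1r; apply: lspanZD => //; exact: lspan0.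
Qed.

Lemma lspanD S u v : lspan S u -> lspan S v -> lspan S (u + v).
Proof. by move=> Su Sv; rewrite -[u]scale1r; exact: lspan_lin. Qed.

Lemma lspanZ S a u : lspan S u -> lspan S (a *: u).
Proof. by move=> Su; rewrite -[_ *: _]addr0; apply: lspan_lin => //; exact: lspan0. Qed.

Lemma lspanB S u v : lspan S u -> lspan S v -> lspan S (u - v).
Proof. by move=> Su Sv; rewrite -[- v]scaleN1r addrC; exact: lspan_lin. Qed.

Lemma lspan_sum S (I : Type) (r : seq I) (P : pred I) (F : I -> V) :
  (forall i, P i -> lspan S (F i)) -> lspan S (\sum_(i <- r | P i) F i).
Proof. by move=> SF; elim/big_ind: _ => //; [exact: lspan0 | exact: lspanD]. Qed.

End Span.

Lemma lspan_ind_lin (K : fieldType) (V W : lmodType K) (S : set V) (S' : set W)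
    (f : V -> W) : linear f -> (forall u, S u -> lspan S' (f u)) ->
  forall u, lspan S u -> lspan S' (f u).
Proof.
move=> fl Sf u; elim=> [|a v w Sv _ IH].
  have := fl (-1) 0 0; rewrite scaler0 addr0 scaleN1r addNr => ->; exact: lspan0.
by rewrite fl; apply: lspan_lin => //; exact: Sf.
Qed.

Section Filtrations.
Variables (K : fieldType) (g : lieAlgebra K) (U : envelopingAlgebra g).
Variable T : tensorSquare U.

(* U_{<= k}: the span of the products of at most k elements of g. *)
Definition ue_le (k : nat) : set U :=
  lspan [set \prod_(x <- s) ue_in U x | s in [set s : seq g | (size s <= k)%N]].

(* U_{<= k} (x) U_{<= k} *)
Definition ts_le (k : nat) : set T :=
  lspan [set u | exists a b, [/\ ue_le k a, ue_le k b & u = tens T a b]].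

Lemma ue_leM m n a b : ue_le m a -> ue_le n b -> ue_le (m + n) (a * b).
Proof.
move=> am bn; move: a am; apply: lspan_ind_lin => [c x y|_ [s /= sm <-]].
  by rewrite mulrDl scalerAl.
move: b bn; apply: lspan_ind_lin => [c x y|_ [t /= tn <-]].
  by rewrite mulrDr scalerAr.
apply: sub_lspan; exists (s ++ t); last by rewrite big_cat.
by rewrite /= size_cat leq_add.
Qed.

Lemma ue_le1 k : ue_le k 1.
Proof. by apply: sub_lspan; exists [::]; rewrite ?big_nil. Qed.

Lemma ue_le_in x : ue_le 1 (ue_in U x).
Proof. by apply: sub_lspan; exists [:: x]; rewrite ?big_seq1. Qed.

Lemma ue_le_ad x k a : ue_le k a ->
  ue_le k (ue_in U x * a - a * ue_in U x).
Proof.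
move: a; apply: lspan_ind_lin => [c a b|_ [s /= sk <-]].
  rewrite mulrDr mulrDl scalerBr opprD -scalerAr -scalerAl.
  by rewrite !addrA; congr (_ + _); rewrite addrAC.
elim: s k sk => [|y s IH] k sk.
  by rewrite big_nil mulr1 mul1r subrr; exact: lspan0.
case: k sk => // k sk; rewrite big_cons.
have -> : ue_in U x * (ue_in U y * \prod_(z <- s) ue_in U z) -
    ue_in U y * (\prod_(z <- s) ue_in U z) * ue_in U x =
    ue_in U (br x y) * \prod_(z <- s) ue_in U z +
    ue_in U y * (ue_in U x * \prod_(z <- s) ue_in U z -
                 \prod_(z <- s) ue_in U z * ue_in U x).
  by rewrite ue_in_br mulrBl mulrBr !mulrA addrA subrK.
apply: lspanD; rewrite -add1n; apply: ue_leM; rewrite ?add1n.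
- exact: ue_le_in.
- by apply: sub_lspan; exists s.
- exact: ue_le_in.
- exact: IH.
Qed.

Lemma ts_leM m n u v : ts_le m u -> ts_le n v -> ts_le (m + n) (u * v).
Proof.
move=> um vn; move: u um; apply: lspan_ind_lin => [c x y|_ [a [b [am bm ->]]]].
  by rewrite mulrDl scalerAl.
move: v vn; apply: lspan_ind_lin => [k x y|_ [c [d [cn dn ->]]]].
  by rewrite mulrDr scalerAr.
by apply: sub_lspan; rewrite tensM; exists (a * c), (b * d); split=> //;
  exact: ue_leM.
Qed.

Lemma ts_le1 k : ts_le k 1.
Proof.
by apply: sub_lspan; exists 1, 1; rewrite tens1; split=> //; exact: ue_le1.
Qed.

Lemma ts_le_tens x y : ts_le 1 (tens T (ue_in U x) (ue_in U y)).
Proof.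
by apply: sub_lspan; exists (ue_in U x), (ue_in U y); split=> //; exact: ue_le_in.
Qed.

Lemma ts_le_ad x k u : ts_le k u ->
  ts_le k (tens T (ue_in U x) 1 * u - u * tens T (ue_in U x) 1).
Proof.
move: u; apply: lspan_ind_lin => [c a b|_ [a [b [ak bk ->]]]].
  rewrite mulrDr mulrDl scalerBr opprD -scalerAr -scalerAl.
  by rewrite !addrA; congr (_ + _); rewrite addrAC.
rewrite !tensM mul1r mulr1; apply: sub_lspan.
exists (ue_in U x * a - a * ue_in U x), b; split=> //; first exact: ue_le_ad.
have [_ /(_ b) Tl] := tens_bilinear T.
have := Tl (-1) (a * ue_in U x) (ue_in U x * a).
by rewrite !scaleN1r ![- _ + _]addrC => ->.
Qed.

Definition calA_pred : {pred fps T} := fun f => `[< forall k, ts_le k (f k) >].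

Lemma calA_predP f : reflect (forall k, ts_le k (f k)) (f \in calA_pred).
Proof. exact: asboolP. Qed.

Record calA := CalA { calA_val :> fps T; _ : calA_val \in calA_pred }.

HB.instance Definition _ := [isSub for calA_val].
HB.instance Definition _ := [Choice of calA by <:].

Lemma calA_le (a : calA) k : ts_le k (calA_val a k).
Proof. by have /calA_predP := valP a; apply. Qed.

Lemma calA_subalg : GRing.subalg_closed calA_pred.
Proof.
split=> [|c a b /calA_predP Aa /calA_predP Ab|a b /calA_predP Aa /calA_predP Ab].
- by apply/calA_predP => -[|k]; [exact: ts_le1 | exact: lspan0].
- by apply/calA_predP => k; exact: (lspan_lin c (Aa k) (Ab k)).
- apply/calA_predP => k; apply: lspan_sum => i _.
  by have := ts_leM (Aa i) (Ab (k - i)%N); rewrite subnKC ?leq_ord.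
Qed.

HB.instance Definition _ :=
  GRing.SubChoice_isSubAlgebra.Build K (fps T) calA_pred calA calA_subalg.

(* A_n = A \cap hbar^n U^{(x)2}[[hbar]] *)
Definition filA (n : nat) : set calA := [set a | forall k, (k < n)%N -> calA_val a k = 0].

Lemma filAM n (a b : calA) : filA n b -> filA n (a * b).
Proof.
move=> bn k kn; rewrite /= [LHS]big1 // => i _.
by rewrite bn ?mulr0 // (leq_ltn_trans (leq_subr _ _)).
Qed.

Definition calE_pred : {pred calA -> calA} := fun X =>
  `[< linear X /\ forall n a, filA n a -> filA n (X a) >].

Record calE := CalE { calE_val :> calA -> calA; _ : calE_val \in calE_pred }.

HB.instance Definition _ := [isSub for calE_val].
HB.instance Definition _ := [Choice of calE by <:].

Lemma calE_submod : GRing.submod_closed calE_pred.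
Proof.
split; first by apply/asboolP; split=> [d a b|//]; rewrite scaler0 addr0.
move=> c X Y /asboolP[Xl Xf] /asboolP[Yl Yf]; apply/asboolP; split.
  move=> d a b; rewrite !fctE Xl Yl !scalerDr !scalerA [c * d]mulrC.
  by rewrite addrACA.
move=> n a an k kn; transitivity (c *: calA_val (X a) k + calA_val (Y a) k) => //.
by rewrite (Xf n) // (Yf n) // scaler0 addr0.
Qed.

HB.instance Definition _ :=
  GRing.SubChoice_isSubLmodule.Build K (calA -> calA) calE_pred calE
  calE_submod.

Lemma calE_linear (X : calE) : linear X.
Proof. by have /asboolP[] := valP X. Qed.

Lemma calE_fil (X : calE) n a : filA n a -> filA n (X a).
Proof. by have /asboolP[_] := valP X; apply. Qed.

Lemma calE_one_subproof : (id : calA -> calA) \in calE_pred.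
Proof. exact/asboolP. Qed.

Lemma calE_mul_subproof (X Y : calE) : (X : calA -> calA) \o Y \in calE_pred.
Proof.
apply/asboolP; split=> [c a b|n a an]; first by rewrite /= !calE_linear.
by apply: calE_fil; apply: calE_fil.
Qed.

Definition calE_one : calE := CalE calE_one_subproof.
Definition calE_mul (X Y : calE) : calE := CalE (calE_mul_subproof X Y).

Lemma calE_mulA : associative calE_mul.
Proof. by move=> X Y Z; exact: val_inj. Qed.

Lemma calE_mul1r : left_id calE_one calE_mul.
Proof. by move=> X; exact: val_inj. Qed.

Lemma calE_mulr1 : right_id calE_one calE_mul.
Proof. by move=> X; exact: val_inj. Qed.

Lemma calE_mulDl : left_distributive calE_mul +%R.
Proof. by move=> X Y Z; exact: val_inj. Qed.

Lemma calE_mulDr : right_distributive calE_mul +%R.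
Proof.
move=> X Y Z; apply: val_inj; apply/funext => a.
by have := calE_linear X 1 (Y a) (Z a); rewrite !scale1r.
Qed.

Lemma calE_oner_neq0 : calE_one != 0.
Proof.
apply/eqP => /(congr1 (fun X : calE => (X : calA -> calA) 1)) /= /eqP.
by rewrite oner_eq0.
Qed.

(* The product of calE is composition. *)
HB.instance Definition _ := GRing.Zmodule_isNzRing.Build calE
  calE_mulA calE_mul1r calE_mulr1 calE_mulDl calE_mulDr calE_oner_neq0.
HB.instance Definition _ := GRing.NzRing_hasMulInverse.Build calE
  (@cmulVx _) (@cmulxV _) (@cunitP _) (@cinv_out _).

(* E_n = {X | Im X \subset A_n} *)
Definition filE (n : nat) : set calE := [set X | forall a, filA n ((X : calA -> calA) a)].

Lemma lmulE_subproof (a : calA) : *%R a \in calE_pred.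
Proof.
apply/asboolP; split=> [c b d|n b]; last exact: filAM.
by rewrite mulrDr scalerAr.
Qed.

Definition lmulE (a : calA) : calE := CalE (lmulE_subproof a).

Lemma adA_subproof (x : g) (a : calA) :
  (fun k => tens T (ue_in U x) 1 * calA_val a k - calA_val a k * tens T (ue_in U x) 1)
    \in calA_pred.
Proof. by apply/calA_predP => k; apply: ts_le_ad; exact: calA_le. Qed.

Definition adA (x : g) (a : calA) : calA := CalA (adA_subproof x a).

Lemma adE_subproof (x : g) : adA x \in calE_pred.
Proof.
apply/asboolP; split=> [c a b|n a an k kn]; last first.
  by rewrite /= an // mulr0 mul0r subrr.
apply: val_inj; apply/funext => k /=.
rewrite !fctE mulrDr mulrDl scalerBr opprD -scalerAr -scalerAl.
by rewrite !addrA; congr (_ + _); rewrite addrAC.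
Qed.

(* ad x^{(1)}, acting coefficientwise; note that x^{(1)} is not in calA in
   general. *)
Definition adE (x : g) : calE := CalE (adE_subproof x).

Lemma hbarA_subproof (X : T) : ts_le 1 X -> fps_hbar X \in calA_pred.
Proof.
move=> X1; apply/calA_predP => k; rewrite /fps_hbar.
by case: eqP => [->//|_]; exact: lspan0.
Qed.

Definition hbarA (X : T) (X1 : ts_le 1 X) : calA := CalA (hbarA_subproof X1).

Lemma expA_subproof (a : calA) : fps_exp (calA_val a) \in calA_pred.
Proof.
apply/calA_predP => k; apply: lspan_sum => j _; apply: lspanZ.
suff -> : (calA_val a) ^+ j = calA_val (a ^+ j) by exact: calA_le.
by rewrite -[calA_val]/(val : calA -> fps T) rmorphXn.
Qed.

Definition expA (a : calA) : calA := CalA (expA_subproof a).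

(* The flip extended to power series coefficientwise. *)
Definition fps_flip (f : fps T) : fps T := fun k => flip T (f k).

Section Casimir.
Variable B : g -> g -> K.

Let n := \dim {: g}.
Let e : n.-tuple g := vbasis fullv.

Definition gram : 'M[K]_n := \matrix_(i, j) B (tnth e i) (tnth e j).

(* The image under f (x) f of the tensor Omega of the form B, which is
   sum_(i, j) (gram^-1)_ij e_i (x) e_j: f = id gives Omega, and the projection
   f of g onto h gives Omega_0. *)
Definition Omega_map (f : g -> g) : T :=
  \sum_i \sum_j invmx gram i j *:
    tens T (ue_in U (f (tnth e i))) (ue_in U (f (tnth e j))).

Lemma Omega_map_le f : ts_le 1 (Omega_map f).
Proof.
by apply: lspan_sum => i _; apply: lspan_sum => j _; apply: lspanZ;
  exact: ts_le_tens.
Qed.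

Definition hbarOmega : calA := hbarA (Omega_map_le id).
Definition hbarOmega0 (p : 'End(g)) : calA := hbarA (Omega_map_le p).

End Casimir.

End Filtrations.

Section ComplexPlane.
Variable R : realType.
Local Notation C := R[i].

Definition cderivable (f : C -> C) (z : C) :=
  derivable (f : C^o -> C^o) (z : C^o) (1 : C^o).

Definition has_cderivative (f : C -> C) (z d : C) :=
  is_derive (z : C^o) (1 : C^o) (f : C^o -> C^o) (d : C^o).

Definition cabs (z : C) : R := ComplexField.Normc.normc z.

(* The argument in ]-pi, pi]. *)
Definition carg (z : C) : R :=
  if 0 <= complex.Im z then acos (complex.Re z / cabs z)
  else - acos (complex.Re z / cabs z).

Definition clog (z : C) : C := (ln (cabs z))%:C + (carg z)%:C * 'i%C.

(* C \ R_{<= 0} and C \ R_{>= 0} *)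
Definition slitL : set C := [set z | ~ (complex.Im z = 0 /\ complex.Re z <= 0)].
Definition slitR : set C := [set z | ~ (complex.Im z = 0 /\ 0 <= complex.Re z)].

Definition upper : set C := [set z | 0 < complex.Im z].
Definition lower : set C := [set z | complex.Im z < 0].

(* z tends to infinity in D inside the sector delta < |arg z| < pi - delta. *)
Definition sector_infty (D : set C) (delta : R) : set_system C :=
  [set P | exists M : R, forall z, D z -> delta < `|carg z| < pi - delta ->
    M < cabs z -> P z].

(* Holomorphy, derivatives and limits in a vector space V with a decreasing
   filtration F by subspaces of finite codimension are those of all the
   truncations in the finite-dimensional spaces V / F_n, tested on the linear
   functionals of V / F_n. *)
Section Truncations.
Variables (V : lmodType C) (F : nat -> set V).

Definition trunc_functional (n : nat) (l : {scalar V}) :=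
  forall x, F n x -> l x = 0.

Definition holomorphic (D : set C) (f : C -> V) :=
  forall n l, trunc_functional n l ->
  forall z, D z -> cderivable (fun w => l (f w)) z.

Definition has_derivative (f : C -> V) (z : C) (d : V) :=
  forall n l, trunc_functional n l ->
  has_cderivative (fun w => l (f w)) z (l d).

Definition converges (I : Type) (G : set_system I) (f : I -> V) (x : V) :=
  forall n l, trunc_functional n l ->
  (l (f i) : C^o) @[i --> G] --> (l x : C^o).

(* f' is the analytic continuation of f from D to a connected D'. *)
Definition continuation (D D' : set C) (f f' : C -> V) :=
  holomorphic D' f' /\ (forall z, D z -> f' z = f z).

End Truncations.

End ComplexPlane.

Section Chambers.
Variables (R : realType) (g : lieAlgebra R[i]) (h : {vspace g}).

Definition hR_reg : set (subvs_of h) :=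
  [set t | forall alpha : {scalar subvs_of h}, is_root alpha ->
    complex.Im (alpha t) = 0 /\ alpha t != 0].

(* Linear coordinates on h, which give it its topology. *)
Definition hcoord (t : subvs_of h) : 'rV[R[i]^o]_(\dim {: subvs_of h}) :=
  \row_i coord (vbasis {: subvs_of h}) i t.

Definition chamber (Ch : set (subvs_of h)) := exists2 t, hR_reg t &
  hcoord @` Ch = connected_component (hcoord @` hR_reg) (hcoord t).

End Chambers.

Section DynamicalKZ.
Variables (R : realType) (g : lieAlgebra R[i]) (h : {vspace g}).
Variables (U : envelopingAlgebra g) (T : tensorSquare U).
Variables (B : g -> g -> R[i]) (p : 'End(g)) (mu : subvs_of h).
Local Notation C := R[i].
Local Notation calA := (calA T).
Local Notation calE := (calE T).

(* The sum of the exponential series; each calE / filE n is a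
   finite-dimensional algebra, in which the series converges. *)
Definition expE (X : calE) : calE :=
  xget 0 [set Y | converges (@filE _ _ _ T) \oo
    (fun N : nat => \sum_(j < N) (j`!%:R : C)^-1 *: X ^+ j) Y].

(* \mathsf h a = hbar a / (2 pi i) *)
Definition sfh (a : calA) : calA := (2 * (pi : R)%:C * 'i%C)^-1 *: a.

Definition hOmega : calA := sfh (hbarOmega T B).
Definition hOmega0 : calA := sfh (hbarOmega0 T B p).

(* z^a = exp (a log z) *)
Definition cpow (z : C) (a : calA) : calA := expA (clog z *: a).

Definition ad_mu : calE := adE T (vsval mu).

Definition dkz_solution (D : set C) (Y : C -> calE) := forall z, D z ->
  has_derivative (@filE _ _ _ T) Y z ((z^-1 *: lmulE hOmega + ad_mu) * Y z).

Definition Upsilon0 (H0 : C -> calA) (z : C) : calE :=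
  expE (z *: ad_mu) * lmulE (H0 z) * lmulE (cpow z hOmega).

Definition canonical_at_0 (H0 : C -> calA) :=
  [/\ holomorphic (@filA _ _ _ T) setT H0, H0 0 = 1
    & dkz_solution (@slitL R) (Upsilon0 H0)].

Definition Upsilon_infty (H : C -> calA) (z : C) : calE :=
  lmulE (H z) * lmulE (cpow z hOmega0) * expE (z *: ad_mu).

(* D is one of the half-planes H_+ and H_-. *)
Definition canonical_at_infty (D : set C) (H : C -> calA) :=
  [/\ holomorphic (@filA _ _ _ T) D H,
      forall delta : R, 0 < delta ->
        converges (@filA _ _ _ T) (sector_infty D delta) H 1
    & dkz_solution D (Upsilon_infty H)].

(* Y is the canonical solution on D, continued analytically to D'. *)
Definition continued_solution (D D' : set C) (H : C -> calA) (Y : C -> calE) :=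
  continuation (@filE _ _ _ T) D D' (Upsilon_infty H) Y.

Definition twist (H0 : C -> calA) (Y : C -> calE) (J : calA) :=
  forall z, slitL z -> (Upsilon0 H0 z)^-1 * Y z = lmulE J.

(* Yp, Ym are continued to C \ R_{<= 0}. *)
Definition stokes_plus (Yp Ym : C -> calE) (S : calA) :=
  forall z, lower z -> Yp z = Ym z * lmulE S.

(* Ym' is Upsilon_- continued across R_{< 0}. *)
Definition stokes_minus (Yp Ym' : C -> calE) (S : calA) :=
  forall z, upper z ->
    Ym' z * lmulE (expA (hbarOmega0 T B p)) = Yp z * lmulE S.

Definition Rmatrix (J : calA) : fps T :=
  (fps_flip J)^-1 * (expA (2^-1 *: hbarOmega T B) : fps T) * (J : fps T).

End DynamicalKZ.

(* Main.v *)
Require Import Defs.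
From HB Require Import structures.
From mathcomp Require Import ring lra.
From mathcomp Require Import all_boot all_order all_algebra.
From mathcomp Require Import all_classical all_reals all_analysis.
From mathcomp.real_closed Require Import complex.
Set Implicit Arguments. Unset Strict Implicit. Unset Printing Implicit Defensive.
Import Order.TTheory GRing.Theory Num.Theory.
Import numFieldNormedType.Exports.
Local Open Scope complex_scope.
Local Open Scope classical_set_scope.
Local Open Scope ring_scope.

(** Every operator identity is evaluated at the element 1 of A. The flip of
    tensor factors combined with z |-> -z is a symmetry of the DKZ equation:
    by uniqueness H_0^21(-z) = H_0(z), H_- is invariant under
    ad (mu^(1) + mu^(2)), and H_-^21(-z) = H_+(z). Comparing the determinations
    of log z and log (-z), this gives
    J_-^21 e^(pi i h Omega_0) = e^(pi i h Omega) J_+. Moreover J_+ = J_- S_+, and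
    continuity of the continuation of Upsilon_- at z = -1 gives
    e^(pi i h Omega) J_+ S_- = e^(- pi i h Omega) J_- e^(2 pi i h Omega_0);
    the theorem follows by algebra. Both uniqueness statements are needed only
    on the imaginary axis, where the leading hbar-coefficient of a difference
    of two solutions has eigen-coordinates f with f' = i a f for a real a (the
    eigenvalues of ad mu are real), so |f| is constant while f tends to 0. *)

(** * Common eigenvectors *)

(** Evaluating at 1 works because ad mu^(1) kills 1: [Upsilon_infty H z 1] is H(z) z^(h Omega_0),
    and Y = Upsilon_0 J becomes an identity in A. Holomorphy and limits are only tested on truncated
    functionals, so the quotients A / A_n are made concrete by bases of U_{<=k} (x) U_{<=k}
    diagonalizing ad mu^(1) and ad mu^(2) at once; exp (z ad mu^(1)), given only as a limit, is then
    diagonal. Leading coefficients decide because h Omega lies in A_1 and z^(h Omega), z^(h Omega_0)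
    lie in 1 + A_1: on a difference already in A_n they do not affect the coefficient of hbar^n, so
    powers of z are neither differentiated nor bounded. The same congruences make every cancelled
    factor invertible, its constant term being 1. The flip turns mu^(1) into mu^(2), and z |-> -z
    repairs the sign only where ad mu^(2) = - ad mu^(1). This is why weight zero is established, for
    Omega by invariance of the form, for Omega_0 because h is abelian, and for H_- by uniqueness. *)

Lemma linear_fun0 (K : fieldType) (V W : lmodType K) (f : V -> W) : linear f -> f 0 = 0.
Proof. by move=> fl; have := fl (-1) 0 0; rewrite scaler0 addr0 scaleN1r addNr. Qed.

Lemma linear_funZ (K : fieldType) (V W : lmodType K) (f : V -> W) :
  linear f -> forall a u, f (a *: u) = a *: f u.
Proof. by move=> fl a u; have := fl a u 0; rewrite (linear_fun0 fl) !addr0. Qed.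

Lemma linear_funD (K : fieldType) (V W : lmodType K) (f : V -> W) :
  linear f -> forall u v, f (u + v) = f u + f v.
Proof. by move=> fl u v; have := fl 1 u v; rewrite !scale1r. Qed.

Lemma lspan_mono (K : fieldType) (V : lmodType K) (S S' : set V) u :
  S `<=` S' -> lspan S u -> lspan S' u.
Proof.
move=> SS'; elim=> [|a v w Sv _ IH]; first exact: lspan0.
by apply: lspanZD => //; exact: SS'.
Qed.

(** The basis is picked from the list itself, so a property of the listed vectors, such as being
    eigenvectors, passes to it. The coordinates are functions on all of V because the span has no
    type of its own; they are meaningful, and linear, on the span only. *)
Lemma lspan_basis (K : fieldType) (V : lmodType K) (s : seq V) :
  exists d (t : 'I_d -> V) (c : 'I_d -> V -> K),
  [/\ forall i, t i \in s,
      forall u, lspan [set` s] u -> u = \sum_i c i u *: t i,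
      forall i j, c i (t j) = (i == j)%:R &
      forall i a u v, lspan [set` s] u -> lspan [set` s] v ->
        c i (a *: u + v) = a * c i u + c i v].
Proof.
elim: s => [|x s [d [t [c [ts cE ct clin]]]]].
  exists 0%N, (fun=> 0), (fun _ _ => 0); split=> [[]//| |[]//|[]//].
  move=> u; rewrite big_ord0; elim=> // a v w /=; rewrite /mkset in_nil //.
case: (pselect (lspan [set` s] x)) => [sx|nsx].
  exists d, t, c.
  have sE u : lspan [set` x :: s] u -> lspan [set` s] u.
    elim=> [|a v w /=]; first exact: lspan0.
    rewrite /mkset inE => /orP[/eqP ->|vs] _ IH; first exact: lspan_lin.
    exact: lspanZD.
  split=> // [i|u /sE/cE//|i a u v /sE us /sE vs]; last exact: clin.
  by rewrite inE ts orbT.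
(* When x is outside the span of s, its coefficient in u is well defined: two values would express x
   through s. *)
have uniq a b u : lspan [set` s] (u - a *: x) -> lspan [set` s] (u - b *: x) -> a = b.
  move=> ua ub; apply/eqP; rewrite -subr_eq0; apply/negP => /negP ab0; apply: nsx.
  have -> : x = (a - b)^-1 *: ((u - b *: x) - (u - a *: x)).
    rewrite opprB [X in _ *: X]addrC addrA subrK -scalerBl.
    by rewrite scalerA mulVf ?scale1r.
  by apply/lspanZ/lspanB.
pose k u := xget 0 [set a | lspan [set` s] (u - a *: x)].
have kE a u : lspan [set` s] (u - a *: x) -> k u = a.
  by move=> ua; rewrite /k; case: xgetP => [_ -> /(uniq _ _ _ ua)//|/(_ a)].
have exk u : lspan [set` x :: s] u -> lspan [set` s] (u - k u *: x).
  move=> us; suff [a ua] : exists a, lspan [set` s] (u - a *: x) by rewrite (kE _ _ ua).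
  elim: us => [|a v w /= + _ [b wb]].
    by exists 0; rewrite scale0r subr0; exact: lspan0.
  rewrite /mkset inE => /orP[/eqP ->|vs].
    by exists (a + b); rewrite scalerDl opprD addrACA subrr add0r.
  by exists b; rewrite -addrA; exact: lspanZD.
have tspan j : lspan [set` s] (t j) by apply: sub_lspan; exact: ts.
have c0 i : c i 0 = 0.
  have := clin i (-1) 0 0 (lspan0 _) (lspan0 _).
  by rewrite scaler0 addr0 mulN1r addNr.
have kx : k x = 1 by apply: kE; rewrite scale1r subrr; exact: lspan0.
have kt j : k (t j) = 0 by apply: kE; rewrite scale0r subr0.
exists d.+1, (fun i => oapp t x (unlift ord0 i)),
  (fun i u => if unlift ord0 i is Some j then c j (u - k u *: x) else k u).
split.
- by move=> i; case: unliftP => [j _|_] /=; rewrite inE ?ts ?orbT ?eqxx.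
- move=> u us; rewrite big_ord_recl /= unlift_none /=.
  under eq_bigr do rewrite liftK /=.
  by rewrite -cE ?subrKC //; exact: exk.
- move=> i j; case: (unliftP ord0 i) => [i' ->|->]; case: (unliftP ord0 j) => [j' ->|->] /=.
  + by rewrite kt scale0r subr0 ct (inj_eq (@lift_inj _ _)).
  + by rewrite kx scale1r subrr c0.
  + by rewrite kt.
  + by rewrite kx ?eqxx.
- move=> i a u v us vs.
  have kl : k (a *: u + v) = a * k u + k v.
    apply: kE; rewrite scalerDl -scalerA opprD addrACA -scalerBr.
    by apply: lspan_lin; exact: exk.
  case: (unliftP ord0 i) => [i' _|_] //.
  rewrite -clin; [|exact: exk..]; congr (c _ _).
  by rewrite kl scalerDl -scalerA opprD addrACA -scalerBr.
Qed.

Section EigenProjection.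
Variables (K : fieldType) (V : lmodType K) (f : V -> V).
Hypothesis fl : linear f.

(** Lagrange interpolation: the product of the (f - c') / (c - c') over the c' in cs other than c,
    hence the projection onto the c-eigenspace when f is diagonalizable with eigenvalues in cs. *)
Definition eigen_proj (cs : seq K) (c : K) (x : V) : V :=
  foldr (fun c' y => if c' == c then y else (c - c')^-1 *: (f y - c' *: y)) x cs.

Lemma eigen_proj_linear cs c : linear (eigen_proj cs c).
Proof.
elim: cs => [|c' cs IH] a u v //=; case: eqP => _; first exact: IH.
rewrite IH fl !scalerBr !scalerDr !scalerA opprD addrACA.
by rewrite [_^-1 * a]mulrC [_ * c' * a]mulrAC [_^-1 * a]mulrC.
Qed.

(** A polynomial in f commutes with whatever commutes with f, so splitting a vector by f leaves it
    an eigenvector of h. *)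
Lemma eigen_proj_comm (h : V -> V) a x cs c : linear h ->
  (forall y, h (f y) = f (h y)) -> h x = a *: x ->
  h (eigen_proj cs c x) = a *: eigen_proj cs c x.
Proof.
move=> hl hf hx; elim: cs => [|c' cs IH] //=; case: eqP => // _.
have hZ := linear_funZ hl.
have hD := linear_funD hl.
have fZ := linear_funZ fl.
rewrite hZ hD -scaleNr hZ hf IH fZ !scalerA ![_ * a]mulrC -!scalerA -scalerDr.
by rewrite !scalerA [_ * a]mulrC -scalerA scaleNr.
Qed.

Lemma eigen_projE b y cs c : f y = b *: y ->
  eigen_proj cs c y = (\prod_(c' <- cs | c' != c) ((c - c')^-1 * (b - c'))) *: y.
Proof.
move=> fy; elim: cs => [|c' cs IH] /=; first by rewrite big_nil scale1r.
rewrite big_cons; case: eqP => //= _.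
have fZ := linear_funZ fl.
rewrite IH fZ fy !scalerA -scalerBl scalerA; congr (_ *: _).
by rewrite -mulrA; congr (_ * _); rewrite mulrBl [b * _]mulrC.
Qed.

Lemma eigen_proj_id b y cs : f y = b *: y -> eigen_proj cs b y = y.
Proof.
move=> fy; rewrite (eigen_projE _ _ fy) big1 ?scale1r // => c cb.
by rewrite mulVf // subr_eq0 eq_sym.
Qed.

Lemma eigen_proj0 b y cs c : f y = b *: y -> b \in cs -> c != b ->
  eigen_proj cs c y = 0.
Proof.
move=> fy bcs cb; rewrite (eigen_projE _ _ fy) (big_rem b) //= eq_sym cb.
by rewrite subrr mulr0 mul0r scale0r.
Qed.

Variables (e : seq V) (cs : seq K).
Hypothesis ecs : forall y, y \in e -> exists2 b, b \in cs & f y = b *: y.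

(** On an eigenvector from e one projection is the identity and the others vanish; [undup] keeps
    that one from being counted twice. *)
Lemma eigen_proj_sum x : lspan [set` e] x ->
  x = \sum_(c <- undup cs) eigen_proj cs c x.
Proof.
elim=> [|a u v /= ue _ IH].
  rewrite big1 // => c _.
  exact: linear_fun0 (eigen_proj_linear cs c).
under eq_bigr do rewrite eigen_proj_linear.
rewrite big_split -scaler_sumr /= -IH; congr (_ *: _ + _).
have [b bcs fu] := ecs ue.
rewrite (big_rem b) ?mem_undup //= (eigen_proj_id _ fu) big_seq big1 ?addr0 // => c.
by rewrite mem_rem_uniq ?undup_uniq // inE => /andP[cb _]; exact: eigen_proj0 fu bcs cb.
Qed.

Lemma eigen_proj_eigen x c : lspan [set` e] x ->
  f (eigen_proj cs c x) = c *: eigen_proj cs c x.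
Proof.
have f0 := linear_fun0 fl.
have fZ := linear_funZ fl.
elim=> [|a u v /= ue _ IH].
  have -> : eigen_proj cs c 0 = 0.
    exact: linear_fun0 (eigen_proj_linear cs c).
  by rewrite f0 scaler0.
rewrite eigen_proj_linear fl IH scalerDr; congr (_ + _).
have [b bcs fu] := ecs ue.
have [->|cb] := eqVneq c b; last by rewrite (eigen_proj0 fu bcs cb) f0 !scaler0.
by rewrite (eigen_proj_id _ fu) fu !scalerA mulrC.
Qed.

End EigenProjection.

(** Simultaneous diagonalization by induction on the operators: each vector found so far is replaced
    by its components in the eigenspaces of the next operator. *)
Lemma common_eigenvectors (K : fieldType) (V : lmodType K) (I : eqType) (F : I -> V -> V)
    (r : seq I) (e0 : seq V) :
  (forall i, linear (F i)) ->
  {in r &, forall i j, forall x, F i (F j x) = F j (F i x)} ->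
  (forall x, lspan [set` e0] x) ->
  (forall i, i \in r -> exists2 e : seq V, (forall x, lspan [set` e] x) &
     forall x, x \in e -> exists c, F i x = c *: x) ->
  exists2 s : seq V, (forall x, lspan [set` s] x) &
    forall i x, i \in r -> x \in s -> exists c, F i x = c *: x.
Proof.
move=> Fl; elim: r => [|i r IH] comm e0s ediag; first by exists e0.
have [|||s ss sE] // := IH.
- by move=> j k jr kr; apply: comm; rewrite inE ?jr ?kr orbT.
- by move=> j jr; apply: ediag; rewrite inE jr orbT.
have [e es eE] := ediag i (mem_head _ _).
have [cs csE] : exists cs : seq K, forall x, x \in e -> exists2 c, c \in cs & F i x = c *: x.
  elim: e eE {es} => [|x e IHe] eE; first by exists [::].
  have [|cs csE] := IHe; first by move=> y ye; apply: eE; rewrite inE ye orbT.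
  have [c xc] := eE x (mem_head _ _).
  exists (c :: cs) => y; rewrite inE => /orP[/eqP ->|/csE[d dcs yd]].
    by exists c; rewrite ?mem_head.
  by exists d; rewrite // inE dcs orbT.
exists [seq eigen_proj (F i) cs c x | x <- s, c <- undup cs].
  move=> x; elim: (ss x) => [|a u v /= us _ IHv]; first exact: lspan0.
  apply: lspan_lin => //; rewrite (eigen_proj_sum (Fl i) csE (es u)) big_seq.
  apply: lspan_sum => c cc; apply: sub_lspan => /=; rewrite /mkset.
  by apply/allpairsP; exists (u, c).
move=> j x; rewrite inE => jr /allpairsP[[y c] /= [ys cc ->]].
have [->|ji] := eqVneq j i; first by exists c; exact: (eigen_proj_eigen (Fl i) csE).
have {}jr : j \in r by move: jr; rewrite (negbTE ji).
have [a ja] := sE _ _ jr ys.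
exists a; apply: eigen_proj_comm => // z; apply: comm; rewrite ?mem_head //.
by rewrite inE jr orbT.
Qed.

Definition scalar_of (K : fieldType) (V : lmodType K) (f : V -> K) (fl : scalar f) :
  {scalar V} := HB.pack f (GRing.isLinear.Build K V K *%R f fl).

Section LieBasics.
Variables (K : fieldType) (g : lieAlgebra K).

Lemma br0r (x : g) : br x 0 = 0.
Proof. exact: linear_fun0 (br_linearr x). Qed.

Lemma brDr (x y z : g) : br x (y + z) = br x y + br x z.
Proof. exact: linear_funD (br_linearr x) _ _. Qed.

Lemma brZr (x : g) a (y : g) : br x (a *: y) = a *: br x y.
Proof. exact: linear_funZ (br_linearr x) _ _. Qed.

Lemma brNr (x y : g) : br x (- y) = - br x y.
Proof. by rewrite -scaleN1r brZr scaleN1r. Qed.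

Lemma brDl (x y z : g) : br (y + z) x = br y x + br z x.
Proof. exact: linear_funD (br_linearl x) _ _. Qed.

Lemma br0l (x : g) : br 0 x = 0.
Proof. exact: linear_fun0 (br_linearl x). Qed.

Lemma brC (x y : g) : br x y = - br y x.
Proof.
apply/eqP; rewrite -addr_eq0; have := brxx (x + y).
by rewrite brDl !brDr !brxx add0r addr0 => ->.
Qed.

Lemma vbasis_lspan (V : vectType K) (W : {vspace V}) x : x \in W -> lspan [set` val (vbasis W)] x.
Proof.
move=> xW; rewrite (coord_vbasis xW); apply: lspan_sum => i _.
by apply: lspanZ; apply: sub_lspan; rewrite /= /mkset mem_nth // size_tuple.
Qed.

Variable h : {vspace g}.
Hypothesis hc : cartan h.

Lemma cartan_common_eigenvectors : exists2 s : seq g, (forall x, lspan [set` s] x) &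
  forall x, x \in s -> forall t, t \in h -> exists c, br t x = c *: x.
Proof.
have [hab hself hdiag] := hc.
have [||||s ss sE] := @common_eigenvectors K g g (@br K g) (vbasis h) (vbasis fullv).
- exact: br_linearr.
- move=> t u /vbasis_mem th /vbasis_mem uh x.
  (* With [t, u] = 0 the Jacobi identity says that ad t and ad u commute. *)
  have := br_jacobi t u x; rewrite (hab t u) // br0r addr0.
  by rewrite [br x t]brC brNr => /eqP; rewrite subr_eq0 => /eqP.
- by move=> x; apply: vbasis_lspan; rewrite memvf.
- move=> t /vbasis_mem /hdiag[e eb eE]; exists e => // x.
  have: x \in <<e>>%VS by rewrite (span_basis eb) memvf.
  move=> /(coord_span (X := in_tuple e)) ->; apply: lspan_sum => i _.
  by apply/lspanZ/sub_lspan; rewrite /= /mkset mem_nth.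
exists s => // x xs t th.
elim: (vbasis_lspan th) => [|a u v /= ub _ [c vx]]; first by exists 0; rewrite br0l scale0r.
have [d ux] := sE _ _ ub xs; exists (a * d + c).
have := br_linearl x a u v; rewrite ux vx => ->.
by rewrite scalerDl scalerA.
Qed.

End LieBasics.

(** * Real eigenvalues of ad mu *)

Section Reality.
Variables (R : realType) (g : lieAlgebra R[i]) (h : {vspace g}).

Lemma chamber_hR_reg (Ch : set (subvs_of h)) mu : chamber Ch -> Ch mu -> hR_reg mu.
Proof.
move=> [t _ ChE] Cmu.
have : (@hcoord R g h @` @hR_reg R g h) (hcoord mu).
  apply: (@connected_component_sub _ _ (hcoord t)).
  by rewrite -ChE; exists mu.
move=> [s sreg smu]; suff -> : mu = s by [].
rewrite (coord_vbasis (memvf mu)) [RHS](coord_vbasis (memvf s)).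
apply: eq_bigr => i _; congr (_ *: _).
by have /rowP/(_ i) := smu; rewrite !mxE.
Qed.

Variables (p : 'End(g)) (mu : subvs_of h).
Hypotheses (hc : cartan h) (hp : cartan_projection h p) (hmu : hR_reg mu).

(** A common eigenvector of h defines a linear form on h. If the form is nonzero it is a root: [p]
    kills the vector, and regularity of mu makes the eigenvalue real. If it vanishes, the vector
    centralizes h and therefore lies in h. *)
Lemma cartan_eigenbasis : exists2 s : seq g, (forall x, lspan [set` s] x) &
  forall x, x \in s -> p x \in h /\ exists a : R, br (vsval mu) x = a%:C *: x.
Proof.
have [s ss sE] := cartan_common_eigenvectors hc.
exists s => // x xs; have [hab hself _] := hc; have [ph proot] := hp.
have [->|x0] := eqVneq x 0.
  by rewrite linear0 mem0v; split=> //; exists 0; rewrite br0r scaler0.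
pose al (t : subvs_of h) : R[i] := xget 0 [set c | br (vsval t) x = c *: x].
have alE (t : subvs_of h) : br (vsval t) x = al t *: x.
  rewrite /al; case: xgetP => [c _ //|no].
  by have [c tc] := sE x xs _ (subvsP t); case: (no c).
have all : scalar al.
  move=> a u v; apply/eqP; rewrite -subr_eq0.
  have : (al (a *: u + v) - (a * al u + al v)) *: x = 0.
    rewrite scalerBl scalerDl -scalerA -!alE linearP.
    by rewrite (br_linearl x a (vsval u) (vsval v)) subrr.
  by move/eqP; rewrite scaler_eq0 (negbTE x0) orbF.
case: (pselect (exists t, al t != 0)) => [alnz|al0].
  have rt : is_root (scalar_of all) by split=> //; exists x.
  split; first by rewrite (proot _ _ rt) ?mem0v.
  have [Im0 _] := hmu rt; exists (complex.Re (al mu)); rewrite alE; congr (_ *: _).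
  by rewrite [LHS]complexE Im0 mulr0 addr0.
have {}al0 t : al t = 0 by apply: contrapT => /eqP tn; apply: al0; exists t.
split; last by exists 0; rewrite alE al0.
have xh : x \in h.
  apply: hself => t th; have := alE (vsproj h t); rewrite vsprojK // => ->.
  by rewrite al0 scale0r.
by rewrite ph.
Qed.

(** A Cartan projection is prescribed on h and on root vectors only; its image lies in h because
    these vectors span g. *)
Lemma cartan_projection_mem x : p x \in h.
Proof.
have [s ss sE] := cartan_eigenbasis.
elim: (ss x) => [|a u v /= us _ IH]; first by rewrite linear0 mem0v.
by rewrite linearP; apply: rpredD => //; apply: rpredZ; case: (sE u us).
Qed.

End Reality.

(** * Enveloping algebras and Casimir tensors *)

Section Words.
Variable T : eqType.

Fixpoint words (s : seq T) (k : nat) : seq (seq T) :=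
  if k is k'.+1 then [::] :: [seq x :: w | x <- s, w <- words s k'] else [:: [::]].

Lemma mem_words s k w : (w \in words s k) = (size w <= k)%N && all (mem s) w.
Proof.
elim: k w => [|k IH] [|x w] //=; rewrite inE /= ltnS.
apply/allpairsP/and3P => [[[y v] /= [ys vw [-> ->]]]|[wk xs ws]].
  by move: vw; rewrite IH => /andP[].
by exists (x, w); rewrite /= IH wk.
Qed.

End Words.

Section Enveloping.
Variables (K : fieldType) (g : lieAlgebra K) (U : envelopingAlgebra g).
Variable T : tensorSquare U.

(** Finitely many words suffice, which is the finite dimension of U_{<=k}; letters are expanded one
    at a time, keeping the length bound. *)
Lemma ue_le_words (s : seq g) k a : (forall x, lspan [set` s] x) -> ue_le k a ->
  lspan [set \prod_(x <- w) ue_in U x | w in [set` words s k]] a.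
Proof.
move=> ss; elim=> [|b u v [w /= wk <-] _ IH]; first exact: lspan0.
apply: lspan_lin => // {b v IH}.
elim: k w wk => [|k IH] [|x w] //= wk; rewrite ?big_nil.
- by apply: sub_lspan; exists [::]; rewrite ?big_nil //= mem_words.
- by apply: sub_lspan; exists [::]; rewrite ?big_nil //= mem_words.
rewrite big_cons; have {}IH := IH w wk.
elim: (ss x) => [|b y z /= ys _ IHz]; first by rewrite linear0 mul0r; exact: lspan0.
rewrite linearP mulrDl -scalerAl; apply: lspan_lin => // {IHz}.
move: IH; apply: lspan_ind_lin => [c u1 u2|_ [v /= + <-]].
  by rewrite mulrDr scalerAr.
rewrite /mkset mem_words => /andP[vk vs]; apply: sub_lspan; exists (y :: v).
  by change (y :: v \in words s k.+1); rewrite mem_words /= ltnS vk vs andbT.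
by rewrite big_cons.
Qed.

Lemma tens_lspan (S S' : set U) (P : set T) a b :
  (forall a b, S a -> S' b -> P (tens T a b)) ->
  lspan S a -> lspan S' b -> lspan P (tens T a b).
Proof.
move=> SP Sa Sb; have [Tl Tr] := tens_bilinear T.
have T0 c : tens T 0 c = 0 by exact: linear_fun0 (Tr c).
move: b Sb; apply: lspan_ind_lin => [|b Sb]; first exact: Tl.
elim: Sa => [|c u v Su _ IH]; first by rewrite T0; exact: lspan0.
rewrite Tr; apply: lspan_lin => //; apply: sub_lspan; exact: SP.
Qed.

Lemma tensDl (a b c : U) : tens T (a + b) c = tens T a c + tens T b c.
Proof. exact: linear_funD ((tens_bilinear T).2 c) _ _. Qed.

Lemma tensDr (a b c : U) : tens T c (a + b) = tens T c a + tens T c b.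
Proof. exact: linear_funD ((tens_bilinear T).1 c) _ _. Qed.

Lemma tens0l (c : U) : tens T 0 c = 0.
Proof. exact: linear_fun0 ((tens_bilinear T).2 c). Qed.

Lemma tens0r (c : U) : tens T c 0 = 0.
Proof. exact: linear_fun0 ((tens_bilinear T).1 c). Qed.

Lemma tensZl s (a c : U) : tens T (s *: a) c = s *: tens T a c.
Proof. exact: linear_funZ ((tens_bilinear T).2 c) _ _. Qed.

Lemma tensZr s (a c : U) : tens T c (s *: a) = s *: tens T c a.
Proof. exact: linear_funZ ((tens_bilinear T).1 c) _ _. Qed.

Lemma tensBl (a b c : U) : tens T (a - b) c = tens T a c - tens T b c.
Proof. by rewrite tensDl -scaleN1r tensZl scaleN1r. Qed.
Lemma tensBr (a b c : U) : tens T c (a - b) = tens T c a - tens T c b.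
Proof. by rewrite tensDr -scaleN1r tensZr scaleN1r. Qed.

Lemma flipE (a b : U) : flip T (tens T a b) = tens T b a.
Proof. by rewrite /flip; case: cid. Qed.

Lemma ts_le_flip k u : ts_le k u -> ts_le k (flip T u).
Proof.
apply: lspan_ind_lin => [c v w|_ [a [b [ak bk ->]]]]; first by rewrite linearP.
by rewrite flipE; apply: sub_lspan; exists b, a.
Qed.

(** The flip is known on pure tensors, and elements of bounded degree are given as combinations of
    these. *)
Lemma flipM m n u v : ts_le m u -> ts_le n v -> flip T (u * v) = flip T u * flip T v.
Proof.
move=> um vn; elim: um => [|c _ w [a [b [_ _ ->]]] _ IH].
  by rewrite mul0r !linear0 mul0r.
rewrite mulrDl -scalerAl !linearP IH mulrDl -scalerAl; congr (_ *: _ + _).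
elim: vn => [|d _ x [a' [b' [_ _ ->]]] _ {}IH].
  by rewrite mulr0 !linear0 mulr0.
by rewrite mulrDr -scalerAr !linearP IH mulrDr -scalerAr tensM !flipE tensM.
Qed.

Lemma flipK k u : ts_le k u -> flip T (flip T u) = u.
Proof.
elim=> [|c _ w [a [b [_ _ ->]]] _ IH]; first by rewrite !linear0.
by rewrite !linearP IH !flipE.
Qed.

Lemma flip1 : flip T 1 = 1.
Proof. by rewrite -(tens1 T) flipE. Qed.

Lemma flip_ad k x u : ts_le k u ->
  flip T (tens T (ue_in U x) 1 * u - u * tens T (ue_in U x) 1) =
  tens T 1 (ue_in U x) * flip T u - flip T u * tens T 1 (ue_in U x).
Proof.
move=> uk; have x1 : ts_le 1 (tens T (ue_in U x) 1).
  by apply: sub_lspan; exists (ue_in U x), 1; split=> //; [exact: ue_le_in|exact: ue_le1].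
by rewrite linearB (flipM x1 uk) (flipM uk x1) flipE.
Qed.

End Enveloping.

(** * Joint eigenvectors in bounded degree *)

Section EigenCoordinates.
Variables (R : realType) (g : lieAlgebra R[i]) (U : envelopingAlgebra g).
Variables (T : tensorSquare U) (x : g).
Local Notation C := R[i].
Local Notation m1 := (tens T (ue_in U x) 1).
Local Notation m2 := (tens T 1 (ue_in U x)).

(** A basis [ec_t] of U_{<=k} (x) U_{<=k} with coordinates [ec_c], made of joint eigenvectors of ad
    x^(1) and ad x^(2). The eigenvalues are typed in R: their reality is what makes the oscillation
    argument work on the imaginary axis. *)
Record eigen_coords (k : nat) := EigenCoords {
  ec_dim : nat;
  ec_t : 'I_ec_dim -> T;
  ec_c : 'I_ec_dim -> T -> C;
  ec_a : 'I_ec_dim -> R;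
  ec_b : 'I_ec_dim -> R;
  ec_le : forall i, ts_le k (ec_t i);
  ec_sum : forall u, ts_le k u -> u = \sum_i ec_c i u *: ec_t i;
  ec_delta : forall i j, ec_c i (ec_t j) = (i == j)%:R;
  ec_lin : forall i a u v, ts_le k u -> ts_le k v ->
    ec_c i (a *: u + v) = a * ec_c i u + ec_c i v;
  ec_ad1 : forall i, m1 * ec_t i - ec_t i * m1 = (ec_a i)%:C *: ec_t i;
  ec_ad2 : forall i, m2 * ec_t i - ec_t i * m2 = (ec_b i)%:C *: ec_t i }.

(** The commutator with x is a derivation, so eigenvalues add up along a word. *)
Lemma ad_prod_eigen (s : seq g) (w : seq g) :
  (forall y, y \in s -> exists a : R, br x y = a%:C *: y) -> all (mem s) w ->
  exists a : R, ue_in U x * (\prod_(y <- w) ue_in U y) - (\prod_(y <- w) ue_in U y) * ue_in U x =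
     a%:C *: \prod_(y <- w) ue_in U y.
Proof.
move=> sE; elim: w => [|y w IH] /=.
  by exists 0; rewrite big_nil mulr1 mul1r subrr scale0r.
move=> /andP[/sE[a ya] /IH[b wb]]; exists (a + b); rewrite big_cons rmorphD scalerDl.
rewrite -!mulrA [ue_in U y * (_ * _)]mulrA.
have -> : ue_in U x * (ue_in U y * \prod_(j <- w) ue_in U j) -
   ue_in U y * (\prod_(j <- w) ue_in U j) * ue_in U x =
   ue_in U (br x y) * \prod_(j <- w) ue_in U j +
   ue_in U y * (ue_in U x * \prod_(j <- w) ue_in U j -
                \prod_(j <- w) ue_in U j * ue_in U x).
  by rewrite ue_in_br mulrBl mulrBr !mulrA addrA subrK.
by rewrite wb ya linearZ /= -scalerAl -scalerAr.
Qed.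

(** Tensors of two words in eigenvectors of ad x span the degree piece and are joint eigenvectors; a
    basis is extracted from them. *)
Lemma eigen_coords_exist (s : seq g) k : (forall y, lspan [set` s] y) ->
  (forall y, y \in s -> exists a : R, br x y = a%:C *: y) ->
  inhabited (eigen_coords k).
Proof.
move=> ss sE; pose wd := [seq \prod_(y <- w) ue_in U y | w <- words s k].
have wE a : ue_le k a -> lspan [set` wd] a.
  move=> /(ue_le_words ss); apply: lspan_mono => _ [w /= ws <-].
  by rewrite /mkset; apply/mapP; exists w.
have wad a : a \in wd -> exists r : R, ue_in U x * a - a * ue_in U x = r%:C *: a.
  by move=> /mapP[w + ->]; rewrite mem_words => /andP[_ /(ad_prod_eigen sE)].
have wle a : a \in wd -> ue_le k a.
  move=> /mapP[w + ->]; rewrite mem_words => /andP[wk _].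
  by apply: sub_lspan; exists w.
have [d [t [c [ts cE ct clin]]]] := lspan_basis [seq tens T a b | a <- wd, b <- wd].
have tE u : ts_le k u -> lspan [set` [seq tens T a b | a <- wd, b <- wd]] u.
  elim=> [|r _ v [a [b [ak bk ->]]] _ IH]; first exact: lspan0.
  apply: lspan_lin => //; apply: tens_lspan (wE _ ak) (wE _ bk) => {ak bk} a' b' /= aw bw.
  by rewrite /mkset; apply/allpairsP; exists (a', b').
have /choice[fa faE] : forall i, exists r : R, m1 * t i - t i * m1 = r%:C *: t i.
  move=> i.
  have /allpairsP[[a b] /= [/wad[r ra] _ ->]] := ts i; exists r.
  by rewrite !tensM mul1r mulr1 -tensBl ra tensZl.
have /choice[fb fbE] : forall i, exists r : R, m2 * t i - t i * m2 = r%:C *: t i.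
  move=> i.
  have /allpairsP[[a b] /= [_ /wad[r ra] ->]] := ts i; exists r.
  by rewrite !tensM mul1r mulr1 -tensBr ra tensZr.
apply/inhabits/(@EigenCoords k d t c fa fb) => //.
- move=> i; have /allpairsP[[a b] /= [aw bw ->]] := ts i.
  by apply: sub_lspan; exists a, b; split=> //; exact: wle.
- by move=> u /tE/cE.
- by move=> i a u v /tE us /tE vs; exact: clin.
Qed.

End EigenCoordinates.

(** * Invariance of the Casimir tensor *)

Section CasimirTensors.
Variables (K : fieldType) (g : lieAlgebra K) (U : envelopingAlgebra g).
Variables (T : tensorSquare U) (B : g -> g -> K).
Hypothesis hB : invariant_form B.
Let n := \dim {: g}.
Let e : n.-tuple g := vbasis fullv.
Let G := gram B.
Local Notation W := (invmx G).

Lemma formZl a x y : B (a *: x) y = a * B x y.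
Proof.
have B0 : B 0 y = 0.
  by have := form_linearl hB y (-1) 0 0; rewrite scaler0 addr0 mulN1r addNr.
by have := form_linearl hB y a x 0; rewrite B0 !addr0.
Qed.

Lemma formDl x y z : B (x + y) z = B x z + B y z.
Proof. by have := form_linearl hB z 1 x y; rewrite scale1r mul1r. Qed.

Lemma form_suml I (r : seq I) (P : pred I) (F : I -> g) z :
  B (\sum_(i <- r | P i) F i) z = \sum_(i <- r | P i) B (F i) z.
Proof.
apply: (big_morph (B^~ z)); first by move=> x y; exact: formDl.
by have := formZl 0 0 z; rewrite scale0r mul0r.
Qed.

Lemma gram_tr : G^T = G.
Proof. by apply/matrixP => i j; rewrite !mxE (form_sym hB). Qed.

Lemma vbasis_coord (x : g) : x = \sum_i coord e i x *: tnth e i.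
Proof.
rewrite {1}(coord_vbasis (memvf x)); apply: eq_bigr => i _.
by rewrite (tnth_nth 0).
Qed.

(** A row vector killed by the Gram matrix is the coordinate vector of an element orthogonal to all
    of g. *)
Lemma gram_unit : G \in unitmx.
Proof.
rewrite -row_free_unit; apply: inj_row_free => v vG.
have v0 : \sum_i v 0 i *: tnth e i = 0.
  apply: (form_nondeg hB) => y; rewrite (form_sym hB) (vbasis_coord y) form_suml.
  rewrite big1 // => j _; rewrite formZl (form_sym hB) form_suml.
  have /rowP/(_ j) := vG; rewrite !mxE => vGj.
  rewrite (eq_bigr (fun i => v 0 i * G i j)) ?vGj ?mulr0 // => i _.
  by rewrite formZl mxE.
apply/rowP => i; rewrite mxE.
have /freeP fr := basis_free (vbasisP {: g}).
apply: (fr (v 0)); rewrite -[RHS]v0; apply: eq_bigr => j _.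
by rewrite (tnth_nth 0).
Qed.

Lemma inv_gram_sym i j : W i j = W j i.
Proof. by rewrite -[in LHS]gram_tr -trmx_inv mxE. Qed.

Lemma flip_Omega_map f : flip T (Omega_map T B f) = Omega_map T B f.
Proof.
rewrite /Omega_map linear_sum exchange_big; apply: eq_bigr => i _ /=.
rewrite linear_sum; apply: eq_bigr => j _ /=.
by rewrite linearZ /= flipE inv_gram_sym.
Qed.

(** With C the matrix of ad x, invariance of the form reads C G + G C^T = 0. Multiplied by G^-1 on
    both sides it becomes C^T G^-1 + G^-1 C = 0, whose two terms are the coefficients produced by
    x^(1) and by x^(2). *)
Lemma Omega_invariant (x : g) (O := Omega_map T B id)
    (m1 := tens T (ue_in U x) 1) (m2 := tens T 1 (ue_in U x)) :
  (m1 * O - O * m1) + (m2 * O - O * m2) = 0.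
Proof.
pose Cm : 'M[K]_n := \matrix_(i, k) coord e k (br x (tnth e i)).
have brE i : br x (tnth e i) = \sum_k Cm i k *: tnth e k.
  by rewrite [LHS]vbasis_coord; apply: eq_bigr => k _; rewrite mxE.
have CG : Cm *m G + G *m Cm^T = 0.
  apply/matrixP => i j; rewrite !mxE.
  have -> : \sum_k Cm i k * G k j = B (br x (tnth e i)) (tnth e j).
    by rewrite brE form_suml; apply: eq_bigr => k _; rewrite formZl [G k j]mxE.
  have -> : \sum_k G i k * Cm^T k j = B (tnth e i) (br x (tnth e j)).
    rewrite (form_sym hB) brE form_suml; apply: eq_bigr => k _.
    by rewrite formZl [Cm^T _ _]mxE [G _ _]mxE mulrC (form_sym hB).
  rewrite brC -scaleN1r formZl (form_inv hB) mulN1r addNr.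
  by [].
have CW : Cm^T *m W + W *m Cm = 0.
  have CGE : Cm *m G = - (G *m Cm^T) by apply/eqP; rewrite -addr_eq0 CG.
  have -> : W *m Cm = W *m (Cm *m G) *m W by rewrite -!mulmxA mulmxV ?gram_unit // mulmx1.
  by rewrite CGE mulmxN mulNmx mulKmx ?gram_unit // subrr.
have E1 : m1 * O - O * m1 = \sum_i \sum_j (Cm^T *m W) i j *:
     tens T (ue_in U (tnth e i)) (ue_in U (tnth e j)).
  rewrite /O /Omega_map mulr_sumr mulr_suml -sumrB.
  transitivity (\sum_i \sum_j \sum_k (Cm k i * W k j) *: tens T (ue_in U (tnth e i)) (ue_in U (tnth e j))).
    rewrite (eq_bigr (fun k => \sum_j \sum_i (Cm k i * W k j) *: tens T (ue_in U (tnth e i)) (ue_in U (tnth e j)))); last first.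
      move=> k _; rewrite mulr_sumr mulr_suml -sumrB; apply: eq_bigr => j _.
      rewrite -scalerAr -scalerAl -scalerBr !tensM mul1r mulr1 -tensBl -ue_in_br brE linear_sum.
      have -> : tens T (\sum_(i < n) ue_in U (Cm k i *: tnth e i)) (ue_in U (tnth e j)) =
         \sum_(i < n) Cm k i *: tens T (ue_in U (tnth e i)) (ue_in U (tnth e j)).
        rewrite (big_morph (fun a => tens T a (ue_in U (tnth e j))) (fun a b => tensDl T a b _) (tens0l T _)).
        by apply: eq_bigr => i _; rewrite linearZ tensZl.
      by rewrite scaler_sumr; apply: eq_bigr => i _; rewrite scalerA mulrC.
    rewrite exchange_big [RHS]exchange_big /=; apply: eq_bigr => j _.
    by rewrite exchange_big.
  apply: eq_bigr => i _; apply: eq_bigr => j _; rewrite -scaler_suml mxE.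
  by congr (_ *: _); apply: eq_bigr => k _; rewrite !mxE.
have E2 : m2 * O - O * m2 = \sum_i \sum_j (W *m Cm) i j *:
     tens T (ue_in U (tnth e i)) (ue_in U (tnth e j)).
  rewrite /O /Omega_map mulr_sumr mulr_suml -sumrB; apply: eq_bigr => i _.
  rewrite mulr_sumr mulr_suml -sumrB.
  transitivity (\sum_k \sum_j (W i k * Cm k j) *: tens T (ue_in U (tnth e i)) (ue_in U (tnth e j))).
    apply: eq_bigr => k _.
    rewrite -scalerAr -scalerAl -scalerBr !tensM mul1r mulr1 -tensBr -ue_in_br brE linear_sum.
    rewrite (big_morph (fun a => tens T (ue_in U (tnth e i)) a) (fun a b => tensDr T a b _) (tens0r T _)).
    rewrite scaler_sumr; apply: eq_bigr => j _.
    by rewrite linearZ tensZr scalerA.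
  rewrite exchange_big; apply: eq_bigr => j _; rewrite -scaler_suml mxE.
  by [].
rewrite E1 E2 -big_split big1 // => i _; rewrite -big_split big1 //= => j _.
rewrite -scalerDl; have /matrixP/(_ i j) := CW.
by rewrite [LHS]mxE [RHS]mxE => ->; rewrite scale0r.
Qed.

Lemma Omega_map_ad0 (f : g -> g) (x : g) : (forall y, br x (f y) = 0) ->
  tens T (ue_in U x) 1 * Omega_map T B f - Omega_map T B f * tens T (ue_in U x) 1 = 0.
Proof.
move=> xf; rewrite /Omega_map mulr_sumr mulr_suml -sumrB big1 // => i _.
rewrite mulr_sumr mulr_suml -sumrB big1 // => j _.
rewrite -scalerAr -scalerAl -scalerBr !tensM mul1r mulr1 -tensBl -ue_in_br xf.
by rewrite linear0 tens0l scaler0.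
Qed.

End CasimirTensors.

(** * The filtered algebra of formal series *)

Section CalA.
Variables (K : fieldType) (g : lieAlgebra K) (U : envelopingAlgebra g).
Variable T : tensorSquare U.
Local Notation calA := (calA T).
Local Notation calE := (calE T).
Local Notation filA := (@filA _ _ _ T).
Local Notation filE := (@filE _ _ _ T).
Implicit Types (a b c : calA) (X Y : calE).

Lemma calA_ext a b : (forall k, calA_val a k = calA_val b k) -> a = b.
Proof. by move=> ab; apply: val_inj; apply/funext. Qed.

Lemma filA_eq a b : (forall n, filA n (a - b)) -> a = b.
Proof. by move=> ab; apply: calA_ext => k; apply/eqP; rewrite -subr_eq0; apply/eqP/(ab k.+1 k). Qed.

Lemma filA0 n : filA n 0. Proof. by []. Qed.

Lemma filAD n a b : filA n a -> filA n b -> filA n (a + b).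
Proof.
by move=> an bn k kn; transitivity (calA_val a k + calA_val b k) => //; rewrite an // bn // addr0.
Qed.

Lemma filAZ n s a : filA n a -> filA n (s *: a).
Proof.
by move=> an k kn; transitivity (s *: calA_val a k) => //; rewrite an // scaler0.
Qed.

Lemma filAB n a b : filA n a -> filA n b -> filA n (a - b).
Proof. by move=> an bn; rewrite -scaleN1r; apply: filAD => //; exact: filAZ. Qed.

Lemma filA_mul m n a b : filA m a -> filA n b -> filA (m + n) (a * b).
Proof.
move=> am bn k kmn; rewrite /= [LHS]big1 // => i _.
have [im|mi] := ltnP i m; first by rewrite am // mul0r.
by rewrite bn ?mulr0 // ltn_subLR ?(leq_trans kmn) ?leq_add2r // -ltnS ltn_ord.
Qed.

Lemma filA_le m n a : (m <= n)%N -> filA n a -> filA m a.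
Proof. by move=> mn an k km; apply: an; exact: leq_trans mn. Qed.

Lemma filAMr n a b : filA n a -> filA n (a * b).
Proof. by move=> an; rewrite -[n]addn0; apply: filA_mul. Qed.

Lemma filAX n a j : filA 1 a -> (n <= j)%N -> filA n (a ^+ j).
Proof.
move=> a1 nj; apply: (filA_le nj); elim: j {nj} => [|j IH] //.
by rewrite exprS -add1n; exact: filA_mul.
Qed.

Lemma calE_ext X Y : (forall a, X a = Y a) -> X = Y.
Proof. by move=> XY; apply: val_inj; apply/funext. Qed.

Lemma calE0 X : X 0 = 0.
Proof. exact: linear_fun0 (calE_linear X). Qed.

Lemma calEZ X s a : X (s *: a) = s *: X a.
Proof. exact: linear_funZ (calE_linear X) _ _. Qed.

Lemma calED X a b : X (a + b) = X a + X b.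
Proof. exact: linear_funD (calE_linear X) _ _. Qed.

Lemma calEB X a b : X (a - b) = X a - X b.
Proof. by rewrite calED -scaleN1r calEZ scaleN1r. Qed.

Lemma calE_sum X (I : Type) (r : seq I) (P : pred I) (F : I -> calA) :
  X (\sum_(i <- r | P i) F i) = \sum_(i <- r | P i) X (F i).
Proof. by apply: (big_morph X); [exact: calED | exact: calE0]. Qed.

Lemma mulEE X Y a : (X * Y) a = X (Y a). Proof. by []. Qed.
Lemma addEE X Y a : (X + Y) a = X a + Y a. Proof. by []. Qed.
Lemma scaleEE s X a : (s *: X) a = s *: X a. Proof. by []. Qed.
Lemma lmulEE a b : lmulE a b = a * b. Proof. by []. Qed.
Lemma oneEE a : (1 : calE) a = a. Proof. by []. Qed.
Lemma sumEE (I : Type) (r : seq I) (P : pred I) (F : I -> calE) a :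
  (\sum_(i <- r | P i) F i) a = \sum_(i <- r | P i) F i a.
Proof. by apply: (big_morph (fun X : calE => X a)). Qed.

Lemma flipA_subproof a : fps_flip a \in @calA_pred _ _ _ T.
Proof. by apply/calA_predP => k; apply: ts_le_flip; exact: calA_le. Qed.

Definition flipA a : calA := CalA (flipA_subproof a).

Lemma flipA_subproof2 : flipA \in @calE_pred _ _ _ T.
Proof.
apply/asboolP; split=> [s a b|n a an k kn].
  by apply: calA_ext => k; rewrite /= /fps_flip linearP.
by rewrite /= /fps_flip an // linear0.
Qed.

Definition flipX : calE := CalE flipA_subproof2.

Lemma flipAM a b : flipX (a * b) = flipX a * flipX b.
Proof.
apply: calA_ext => k; rewrite /= /fps_flip linear_sum; apply: eq_bigr => i _.
by rewrite (@flipM _ _ _ _ i (k - i)) //; exact: calA_le.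
Qed.

Lemma flipAK a : flipX (flipX a) = a.
Proof. by apply: calA_ext => k; rewrite /= /fps_flip (@flipK _ _ _ _ k) //; exact: calA_le. Qed.

Lemma flipA1 : flipX 1 = 1.
Proof.
apply: calA_ext => k; change (flip T ((k == 0%N)%:R) = (k == 0%N)%:R).
by case: k => [|k] /=; rewrite ?flip1 ?linear0.
Qed.

(** Right multiplications are filtered operators as well, so derivatives and limits pass through
    them as through the flip. *)
Lemma rmulX_subproof c : (fun a => a * c) \in @calE_pred _ _ _ T.
Proof.
apply/asboolP; split=> [s a b|n a an]; first by rewrite mulrDl -scalerAl.
exact: filAMr.
Qed.

Definition rmulX c : calE := CalE (rmulX_subproof c).

Lemma rmulXE c a : rmulX c a = a * c. Proof. by []. Qed.

Lemma adE_mul x a b : adE T x (a * b) = adE T x a * b + a * adE T x b.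
Proof.
apply: calA_ext => k.
transitivity (\sum_(i < k.+1) (calA_val (adE T x a) i * calA_val b (k - i)%N +
   calA_val a i * calA_val (adE T x b) (k - i)%N)); last exact: big_split.
rewrite /= mulr_sumr mulr_suml -sumrB; apply: eq_bigr => i _ /=.
by rewrite mulrBl mulrBr !mulrA addrA subrK.
Qed.

(* ad (x^(1) + x^(2)): the second summand is ad x^(2). *)
Definition ad_diag x : calE := adE T x + flipX * adE T x * flipX.

Lemma ad_diagE x a k : calA_val (ad_diag x a) k =
  (tens T (ue_in U x) 1 * calA_val a k - calA_val a k * tens T (ue_in U x) 1) +
  (tens T 1 (ue_in U x) * calA_val a k - calA_val a k * tens T 1 (ue_in U x)).
Proof.
transitivity (calA_val (adE T x a) k + calA_val (flipX (adE T x (flipX a))) k) => //.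
congr (_ + _); rewrite /= /fps_flip /= (@flip_ad _ _ _ _ k).
  by rewrite (@flipK _ _ _ _ k) //; exact: calA_le.
by apply: ts_le_flip; exact: calA_le.
Qed.

Lemma ad_diag_mul x a b : ad_diag x (a * b) = ad_diag x a * b + a * ad_diag x b.
Proof.
rewrite /ad_diag !addEE !mulEE flipAM !adE_mul calED !flipAM !flipAK mulrDl mulrDr.
by rewrite addrACA.
Qed.

Lemma ad_diag1 x : ad_diag x 1 = 0.
Proof.
have := ad_diag_mul x 1 1; rewrite !mulr1 mul1r => /eqP.
by rewrite -subr_eq0 opprD addrA subrr add0r oppr_eq0 => /eqP.
Qed.

Lemma adE1 x : adE T x 1 = 0.
Proof.
have := adE_mul x 1 1; rewrite !mulr1 mul1r => /eqP.
by rewrite -subr_eq0 opprD addrA subrr add0r oppr_eq0 => /eqP.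
Qed.

Lemma commutator_comm (A : nzRingType) (y z u : A) : y * z = z * y ->
  z * (y * u - u * y) - (y * u - u * y) * z = y * (z * u - u * z) - (z * u - u * z) * y.
Proof.
move=> yz; rewrite !mulrBr !mulrBl !opprB !mulrA yz -![u * _ * _]mulrA yz.
by rewrite addrACA [RHS]addrACA [- (z * u * y) - _]addrC.
Qed.

(** The elements x^(1) and x^(2) commute. *)
Lemma ad_diag_adC x a : ad_diag x (adE T x a) = adE T x (ad_diag x a).
Proof.
apply: calA_ext => k.
change (calA_val (ad_diag x (adE T x a)) k = tens T (ue_in U x) 1 * calA_val (ad_diag x a) k -
  calA_val (ad_diag x a) k * tens T (ue_in U x) 1).
rewrite !ad_diagE /=.
rewrite [X in _ = X - _]mulrDr [X in _ = _ - X]mulrDl opprD [RHS]addrACA; congr (_ + _).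
by rewrite commutator_comm // !tensM !mul1r !mulr1.
Qed.
(** The Neumann series of the inverse of a = 1 - (1 - a). Stopping at j = k in the coefficient of
    hbar^k is exact once 1 - a has no constant term. *)
Lemma invA_subproof a : (fun k => \sum_(j < k.+1) calA_val ((1 - a) ^+ j) k) \in @calA_pred _ _ _ T.
Proof. by apply/calA_predP => k; apply: lspan_sum => j _; exact: calA_le. Qed.

Definition invA a : calA := CalA (invA_subproof a).

Lemma calA_val_sum (I : Type) (r : seq I) (P : pred I) (F : I -> calA) k :
  calA_val (\sum_(i <- r | P i) F i) k = \sum_(i <- r | P i) calA_val (F i) k.
Proof. by apply: (big_morph (fun a : calA => calA_val a k)). Qed.

(** The power a^j starts at hbar^j, so the coefficient of hbar^k sees only j <= k. Both the Neumann
    and the exponential series are compared with their partial sums in this way. *)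
Lemma filA_trunc_sum n a (s : nat -> K) (b : calA) : filA 1 a ->
  (forall k, calA_val b k = \sum_(j < k.+1) s j *: calA_val (a ^+ j) k) ->
  filA n (b - \sum_(j < n) s j *: a ^+ j).
Proof.
move=> a1 bE k kn.
change (calA_val b k - calA_val (\sum_(j < n) s j *: a ^+ j) k = 0).
apply/eqP; rewrite subr_eq0; apply/eqP.
rewrite bE calA_val_sum -!(big_mkord predT (fun j => s j *: calA_val (a ^+ j) k)).
rewrite [RHS](big_cat_nat (n := k.+1)) //= [X in _ + X]big_nat_cond [X in _ + X]big1 ?addr0 // => j /andP[/andP[kj _] _].
by rewrite (filAX a1 kj) ?scaler0.
Qed.

Lemma invA_trunc n a : filA 1 (1 - a) -> filA n (invA a - \sum_(j < n) (1 - a) ^+ j).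
Proof.
move=> a1; have := @filA_trunc_sum n (1 - a) (fun=> 1) (invA a) a1.
under eq_bigr do rewrite scale1r; apply.
by move=> k; apply: eq_bigr => j _; rewrite scale1r.
Qed.

Lemma invAK a : filA 1 (1 - a) -> invA a * a = 1 /\ a * invA a = 1.
Proof.
move=> a1; pose S n := \sum_(j < n) (1 - a) ^+ j.
have aS n : a * S n = 1 - (1 - a) ^+ n.
  by apply: oppr_inj; rewrite opprB subrX1 -mulNr addrAC subrr add0r.
have Sa n : S n * a = 1 - (1 - a) ^+ n.
  rewrite -aS -/(GRing.comm (S n) a); apply/commr_sym/commr_sum => j _.
  by apply/commrX/commrB => //; exact: commr1.
have aux n : filA n (1 - (1 - a) ^+ n - 1).
  by rewrite addrAC subrr add0r -scaleN1r; apply: filAZ; exact: filAX.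
split; apply: filA_eq => n; have iS := @invA_trunc n a a1.
  have -> : invA a * a - 1 = (invA a - S n) * a + (S n * a - 1) by rewrite mulrBl addrA subrK.
  by apply: filAD; [exact: filAMr | rewrite Sa].
have -> : a * invA a - 1 = a * (invA a - S n) + (a * S n - 1) by rewrite mulrBr addrA subrK.
by apply: filAD; [exact: filAM | rewrite aS].
Qed.

Lemma calA_valX a j : (calA_val a : fps T) ^+ j = calA_val (a ^+ j).
Proof. by elim: j => [|j IH] //; rewrite !exprS IH. Qed.

Lemma expA_trunc n a : filA 1 a -> filA n (expA a - \sum_(j < n) (j`!%:R : K)^-1 *: a ^+ j).
Proof.
move=> a1; apply: (@filA_trunc_sum n a (fun j => (j`!%:R : K)^-1)) => // k.
by apply: eq_bigr => j _; rewrite calA_valX.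
Qed.

Definition exp_poly n (s : K) : {poly K} := \poly_(i < n) (s ^+ i / i`!%:R).

Lemma expAZ_trunc n s a : filA 1 a -> filA n (expA (s *: a) - horner_alg a (exp_poly n s)).
Proof.
move=> a1; have sa1 : filA 1 (s *: a) by exact: filAZ.
have := expA_trunc (n := n) sa1.
suff -> : \sum_(j < n) (j`!%:R : K)^-1 *: (s *: a) ^+ j = horner_alg a (exp_poly n s) by [].
rewrite /exp_poly poly_def linear_sum; apply: eq_bigr => j _ /=.
by rewrite linearZ /= rmorphXn /= horner_algX exprZn scalerA -scalerAl mul1r mulrC.
Qed.

Lemma horner_alg_filA n a (P : {poly K}) : filA 1 a -> (forall i, (i < n)%N -> P`_i = 0) ->
  filA n (horner_alg a P).
Proof.
move=> a1 P0; rewrite -(poly_take_drop n P).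
have -> : take_poly n P = 0.
  by apply/polyP => i; rewrite coef_take_poly coef0; case: ifP => // /P0.
rewrite add0r rmorphM rmorphXn /= horner_algX; apply: filAM; exact: filAX.
Qed.

Hypothesis char0 : forall j, (j`!%:R : K) != 0.

(** Modulo A_n all three exponentials are polynomials in a, so the addition law reduces to that of
    truncated exponentials in K[X] modulo X^n, which is the binomial formula. *)
Lemma expAD s t a : filA 1 a -> expA (s *: a) * expA (t *: a) = expA ((s + t) *: a).
Proof.
move=> a1; apply: filA_eq => n.
pose H := horner_alg a; pose P := exp_poly n.
have hs r : filA n (expA (r *: a) - H (P r)) by exact: expAZ_trunc.
have telescope (x y z w v : calA) : x - v = (x - y) + (y - z) + (z - w) - (v - w).
  by rewrite opprB !addrA !subrK.
rewrite (telescope _ (H (P s) * expA (t *: a)) (H (P s) * H (P t)) (H (P (s + t)))).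
rewrite -mulrBl -mulrBr -rmorphM -rmorphB.
apply: filAB => //; apply: filAD; first by apply: filAD; [exact: filAMr | exact: filAM].
apply: horner_alg_filA => // m mn; rewrite coefB coefM coef_poly mn.
apply/eqP; rewrite subr_eq0; apply/eqP.
rewrite addrC exprDn mulr_suml; apply: eq_bigr => i _.
rewrite !coef_poly (leq_ltn_trans (leq_ord i) mn) (leq_ltn_trans (leq_subr i m) mn).
(* m! is written as the binomial coefficient times i! (m - i)!, after which the fractions cancel. *)
have := bin_fact (leq_ord i); move/(congr1 (fun k => k%:R : K)); rewrite !natrM => <-.
have b0 : ('C(m, i)%:R : K) != 0.
  have := char0 m; rewrite -(bin_fact (leq_ord i)) natrM mulf_eq0 negb_or.
  by case/andP.
rewrite -[_ *+ 'C(m, i)]mulr_natr.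
have key (z x y c d : K) : z != 0 -> x != 0 -> y != 0 -> c / x * (d / y) = d * c * z / (z * (x * y)).
  by move=> z0 x0 y0; field; rewrite x0 y0 z0.
by apply: key => //; exact: char0.
Qed.

Lemma expA0 : expA 0 = 1 :> calA.
Proof.
apply: filA_eq => -[//|n].
have := @expA_trunc n.+1 0 (@filA0 _).
rewrite big_ord_recl /= big1 ?addr0; first by rewrite fact0 invr1 scale1r expr0.
by move=> i _; rewrite expr0n /= scaler0.
Qed.

Lemma expA_unip a : filA 1 a -> filA 1 (1 - expA a).
Proof.
move=> a1; rewrite -opprB -scaleN1r; apply: filAZ.
by have := @expA_trunc 1 a a1; rewrite big_ord1 fact0 invr1 scale1r expr0.
Qed.

Lemma flipA_exp a : filA 1 a -> flipX (expA a) = expA (flipX a).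
Proof.
move=> a1; apply: filA_eq => n.
have f1 : filA 1 (flipX a) by exact: calE_fil.
have := calE_fil flipX (expA_trunc (n := n) a1); rewrite calEB => e1.
have e2 := expA_trunc (n := n) f1.
have -> : flipX (expA a) - expA (flipX a) =
  (flipX (expA a) - flipX (\sum_(j < n) (j`!%:R : K)^-1 *: a ^+ j)) -
  (expA (flipX a) - flipX (\sum_(j < n) (j`!%:R : K)^-1 *: a ^+ j)).
  by rewrite opprB addrA subrK.
apply: filAB => //; move: e2.
suff -> : flipX (\sum_(j < n) (j`!%:R : K)^-1 *: a ^+ j) = \sum_(j < n) (j`!%:R : K)^-1 *: (flipX a) ^+ j by [].
rewrite calE_sum; apply: eq_bigr => j _; rewrite calEZ; congr (_ *: _).
elim: (nat_of_ord j) => [|i IH]; first by rewrite !expr0 flipA1.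
by rewrite !exprS flipAM IH.
Qed.

Lemma ad_diag_exp x a : filA 1 a -> ad_diag x a = 0 -> ad_diag x (expA a) = 0.
Proof.
move=> a1 xa; apply: filA_eq => n; rewrite subr0.
have := calE_fil (ad_diag x) (expA_trunc (n := n) a1); rewrite calEB calE_sum big1 ?subr0 // => j _.
rewrite calEZ; suff -> : ad_diag x (a ^+ j) = 0 by rewrite scaler0.
elim: (nat_of_ord j) => [|i IH]; first by rewrite expr0 ad_diag1.
by rewrite exprS ad_diag_mul xa IH mul0r mulr0 addr0.
Qed.

Lemma adE_exp x a : filA 1 a -> adE T x a = 0 -> adE T x (expA a) = 0.
Proof.
move=> a1 xa; apply: filA_eq => n; rewrite subr0.
have := calE_fil (adE T x) (expA_trunc (n := n) a1); rewrite calEB calE_sum big1 ?subr0 // => j _.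
rewrite calEZ; suff -> : adE T x (a ^+ j) = 0 by rewrite scaler0.
elim: (nat_of_ord j) => [|i IH]; first by rewrite expr0 adE1.
by rewrite exprS adE_mul xa IH mul0r mulr0 addr0.
Qed.

End CalA.

(** * Functional calculus of ad x^(1) *)

Section EigenOperators.
Variables (R : realType) (g : lieAlgebra R[i]) (U : envelopingAlgebra g).
Variables (T : tensorSquare U) (x : g).
Variable cb : forall k, eigen_coords T x k.
Local Notation C := R[i].
Local Notation calA := (calA T).
Local Notation calE := (calE T).
Local Notation filA := (@filA _ _ _ T).
Local Notation filE := (@filE _ _ _ T).
Local Notation m1 := (tens T (ue_in U x) 1).
Local Notation m2 := (tens T 1 (ue_in U x)).
Local Notation flipX := (flipX T).
Local Notation ad_diag := (ad_diag T).
Implicit Types (a b c : calA) (X Y : calE).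

Lemma ec_c0 k (i : 'I_(ec_dim (cb k))) : ec_c i 0 = 0.
Proof.
have := ec_lin i (-1) (lspan0 _) (lspan0 _).
by rewrite scaler0 addr0 mulN1r addNr.
Qed.

Lemma ec_cZ k (i : 'I_(ec_dim (cb k))) s u : ts_le k u -> ec_c i (s *: u) = s * ec_c i u.
Proof. by move=> uk; have := ec_lin i s uk (lspan0 _); rewrite !addr0 ec_c0 addr0. Qed.

Lemma ec_csum k (i : 'I_(ec_dim (cb k))) (f : 'I_(ec_dim (cb k)) -> C) :
  ec_c i (\sum_j f j *: ec_t j) = f i.
Proof.
have H (r : seq 'I_(ec_dim (cb k))) : ec_c i (\sum_(j <- r) f j *: ec_t j) = \sum_(j <- r) f j * (i == j)%:R
    /\ ts_le k (\sum_(j <- r) f j *: ec_t j).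
  elim: r => [|j r [IH1 IH2]]; first by rewrite !big_nil ec_c0; split=> //; exact: lspan0.
  rewrite !big_cons; split; last by apply: lspan_lin => //; exact: ec_le.
  by rewrite ec_lin //; [rewrite IH1 ec_delta | exact: ec_le].
rewrite (H _).1 (bigD1 i) //= eqxx mulr1 big1 ?addr0 // => j ji.
by rewrite eq_sym (negbTE ji) mulr0.
Qed.

Lemma ec_eq k (u v : T) : ts_le k u -> ts_le k v ->
  (forall i : 'I_(ec_dim (cb k)), ec_c i u = ec_c i v) -> u = v.
Proof.
move=> uk vk uv; rewrite (ec_sum (cb k) uk) (ec_sum (cb k) vk).
by apply: eq_bigr => i _; rewrite uv.
Qed.

Definition eigen_coord k (i : 'I_(ec_dim (cb k))) (a : calA) : C := ec_c i (calA_val a k).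

Lemma eigen_coord_scalar k i : scalar (@eigen_coord k i).
Proof. by move=> s a b; rewrite /eigen_coord -ec_lin //; exact: calA_le. Qed.

Definition eigen_coordl k i : {scalar calA} := scalar_of (@eigen_coord_scalar k i).

Lemma eigen_coord_trunc k i : trunc_functional filA k.+1 (@eigen_coordl k i).
Proof. by move=> a /(_ k (ltnSn k)) ak; rewrite /= /eigen_coord ak ec_c0. Qed.

Lemma eigen_vec_subproof k (i : 'I_(ec_dim (cb k))) :
  (fun j => if j == k then ec_t i else 0) \in @calA_pred _ _ _ T.
Proof.
apply/calA_predP => j; case: eqP => [->|_]; last exact: lspan0.
exact: ec_le.
Qed.

Definition eigen_vec k i : calA := CalA (@eigen_vec_subproof k i).

Lemma eigen_vec_fil k i : filA k (@eigen_vec k i).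
Proof. by move=> j jk; rewrite /= ltn_eqF. Qed.

(** Concrete form of the finite dimension of A / A_n: it is spanned by the [eigen_vec] of level
    below n. Hence derivatives and limits in A need only be checked on eigen-coordinates. *)
Lemma eigen_coord_decomp n a : filA n (a - \sum_(k < n) \sum_i eigen_coord i a *: @eigen_vec k i).
Proof.
move=> j jn; change (calA_val a j - calA_val (\sum_(k < n) \sum_i eigen_coord i a *: @eigen_vec k i) j = 0).
apply/eqP; rewrite subr_eq0; apply/eqP.
rewrite calA_val_sum (bigD1 (Ordinal jn)) //= [X in _ + X]big1 ?addr0.
  rewrite calA_val_sum [LHS](ec_sum (cb j)); last exact: calA_le.
  apply: eq_bigr => i _; change (ec_c i (calA_val a j) *: ec_t i = eigen_coord i a *: calA_val (eigen_vec i) j).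
  by rewrite /= eqxx.
move=> k kj; rewrite calA_val_sum big1 // => i _.
change (eigen_coord i a *: calA_val (eigen_vec i) j = 0); rewrite /=.
have -> : (j == k) = false by apply/negP => /eqP jk; move/eqP: kj; apply; exact: val_inj.
by rewrite scaler0.
Qed.

Lemma trunc_decomp n (l : {scalar calA}) a : trunc_functional filA n l ->
  l a = \sum_(k < n) \sum_i eigen_coord i a * l (@eigen_vec k i).
Proof.
move=> ln; have := ln _ (@eigen_coord_decomp n a); rewrite linearB => /eqP.
rewrite subr_eq0 => /eqP ->; rewrite linear_sum; apply: eq_bigr => k _.
by rewrite linear_sum; apply: eq_bigr => i _; rewrite linearZ.
Qed.

Lemma filA_eigen_coord n a : filA n a -> (forall i, @eigen_coord n i a = 0) -> filA n.+1 a.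
Proof.
move=> an c0 k; rewrite ltnS leq_eqVlt => /orP[/eqP ->|]; last exact: an.
rewrite (ec_sum (cb n) (calA_le a n)) big1 // => i _.
by have := c0 i; rewrite /eigen_coord => ->; rewrite scale0r.
Qed.

Lemma eigen_coord_inj a b : (forall n i, @eigen_coord n i a = eigen_coord i b) -> a = b.
Proof.
move=> ab; apply: calA_ext => k; apply: ec_eq; [exact: calA_le..|].
by move=> i; exact: ab.
Qed.

Lemma eigen_coord_ad k i a : @eigen_coord k i (adE T x a) = (ec_a i)%:C * eigen_coord i a.
Proof.
rewrite /eigen_coord /= {1 2}(ec_sum (cb k) (calA_le a k)) mulr_sumr mulr_suml -sumrB.
rewrite (eq_bigr (fun j => (ec_c j (calA_val a k) * (ec_a j)%:C) *: ec_t j)).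
  by rewrite ec_csum mulrC.
by move=> j _; rewrite -scalerAr -scalerAl -scalerBr ec_ad1 scalerA.
Qed.

Section Phi.
Variable phi : R -> C.

Definition phiT k (u : T) : T := \sum_i phi (ec_a i) *: (@ec_c _ _ _ _ _ k (cb k) i u *: ec_t i).

Lemma eigen_op_subproof a : (fun k => phiT k (calA_val a k)) \in @calA_pred _ _ _ T.
Proof. by apply/calA_predP => k; apply: lspan_sum => i _; apply/lspanZ/lspanZ/ec_le. Qed.

(** Every basis vector that occurs in an eigenvector u has the eigenvalue of u. So phi (ad x^(1))
    acts on u independently of the chosen basis, which allows degree pieces with unrelated bases to
    be compared. *)
Lemma phiT_eigen k u (r : R) : ts_le k u -> m1 * u - u * m1 = r%:C *: u ->
  phiT k u = phi r *: u.
Proof.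
move=> uk ur; rewrite /phiT {2}(ec_sum (cb k) uk) scaler_sumr; apply: eq_bigr => i _.
have [->|ci] := eqVneq (ec_c i u) 0; first by rewrite !scale0r !scaler0.
suff -> : ec_a i = r by [].
have : ec_c i (m1 * u - u * m1) = (ec_a i)%:C * ec_c i u.
  rewrite {1 2}(ec_sum (cb k) uk) mulr_sumr mulr_suml -sumrB.
  rewrite (eq_bigr (fun j => (ec_c j u * (ec_a j)%:C) *: ec_t j)).
    by rewrite ec_csum mulrC.
  by move=> j _; rewrite -scalerAr -scalerAl -scalerBr ec_ad1 scalerA.
by rewrite ur ec_cZ // => /(mulIf ci) /complexI.
Qed.

Lemma phiT_lin k s u v : ts_le k u -> ts_le k v -> phiT k (s *: u + v) = s *: phiT k u + phiT k v.
Proof.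
move=> uk vk; rewrite /phiT scaler_sumr -big_split; apply: eq_bigr => i _ /=.
by rewrite ec_lin // scalerDl scalerDr !scalerA; congr (_ *: _ + _); rewrite mulrCA.
Qed.

Lemma eigen_op_subproof2 : (fun a => CalA (eigen_op_subproof a)) \in @calE_pred _ _ _ T.
Proof.
apply/asboolP; split=> [s a b|n a an k kn].
  by apply: calA_ext => k; exact: phiT_lin (calA_le a k) (calA_le b k).
by rewrite /= an // /phiT big1 // => i _; rewrite ec_c0 scale0r scaler0.
Qed.

Definition eigen_op : calE := CalE eigen_op_subproof2.

Lemma eigen_coord_eigen_op k i a : @eigen_coord k i (eigen_op a) = phi (ec_a i) * eigen_coord i a.
Proof.
by rewrite /eigen_coord /= /phiT; under eq_bigr do rewrite scalerA; rewrite ec_csum.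
Qed.

Lemma eigen_op0 a : adE T x a = 0 -> eigen_op a = phi 0 *: a.
Proof.
move=> xa; apply: calA_ext => k; apply: (phiT_eigen (calA_le a k)).
by rewrite scale0r -[LHS]/(calA_val (adE T x a) k) xa.
Qed.

(** Eigenvalues of a derivation add under products, so a phi turning sums into products yields a
    multiplicative operator. *)
Lemma eigen_opM a b : (forall r s, phi (r + s) = phi r * phi s) -> eigen_op (a * b) = eigen_op a * eigen_op b.
Proof.
move=> phiD; apply: calA_ext => k.
have phi_sum (I : Type) (r : seq I) (F : I -> T) : (forall i, ts_le k (F i)) ->
    phiT k (\sum_(i <- r) F i) = \sum_(i <- r) phiT k (F i).
  move=> Fk; elim: r => [|i r IH].
    by rewrite !big_nil /phiT big1 // => i _; rewrite ec_c0 scale0r scaler0.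
  rewrite !big_cons -IH -{1}[F i]scale1r phiT_lin ?scale1r //.
  by apply: lspan_sum => j _; exact: Fk.
rewrite [LHS]/= [RHS]/= phi_sum; last first.
  by move=> i; have := ts_leM (calA_le a i) (calA_le b (k - i)); rewrite subnKC // leq_ord.
apply: eq_bigr => i _.
suff phiM u v m n : ts_le m u -> ts_le n v -> (m + n)%N = k -> phiT k (u * v) = phiT m u * phiT n v.
  by apply: phiM; [exact: calA_le | exact: calA_le | rewrite subnKC // leq_ord].
move=> um vn mnk {i}.
have phi0 w : phiT w 0 = 0.
  by rewrite /phiT big1 // => j _; rewrite ec_c0 scale0r scaler0.
have key p q : phiT k (@ec_t _ _ _ _ _ m (cb m) p * @ec_t _ _ _ _ _ n (cb n) q) =
    phiT m (@ec_t _ _ _ _ _ m (cb m) p) * phiT n (@ec_t _ _ _ _ _ n (cb n) q).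
  have pm := ec_le p; have qn := ec_le q.
  rewrite (phiT_eigen (k := m) pm (ec_ad1 p)) (phiT_eigen (k := n) qn (ec_ad1 q)).
  rewrite -scalerAl -scalerAr scalerA -phiD; apply: phiT_eigen; first by rewrite -mnk; exact: ts_leM.
  rewrite rmorphD scalerDl.
  have -> : forall y z : T, m1 * (y * z) - y * z * m1 = (m1 * y - y * m1) * z + y * (m1 * z - z * m1).
    by move=> y z; rewrite mulrBl mulrBr !mulrA addrA subrK.
  by rewrite !ec_ad1 -scalerAl -scalerAr.
have tk p q : ts_le k (@ec_t _ _ _ _ _ m (cb m) p * @ec_t _ _ _ _ _ n (cb n) q).
  by rewrite -mnk; exact: (ts_leM (ec_le p) (ec_le q)).
have uvk p : ts_le k (@ec_t _ _ _ _ _ m (cb m) p * v).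
  by rewrite -mnk; exact: (ts_leM (ec_le p) vn).
have phiZ w s y : ts_le w y -> phiT w (s *: y) = s *: phiT w y.
  by move=> yw; have := phiT_lin s yw (lspan0 _); rewrite !addr0 phi0 addr0.
have phiE w y : ts_le w y -> phiT w y = \sum_i ec_c i y *: phiT w (@ec_t _ _ _ _ _ w (cb w) i).
  move=> yw; rewrite {1}/phiT; apply: eq_bigr => i _.
  by rewrite (phiT_eigen (ec_le i) (ec_ad1 i)) !scalerA mulrC.
rewrite {1}(ec_sum (cb m) um) mulr_suml phi_sum; last first.
  by move=> p; rewrite -scalerAl; exact/lspanZ/uvk.
rewrite [phiT m u](phiE _ _ um) mulr_suml; apply: eq_bigr => p _.
rewrite -scalerAl phiZ // -scalerAl; congr (_ *: _).
rewrite {1}(ec_sum (cb n) vn) mulr_sumr phi_sum; last first.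
  by move=> q; rewrite -scalerAr; exact/lspanZ/tk.
rewrite [phiT n v](phiE _ _ vn) mulr_sumr; apply: eq_bigr => q _.
by rewrite -scalerAr phiZ // -scalerAr key.
Qed.

End Phi.

Lemma eigen_opK phi psi : (forall r, phi r * psi r = 1) -> eigen_op phi * eigen_op psi = 1.
Proof.
move=> pp; apply: calE_ext => a; rewrite mulEE oneEE; apply: eigen_coord_inj => k i.
by rewrite !eigen_coord_eigen_op mulrA pp mul1r.
Qed.

(** Conjugation by the flip replaces ad x^(1) by ad x^(2), which is - ad x^(1) on the kernel of
    [ad_diag]. *)
Lemma eigen_op_flip phi a : ad_diag x a = 0 -> flipX (eigen_op phi (flipX a)) = eigen_op (fun r => phi (- r)) a.
Proof.
move=> xa; apply: calA_ext => k.
have ak := calA_le a k.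
have : m1 * calA_val a k - calA_val a k * m1 + (m2 * calA_val a k - calA_val a k * m2) = 0.
  by rewrite -ad_diagE xa.
rewrite /= /fps_flip; move: (calA_val a k) ak => u uk u0.
(* Weight zero in coordinates: only basis vectors with opposite eigenvalues occur in u. *)
have cab i : (@ec_c _ _ _ _ _ k (cb k) i u) * ((ec_a i)%:C + (ec_b i)%:C) = 0.
  move: u0; rewrite {1 2 3 4}(ec_sum (cb k) uk) !mulr_sumr !mulr_suml -!sumrB -big_split /=.
  rewrite (eq_bigr (fun j => (ec_c j u * ((ec_a j)%:C + (ec_b j)%:C)) *: ec_t j)).
    by move/(congr1 (ec_c i)); rewrite ec_csum ec_c0.
  move=> j _; rewrite -!scalerAr -!scalerAl -!scalerBr ec_ad1 ec_ad2.
  by rewrite -scalerDr -scalerDl scalerA.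
have flk v : ts_le k v -> ts_le k (flip T v) by exact: ts_le_flip.
have H (r : seq 'I_(ec_dim (cb k))) (f : 'I_(ec_dim (cb k)) -> C) :
    ts_le k (\sum_(i <- r) f i *: ec_t i) /\
    flip T (phiT phi k (flip T (\sum_(i <- r) f i *: ec_t i))) = \sum_(i <- r) (f i * phi (ec_b i)) *: ec_t i.
  elim: r => [|i r [IH1 IH2]].
    rewrite !big_nil linear0; split; first exact: lspan0.
    by rewrite /phiT big1 ?linear0 // => i _; rewrite ec_c0 scale0r scaler0.
  have it := ec_le i; rewrite !big_cons; split; first exact: lspan_lin.
  rewrite linearP phiT_lin ?linearP; [|exact: flk..].
  congr (_ + _) => //.
  rewrite (@phiT_eigen _ _ _ (ec_b i)); last 2 first.
  - exact: flk.
  - rewrite -[m1 * _ - _](flipK (k := k)); last exact/ts_le_ad/flk.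
    by rewrite (flip_ad _ (flk _ it)) (flipK it) ec_ad2 linearZ.
  rewrite linearZ /= (flipK it) scalerA //.
rewrite {1}(ec_sum (cb k) uk) (H _ _).2 /phiT; apply: eq_bigr => i _.
have [->|ci] := eqVneq (ec_c i u) 0; first by rewrite mul0r !scale0r scaler0.
have /eqP := cab i; rewrite mulf_eq0 (negbTE ci) /= -rmorphD => /eqP /complexI /eqP.
rewrite addrC addr_eq0 => /eqP ->.
by rewrite scalerA mulrC.
Qed.

End EigenOperators.

(** * Complex limits and derivatives along rays *)

Section ComplexLimits.
Variable R : realType.
Local Notation C := R[i].
Implicit Types (z w : C).

Lemma normcE_cabs z : `|z| = (cabs z)%:C.
Proof. by []. Qed.

Lemma cabs_ge0 z : 0 <= cabs z.
Proof. by have := normr_ge0 z; rewrite normcE_cabs ler0c. Qed.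

Lemma cabs_eq0 z : cabs z = 0 -> z = 0.
Proof. by move=> z0; apply/normr0_eq0; rewrite normcE_cabs z0. Qed.

Lemma cabs_gt0 z : z != 0 -> 0 < cabs z.
Proof.
move=> z0; rewrite lt_neqAle cabs_ge0 andbT eq_sym.
by apply: contra z0 => /eqP/cabs_eq0 ->.
Qed.

Lemma Re_le_cabs z : `|complex.Re z| <= cabs z.
Proof. by have := normc_ge_Re z; rewrite normcE_cabs lecR. Qed.

Lemma Im_le_cabs z : `|complex.Im z| <= cabs z.
Proof.
case: z => a b; rewrite /cabs /=; rewrite -[`|b|]sqrtr_sqr.
by rewrite ler_sqrt ?lerDr ?sqr_ge0 // addr_ge0 ?sqr_ge0.
Qed.

Lemma ReDc z w : complex.Re (z + w) = complex.Re z + complex.Re w.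
Proof. by case: z w => [? ?] [? ?]. Qed.
Lemma ImDc z w : complex.Im (z + w) = complex.Im z + complex.Im w.
Proof. by case: z w => [? ?] [? ?]. Qed.
Lemma ReNc z : complex.Re (- z) = - complex.Re z.
Proof. by case: z. Qed.
Lemma ImNc z : complex.Im (- z) = - complex.Im z.
Proof. by case: z. Qed.
Lemma ReMc z w : complex.Re (z * w) = complex.Re z * complex.Re w - complex.Im z * complex.Im w.
Proof. by case: z w => [? ?] [? ?]. Qed.
Lemma ImMc z w : complex.Im (z * w) = complex.Re z * complex.Im w + complex.Im z * complex.Re w.
Proof. by case: z w => [? ?] [? ?]. Qed.

Lemma complex_eqP z w : complex.Re z = complex.Re w -> complex.Im z = complex.Im w -> z = w.
Proof. by case: z w => [? ?] [? ?] /= -> ->. Qed.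

Lemma ltc0E (e : C) : 0 < e -> exists2 r : R, 0 < r & e = r%:C.
Proof.
move=> e0; exists (complex.Re e); first by move: e0; rewrite ltcE => /andP[].
by apply: complex_eqP => //=; move: e0; rewrite ltcE => /andP[/eqP -> _].
Qed.

Lemma cvgCP (I : Type) (F : set_system I) {FF : Filter F} (f : I -> C^o) (z : C^o) :
  f @ F --> z <-> forall e : R, 0 < e -> \forall i \near F, cabs (f i - z) < e.
Proof.
split=> [/cvgrPdist_lt H e e0|H]; last first.
  apply/cvgrPdist_lt => _ /ltc0E[e e0 ->]; apply: filterS (H e e0) => i.
  by rewrite distrC normcE_cabs ltcR.
have e0' : 0 < e%:C by rewrite ltcR.
by apply: filterS (H _ e0') => i; rewrite distrC normcE_cabs ltcR.
Qed.

Lemma cvg_Re (I : Type) (F : set_system I) {FF : Filter F} (f : I -> C^o) (z : C^o) :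
  f @ F --> z -> (fun i => complex.Re (f i)) @ F --> complex.Re z.
Proof.
move=> /cvgCP H; apply/cvgrPdist_lt => e /H; apply: filterS => i.
by apply: le_lt_trans; rewrite distrC -ReNc -ReDc Re_le_cabs.
Qed.

Lemma cvg_Im (I : Type) (F : set_system I) {FF : Filter F} (f : I -> C^o) (z : C^o) :
  f @ F --> z -> (fun i => complex.Im (f i)) @ F --> complex.Im z.
Proof.
move=> /cvgCP H; apply/cvgrPdist_lt => e /H; apply: filterS => i.
by apply: le_lt_trans; rewrite distrC -ImNc -ImDc Im_le_cabs.
Qed.

Lemma cabs_le z : cabs z <= `|complex.Re z| + `|complex.Im z|.
Proof.
rewrite -lecR -normcE_cabs {1}[z]complexE (le_trans (ler_normD _ _)) // normrM.
rewrite !normcE_cabs /cabs /= !expr0n /= !addr0 expr1n add0r sqrtr1 !sqrtr_sqr.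
by rewrite mul1r rmorphD.
Qed.

Lemma cvg_ReIm (I : Type) (F : set_system I) {FF : Filter F} (f : I -> C^o) (z : C^o) :
  (fun i => complex.Re (f i)) @ F --> complex.Re z ->
  (fun i => complex.Im (f i)) @ F --> complex.Im z -> f @ F --> z.
Proof.
move=> /cvgrPdist_lt H1 /cvgrPdist_lt H2; apply/cvgCP => e e0.
have e2 : 0 < e / 2 by rewrite divr_gt0.
near=> i; apply: (le_lt_trans (cabs_le _)); rewrite [ltRHS](splitr e).
apply: ltrD; rewrite ?ReDc ?ImDc ?ReNc ?ImNc distrC; near: i; [exact: H1 | exact: H2].
Unshelve. all: by end_near.
Qed.

(** The derivative of a complex function of a real variable is taken by components, so that the real
    mean value theorem applies. *)
Definition rderive (f : R -> C) (t : R) (d : C) :=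
  is_derive t 1 (fun s => complex.Re (f s)) (complex.Re d) /\
  is_derive t 1 (fun s => complex.Im (f s)) (complex.Im d).

Lemma cvg_is_derive (f : R -> R) (t d : R) :
  (fun h => h^-1 * (f (h + t) - f t)) @ 0^' --> d -> is_derive t 1 f d.
Proof.
move=> H; have H' : (fun h => h^-1 *: ((f \o shift t) (h *: 1) - f t)) @ 0^' --> d.
  by under eq_fun do rewrite /= [_ *: 1]mulr1.
apply: DeriveDef; first by apply/cvg_ex; exists d.
exact: cvg_lim.
Qed.

(** Chain rule for s |-> s z: a real increment h is the complex increment h z, and dividing by h
    instead of h z produces the factor z. *)
Lemma rderive_ray (f : C -> C) (z : C) (t : R) (d : C) : z != 0 ->
  has_cderivative f (t%:C * z) d -> rderive (fun s => f (s%:C * z)) t (z * d).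
Proof.
move=> z0 [dv dl].
have H : (fun h : C => h^-1 * (f (h + t%:C * z) - f (t%:C * z))) @ (0 : C^o)^' --> (d : C^o).
  have -> : (fun h : C => h^-1 * (f (h + t%:C * z) - f (t%:C * z))) =
    (fun h : C^o => h^-1 *: ((f \o shift (t%:C * z)) (h *: (1 : C^o)) - f (t%:C * z)) : C^o).
    by apply/funext => h /=; rewrite [_ *: 1]mulr1.
  by rewrite -dl; exact: dv.
have G : (fun h : R => z * ((h%:C * z)^-1 * (f (h%:C * z + t%:C * z) - f (t%:C * z))) : C^o) @ 0^' --> (z * d : C^o).
  apply: cvgM; first exact: cvg_cst.
  have K : (fun h : R => (h%:C * z : C^o)) @ 0^' --> (0 : C^o)^'.
    move=> A [_/= /ltc0E[e e0 ->] HA]; exists (e / cabs z).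
      by rewrite /= divr_gt0 // cabs_gt0.
    have cz0 := cabs_gt0 z0.
    move=> h /=; rewrite !sub0r !normrN => he h0; apply: HA; rewrite /=; last first.
      by rewrite mulf_neq0 // eq_complex /= eqxx andbT.
    rewrite sub0r normrN normrM !normcE_cabs -rmorphM ltcR /= {1}/cabs /= expr0n addr0 sqrtr_sqr.
    by rewrite -ltr_pdivlMr.
  exact: (cvg_comp _ _ K H).
have E h : h != 0 -> z * ((h%:C * z)^-1 * (f (h%:C * z + t%:C * z) - f (t%:C * z))) =
   (h^-1)%:C * (f ((h + t)%:C * z) - f (t%:C * z)).
  move=> h0; rewrite invfM mulrA [_ * z^-1]mulrC mulrA divff // mul1r.
  by rewrite rmorphD mulrDl fmorphV.
split; apply: cvg_is_derive.
  apply: cvg_trans (cvg_Re G); apply: near_eq_cvg.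
  near=> h; rewrite E; last by near: h; exact: nbhs_dnbhs_neq.
  by rewrite ReMc /= mul0r subr0 ReDc ReNc.
apply: cvg_trans (cvg_Im G); apply: near_eq_cvg.
near=> h; rewrite E; last by near: h; exact: nbhs_dnbhs_neq.
by rewrite ImMc /= mul0r addr0 ImDc ImNc.
Unshelve. all: by end_near.
Qed.

Lemma cderivable_cvg (f : C -> C) (z : C) : cderivable f z ->
  (f : C^o -> C^o) @ (z : C^o) --> (f z : C^o).
Proof. by move=> /derivable1_diffP /differentiable_continuous. Qed.

Lemma is_derive_ext (f f' : R -> R) (t d : R) : (forall s, f s = f' s) -> is_derive t 1 f d -> is_derive t 1 f' d.
Proof. by move=> /funext ->. Qed.

Lemma rderive_ext (f g : R -> C) t d : (forall s, f s = g s) -> rderive f t d -> rderive g t d.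
Proof. by move=> /funext ->. Qed.

Lemma rderive_near (f g : R -> C) t d : (\forall s \near t, f s = g s) -> rderive f t d -> rderive g t d.
Proof.
move=> fg [Hr Hi]; split; [apply: near_eq_is_derive Hr | apply: near_eq_is_derive Hi];
  rewrite ?oner_neq0 //; by apply: filterS fg => s ->.
Qed.

Lemma rderiveD (f g : R -> C) t d e : rderive f t d -> rderive g t e -> rderive (fun s => f s + g s) t (d + e).
Proof.
move=> [fr fi] [gr gi]; split.
- rewrite ReDc; apply: is_derive_ext (is_deriveD fr gr) => s; by rewrite ReDc.
- rewrite ImDc; apply: is_derive_ext (is_deriveD fi gi) => s; by rewrite ImDc.
Qed.

Lemma rderiveN (f : R -> C) t d : rderive f t d -> rderive (fun s => - f s) t (- d).
Proof.
move=> [fr fi]; split.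
- rewrite ReNc; apply: is_derive_ext (is_deriveN fr) => s; by rewrite ReNc.
- rewrite ImNc; apply: is_derive_ext (is_deriveN fi) => s; by rewrite ImNc.
Qed.

Lemma rderive_cst (z : C) t : rderive (fun=> z) t 0.
Proof. by split; exact: is_derive_cst. Qed.

Lemma rderiveM (f g : R -> C) t d e : rderive f t d -> rderive g t e ->
  rderive (fun s => f s * g s) t (d * g t + f t * e).
Proof.
move=> [fr fi] [gr gi]; split.
- have := is_deriveB (is_deriveM fr gr) (is_deriveM fi gi).
  move=> H; apply: (is_derive_eq (is_derive_ext _ H)) => [s|]; first by rewrite ReMc.
  by rewrite ReDc !ReMc /GRing.scale /=; ring.
- have := is_deriveD (is_deriveM fr gi) (is_deriveM fi gr).
  move=> H; apply: (is_derive_eq (is_derive_ext _ H)) => [s|]; first by rewrite ImMc.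
  by rewrite ImDc !ImMc /GRing.scale /=; ring.
Qed.

Lemma rderiveZ (f : R -> C) c t d : rderive f t d -> rderive (fun s => c * f s) t (c * d).
Proof. by move=> fd; have := rderiveM (rderive_cst c t) fd; rewrite mul0r add0r. Qed.

Lemma rderive_sum n (f : 'I_n -> R -> C) t (d : 'I_n -> C) : (forall i, rderive (f i) t (d i)) ->
  rderive (fun s => \sum_i f i s) t (\sum_i d i).
Proof.
elim: n f d => [|n IH] f d H.
  by rewrite big_ord0; apply: rderive_ext (rderive_cst 0 t) => s; rewrite big_ord0.
rewrite big_ord_recl; have := rderiveD (H ord0) (IH _ _ (fun i => H (lift ord0 i))).
by apply: rderive_ext => s; rewrite [RHS]big_ord_recl.
Qed.

Lemma is_derive0_const (f : R -> R) : (forall t : R, 0 < t -> is_derive t 1 f 0) ->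
  forall s t : R, 0 < s -> 0 < t -> f s = f t.
Proof.
move=> H; suff K s t : 0 < s -> s < t -> f t = f s.
  move=> s t s0 t0; case: (ltgtP s t) => [st|ts|-> //]; first by rewrite (K s t).
  by rewrite (K t s).
move=> s0 st; have [||c _] := @MVT R f (fun=> 0) s t st.
- by move=> x; rewrite in_itv /= => /andP[sx _]; apply: H; exact: lt_trans sx.
- apply: continuous_in_subspaceT => x; rewrite inE /= in_itv /= => /andP[sx _].
  have [dx _] := H x (lt_le_trans s0 sx).
  by move/derivable1_diffP: dx => /differentiable_continuous.
by rewrite mul0r => /eqP; rewrite subr_eq0 => /eqP.
Qed.

(* [|f|^2] is conserved by [f' = i a f] with [a] real. *)
Lemma oscillation_eq0 (f : R -> C) (a : R) :
  (forall t : R, 0 < t -> rderive f t ('i%C * a%:C * f t)) ->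
  (forall e, 0 < e -> exists2 t, 0 < t & cabs (f t) < e) ->
  forall t, 0 < t -> f t = 0.
Proof.
move=> fd f0; pose N t := complex.Re (f t) ^+ 2 + complex.Im (f t) ^+ 2.
have Nc : forall s t : R, 0 < s -> 0 < t -> N s = N t.
  apply: is_derive0_const => t /fd [fr fi].
  apply: (is_derive_eq (is_deriveD (is_deriveM fr fr) (is_deriveM fi fi))).
  by rewrite !ReMc !ImMc /GRing.scale /=; ring.
have cN t : cabs (f t) ^+ 2 = N t.
  rewrite /cabs /N; case: (f t) => u v /=.
  by rewrite sqr_sqrtr // addr_ge0 ?sqr_ge0.
move=> t t0; suff : cabs (f t) = 0 by exact: cabs_eq0.
apply/eqP; rewrite eq_le cabs_ge0 andbT leNgt; apply/negP => ft.
have [s s0 fs] := f0 _ ft.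
have : cabs (f s) ^+ 2 = cabs (f t) ^+ 2 by rewrite !cN (Nc s t).
move/eqP; rewrite eqrXn2 ?cabs_ge0 // => /eqP fst.
by move: fs; rewrite fst ltxx.
Qed.

End ComplexLimits.

(** * The complex exponential and its power series *)

Section ComplexExponential.
Variable R : realType.
Local Notation C := R[i].
Implicit Types (z w : C).

(** Euler's formula serves as the definition, so the addition law and the derivative come from the
    real functions; agreement with the power series is [cexp_series]. *)
Definition cexp z : C :=
  (expR (complex.Re z) * cos (complex.Im z)) +i* (expR (complex.Re z) * sin (complex.Im z)).

Lemma cexpD z w : cexp (z + w) = cexp z * cexp w.
Proof.
apply: complex_eqP; rewrite ?ReMc ?ImMc /= ReDc ImDc expRD ?cosD ?sinD; ring.
Qed.

Lemma cexp0 : cexp 0 = 1.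
Proof. by apply: complex_eqP => /=; rewrite expR0 ?cos0 ?sin0 ?mulr1 ?mulr0. Qed.

Lemma cexpVK z : cexp z * cexp (- z) = 1.
Proof. by rewrite -cexpD subrr cexp0. Qed.

Lemma is_derive_linear (k t : R) : is_derive t 1 (fun s => s * k) k.
Proof.
have := is_deriveM (is_derive_id t (1 : R)) (is_derive_cst k t 1).
move=> H; apply: (is_derive_eq (is_derive_ext _ H)) => [s //|].
by rewrite /GRing.scale /= mulr0 add0r mulr1.
Qed.

Lemma rderive_linear z t : rderive (fun s => s%:C * z) t z.
Proof.
split.
- by apply: is_derive_ext (is_derive_linear (complex.Re z) t) => s; rewrite ReMc /= mul0r subr0.
- by apply: is_derive_ext (is_derive_linear (complex.Im z) t) => s; rewrite ImMc /= mul0r addr0.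
Qed.

Lemma rderive_cexp z t : rderive (fun s => cexp (s%:C * z)) t (z * cexp (t%:C * z)).
Proof.
have e := @is_derive1_comp R (@expR R) (fun s => s * complex.Re z) t _ _ (is_derive_expR _) (is_derive_linear (complex.Re z) t).
have c := @is_derive1_comp R (@cos R) (fun s => s * complex.Im z) t _ _ (is_derive_cos _) (is_derive_linear (complex.Im z) t).
have s := @is_derive1_comp R (@sin R) (fun s => s * complex.Im z) t _ _ (is_derive_sin _) (is_derive_linear (complex.Im z) t).
have Er (r : R) : complex.Re (r%:C * z) = r * complex.Re z. by rewrite ReMc /= mul0r subr0.
have Ei (r : R) : complex.Im (r%:C * z) = r * complex.Im z by rewrite ImMc /= mul0r addr0.
split.
- apply: (is_derive_eq (is_derive_ext _ (is_deriveM e c))) => [r|].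
    change (expR (r * complex.Re z) * cos (r * complex.Im z) =
      expR (complex.Re (r%:C * z)) * cos (complex.Im (r%:C * z))).
    by rewrite Er Ei.
  rewrite ReMc; change (complex.Re (cexp (t%:C * z))) with
    (expR (complex.Re (t%:C * z)) * cos (complex.Im (t%:C * z))).
  change (complex.Im (cexp (t%:C * z))) with
    (expR (complex.Re (t%:C * z)) * sin (complex.Im (t%:C * z))).
  by rewrite Er Ei /GRing.scale /=; ring.
- apply: (is_derive_eq (is_derive_ext _ (is_deriveM e s))) => [r|].
    change (expR (r * complex.Re z) * sin (r * complex.Im z) =
      expR (complex.Re (r%:C * z)) * sin (complex.Im (r%:C * z))).
    by rewrite Er Ei.
  rewrite ImMc; change (complex.Re (cexp (t%:C * z))) with
    (expR (complex.Re (t%:C * z)) * cos (complex.Im (t%:C * z))).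
  change (complex.Im (cexp (t%:C * z))) with
    (expR (complex.Re (t%:C * z)) * sin (complex.Im (t%:C * z))).
  by rewrite Er Ei /GRing.scale /=; ring.
Qed.

Lemma rderive_powS z t n :
  rderive (fun s => (s%:C * z) ^+ n.+1) t (n.+1%:R * z * (t%:C * z) ^+ n).
Proof.
elim: n => [|n IH].
  by rewrite expr0 mul1r mulr1; exact: rderive_linear.
have := rderiveM (rderive_linear z t) IH.
have -> : z * (t%:C * z) ^+ n.+1 + t%:C * z * (n.+1%:R * z * (t%:C * z) ^+ n) =
   n.+2%:R * z * (t%:C * z) ^+ n.+1.
  by rewrite [n.+2%:R]mulrS !exprS; ring.
by apply: rderive_ext => s; rewrite [RHS]exprS.
Qed.

(** Taylor remainder along the segment from 0 to z; differentiating in t lowers its order by one and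
    gives a factor z. *)
Let rem z n (t : R) : C := cexp (t%:C * z) - \sum_(j < n) (j`!%:R)^-1 * (t%:C * z) ^+ j.

Let rem_rderive z n t : rderive (rem z n.+1) t (z * rem z n t).
Proof.
have := rderiveD (rderive_cexp z t) (rderiveN (rderiveD (rderive_cst (1 : C) t)
  (rderive_sum (fun j : 'I_n => rderiveZ ((j.+1)`!%:R^-1) (rderive_powS z t j))))).
have -> : z * cexp (t%:C * z) -
   (0 + \sum_(j < n) (j.+1)`!%:R^-1 * (j.+1%:R * z * (t%:C * z) ^+ j)) = z * rem z n t.
  rewrite add0r /rem mulrBr mulr_sumr; congr (_ - _); apply: eq_bigr => j _.
  rewrite factS natrM invfM !mulrA [_ * j.+1%:R]mulrC !mulrA divff ?mul1r ?pnatr_eq0 //.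
  by rewrite [z * _]mulrC.
apply: rderive_ext => s; rewrite /rem big_ord_recl; congr (_ - (_ + _)).
by rewrite fact0 invr1 mulr1.
Qed.

(** Both v + u and v - u vanish at 0 and have nonnegative derivative on [0, 1]. *)
Lemma deriv_bound (u du v dv : R -> R) : (forall t : R, is_derive t 1 u (du t)) ->
  (forall t : R, is_derive t 1 v (dv t)) -> (forall t : R, 0 <= t <= 1 -> `|du t| <= dv t) ->
  u 0 = 0 -> v 0 = 0 -> forall t : R, 0 <= t <= 1 -> `|u t| <= v t.
Proof.
move=> ud vd ub u0 v0.
have mono (f df : R -> R) : (forall t : R, is_derive t 1 f (df t)) ->
    (forall t : R, 0 <= t <= 1 -> 0 <= df t) -> f 0 = 0 -> forall t : R, 0 <= t <= 1 -> 0 <= f t.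
  move=> fd df0 f0 t /andP[t0 t1].
  have fc : {within `[0, t], continuous f}.
    apply: continuous_subspaceT => x; have [dx _] := fd x.
    by move/derivable1_diffP: dx => /differentiable_continuous.
  have [c] := MVT_segment t0 (fun x _ => fd x) fc.
  rewrite in_itv /= f0 !subr0 => /andP[c0 ct] ->; apply: mulr_ge0 => //.
  by apply: df0; rewrite c0 (le_trans ct).
move=> t t01; rewrite ler_norml; apply/andP; split.
  rewrite -subr_ge0 opprK; apply: (mono _ _ (fun t => is_deriveD (ud t) (vd t))) => //.
    by move=> s /ub; rewrite ler_norml => /andP[+ _]; rewrite -subr_ge0 opprK.
  by rewrite /= -[LHS]/(u 0 + v 0) u0 v0 addr0.
rewrite -subr_ge0; apply: (mono _ _ (fun t => is_deriveB (vd t) (ud t))) => //.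
  by move=> s /ub; rewrite ler_norml => /andP[_ +]; rewrite subr_ge0.
by rewrite -[LHS]/(v 0 - u 0) u0 v0 subr0.
Qed.

Let M z : R := expR `|complex.Re z|.
Let c z : R := `|complex.Re z| + `|complex.Im z|.

(** The bound of order n, integrated, gives the one of order n + 1: [c z] controls the effect of
    multiplication by z on each component, and [M z] bounds the exponential on the segment. At t = 1
    the bound is, up to [M z], the general term of the exponential series of [c z], which tends to
    0. *)
Let rem_bound z n (t : R) : 0 <= t <= 1 ->
  `|complex.Re (rem z n t)| <= M z * ((t * c z) ^+ n / n`!%:R) /\
  `|complex.Im (rem z n t)| <= M z * ((t * c z) ^+ n / n`!%:R).
Proof.
elim: n t => [|n IH] t t01.
  have /andP[t0 t1] := t01.
  have eM : expR (t * complex.Re z) <= M z.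
    rewrite ler_expR (le_trans (ler_norm _)) // normrM ger0_norm //.
    by rewrite -[leRHS]mul1r ler_wpM2r.
  rewrite /rem big_ord0 subr0 expr0 fact0 divr1 mulr1 /= ReMc ImMc /= !mul0r subr0 addr0.
  rewrite !normrM (ger0_norm (expR_ge0 _)); split.
    by rewrite (le_trans _ eM) // -[leRHS]mulr1 ler_wpM2l ?expR_ge0 // cos_max.
  by rewrite (le_trans _ eM) // -[leRHS]mulr1 ler_wpM2l ?expR_ge0 // sin_max.
have c0 : 0 <= c z by rewrite addr_ge0.
have vd (s : R) : is_derive s 1 (fun t => M z * ((t * c z) ^+ n.+1 / n.+1`!%:R)) (c z * (M z * ((s * c z) ^+ n / n`!%:R))).
  have := is_deriveZ (M z * n.+1`!%:R^-1) (is_deriveX n.+1 (is_derive_linear (c z) s)).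
  move=> H; apply: (is_derive_eq (is_derive_ext _ H)) => [r|].
    rewrite fctE.
    change (M z / n.+1`!%:R * (r * c z) ^+ n.+1 = M z * ((r * c z) ^+ n.+1 / n.+1`!%:R)).
    by rewrite mulrAC mulrA.
  rewrite /GRing.scale /= factS natrM invfM.
  have n0 : n.+1%:R != 0 :> R by rewrite pnatr_eq0.
  have f0 : n`!%:R != 0 :> R by rewrite pnatr_eq0 -lt0n fact_gt0.
  have key (m q f k P : R) : q != 0 -> f != 0 -> m * (q^-1 * f^-1) * (q * P * k) = k * (m * (P / f)).
    by move=> q0 f1; field; rewrite q0 f1.
  exact: key.
have r0 : rem z n.+1 0 = 0.
  rewrite /rem mul0r cexp0 big_ord_recl expr0 fact0 invr1 mulr1 big1 ?addr0 ?subrr // => j _.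
  by rewrite exprS mul0r mulr0.
have v0 : M z * ((0 * c z) ^+ n.+1 / n.+1`!%:R) = 0 by rewrite mul0r expr0n /= mul0r mulr0.
have bd (a b p q k : R) : `|p| <= k -> `|q| <= k -> `|a| + `|b| = c z -> `|a * p + b * q| <= c z * k.
  move=> pk qk <-; rewrite (le_trans (ler_normD _ _)) // !normrM mulrDl.
  by rewrite lerD // ler_wpM2l.
split; move: t t01.
  apply: (deriv_bound (fun t => (rem_rderive z n t).1) vd) => [s /IH[h1 h2]||//]; last by rewrite r0.
  by rewrite ReMc -mulNr; apply: bd => //; rewrite normrN.
apply: (deriv_bound (fun t => (rem_rderive z n t).2) vd) => [s /IH[h1 h2]||//]; last by rewrite r0.
by rewrite ImMc; apply: bd.
Qed.

Lemma cexp_series z :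
  (fun n : nat => \sum_(j < n) (j`!%:R)^-1 * z ^+ j : C^o) @ \oo --> (cexp z : C^o).
Proof.
have K : (fun n => M z * (c z ^+ n / n`!%:R)) @ \oo --> (0 : R).
  rewrite -(mulr0 (M z)); apply: cvgM; first exact: cvg_cst.
  exact: (cvg_series_cvg_0 (is_cvg_series_exp_coeff (c z))).
apply/cvgCP => e e0; have e2 : 0 < e / 2 by rewrite divr_gt0.
move/cvgrPdist_lt: K => /(_ _ e2); apply: filterS => n.
rewrite sub0r normrN => Kn.
have [|h1 h2] := @rem_bound z n 1; first by rewrite ler01 lexx.
rewrite -opprB; apply: le_lt_trans (cabs_le _) _; rewrite ReNc ImNc !normrN [ltRHS]splitr.
have E : cexp z - \sum_(j < n) (j`!%:R)^-1 * z ^+ j = rem z n 1 by rewrite /rem mul1r.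
rewrite E; move: h1 h2; rewrite mul1r => h1 h2.
have lt := le_lt_trans (ler_norm _) Kn.
by apply: ltrD; apply: le_lt_trans lt.
Qed.

End ComplexExponential.

(** * Truncated functionals and uniqueness *)

Lemma cvg_sum_C (R : realType) (I : Type) (F : set_system I) {FF : Filter F} n
    (f : 'I_n -> I -> R[i]^o) (l : 'I_n -> R[i]^o) :
  (forall i, f i @ F --> l i) -> (fun N => \sum_i f i N) @ F --> (\sum_i l i : R[i]^o).
Proof.
elim: n f l => [|n IH] f l H.
  by rewrite big_ord0; under eq_fun do rewrite big_ord0; exact: cvg_cst.
rewrite big_ord_recl; under eq_fun do rewrite big_ord_recl.
by apply: cvgD => //; exact: IH.
Qed.

Section ConstantTerm.
Variables (R : realType) (g : lieAlgebra R[i]) (U : envelopingAlgebra g).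
Variables (T : tensorSquare U).
Local Notation C := R[i].
Local Notation calA := (calA T).
Local Notation calE := (calE T).
Local Notation filA := (@filA _ _ _ T).
Local Notation filE := (@filE _ _ _ T).
Local Notation flipX := (flipX T).
Local Notation ad_diag := (ad_diag T).
Implicit Types (a b c : calA) (X Y : calE).

Lemma ue_le0 (a : U) : ue_le 0 a -> exists c : C, a = c *: 1.
Proof.
elim=> [|c _ v [s /= + <-] _ [d ->]]; first by exists 0; rewrite scale0r.
rewrite leqn0 size_eq0 => /eqP ->; rewrite big_nil.
by exists (c + d); rewrite scalerDl.
Qed.

Lemma ts_le0 (u : T) : ts_le 0 u -> exists c : C, u = c *: 1.
Proof.
elim=> [|c _ v [a [b [/ue_le0[r ->] /ue_le0[s ->] ->]]] _ [d ->]].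
  by exists 0; rewrite scale0r.
exists (c * (r * s) + d); rewrite scalerDl -!scalerA; congr (_ *: _ + _).
by rewrite tensZl tensZr tens1.
Qed.

(** By the degree condition the coefficient of hbar^0 lies in U_{<=0} (x) U_{<=0}, which consists of
    scalars. This is the augmentation of A, a character with kernel A_1. *)
Definition const_term (a : calA) : C := xget 0 [set c | calA_val a 0%N = c *: 1].

Lemma const_termE a : calA_val a 0%N = const_term a *: 1.
Proof.
rewrite /const_term; case: xgetP => [c _ //|no].
by have [c ac] := ts_le0 (calA_le a 0); case: (no c).
Qed.

Lemma const_term_unique a s : calA_val a 0%N = s *: 1 -> const_term a = s.
Proof.
rewrite const_termE => /eqP; rewrite -subr_eq0 -scalerBl scaler_eq0 oner_eq0 orbF subr_eq0.
by move=> /eqP.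
Qed.

Lemma const_term_scalar : scalar const_term.
Proof.
move=> s a b; apply: const_term_unique.
rewrite -[LHS]/(s *: calA_val a 0%N + calA_val b 0%N) !const_termE.
by rewrite scalerA -scalerDl.
Qed.

Definition const_terml : {scalar calA} := scalar_of const_term_scalar.

Lemma const_term_trunc : trunc_functional filA 1 const_terml.
Proof. by move=> a /(_ 0%N isT) a0; apply: const_term_unique; rewrite a0 scale0r. Qed.

Lemma const_termM a b : const_term (a * b) = const_term a * const_term b.
Proof.
apply: const_term_unique; rewrite -[LHS]/(\sum_(i < 1) calA_val a i * calA_val b (0 - i)%N).
by rewrite big_ord1 /= !const_termE -scalerAl mul1r scalerA.
Qed.

Lemma const_term1 : const_term 1 = 1.
Proof. by apply: const_term_unique; rewrite scale1r. Qed.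

Lemma const_term_filA a : filA 1 a -> const_term a = 0. Proof. exact: const_term_trunc. Qed.

Lemma const_termB a b : const_term (a - b) = const_term a - const_term b.
Proof. exact: (linearB const_terml). Qed.

Lemma const_term_unip a : const_term a = 1 <-> filA 1 (1 - a).
Proof.
split=> [a1 [|//] _|/const_term_filA]; last by rewrite const_termB const_term1 => /eqP; rewrite subr_eq0 => /eqP.
rewrite -[LHS]/(calA_val 1 0%N - calA_val a 0%N) !const_termE a1 const_term1 subrr //.
Qed.

Lemma const_term_flip a : const_term (flipX a) = const_term a.
Proof.
apply: const_term_unique; rewrite -[LHS]/(flip T (calA_val a 0%N)) const_termE linearZ /= flip1 //.
Qed.

Lemma const_term_ad x a : const_term (adE T x a) = 0.
Proof.
apply: const_term_unique; rewrite scale0r.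
rewrite -[LHS]/(tens T (ue_in U x) 1 * calA_val a 0%N - calA_val a 0%N * tens T (ue_in U x) 1).
by rewrite const_termE -scalerAl -scalerAr mul1r mulr1 subrr.
Qed.

Lemma const_term_unit a : const_term a = 1 -> exists b, [/\ a * b = 1, b * a = 1 & const_term b = 1].
Proof.
move=> a1; have [b1 b2] := invAK ((const_term_unip a).1 a1); exists (invA a); split=> //.
by have := const_termM (invA a) a; rewrite b1 a1 mulr1 const_term1.
Qed.

Lemma const_term_cancel a b c : const_term a = 1 -> a * b = a * c -> b = c.
Proof.
move=> /const_term_unit[d [_ da _]] /(congr1 (fun v => d * v)).
by rewrite !mulrA da !mul1r.
Qed.

Definition weak_derive (f : R -> calA) (t : R) (d : calA) :=
  forall n (l : {scalar calA}), trunc_functional filA n l -> rderive (fun s => l (f s)) t (l d).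

Definition comp_scalar (l : {scalar calA}) X : {scalar calA}.
Proof.
apply: (@scalar_of _ _ (fun a => l (X a))).
by move=> s a b; rewrite calED calEZ linearP.
Defined.

Lemma comp_trunc n (l : {scalar calA}) X : trunc_functional filA n l ->
  trunc_functional filA n (comp_scalar l X).
Proof. by move=> ln a an; apply: ln; exact: calE_fil. Qed.

(** Through evaluation at a followed by l, an equation between operators yields one in A. *)
Definition ev_scalar (l : {scalar calA}) a : {scalar calE}.
Proof.
apply: (@scalar_of _ _ (fun X : calE => l (X a))).
by move=> s X Y; rewrite addEE scaleEE linearP.
Defined.

Lemma ev_scalarE (l : {scalar calA}) a X : ev_scalar l a X = l (X a).
Proof. by []. Qed.

Lemma ev_trunc n (l : {scalar calA}) a : trunc_functional filA n l ->
  trunc_functional filE n (ev_scalar l a).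
Proof. by move=> ln X Xn; apply: ln; exact: Xn. Qed.

Lemma weak_derive_op X f t d : weak_derive f t d -> weak_derive (fun s => X (f s)) t (X d).
Proof. by move=> fd n l ln; exact: (fd n (comp_scalar l X) (comp_trunc X ln)). Qed.

Lemma weak_deriveB f h t d e : weak_derive f t d -> weak_derive h t e -> weak_derive (fun s => f s - h s) t (d - e).
Proof.
move=> fd he n l ln; rewrite linearB.
by apply: rderive_ext (rderiveD (fd n l ln) (rderiveN (he n l ln))) => s; rewrite linearB.
Qed.

Lemma weak_derive_ext f h t d : (forall s, 0 < s -> f s = h s) -> 0 < t -> weak_derive f t d -> weak_derive h t d.
Proof.
move=> fh t0 fd n l ln; apply: rderive_near (fd n l ln).
by near=> s; rewrite fh //; near: s; exact: lt_nbhsr.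
Unshelve. all: by end_near.
Qed.

(** * The exponential of ad x^(1) and uniqueness along a ray *)

Section Coordinates.
Variables (x : g) (cb : forall k, eigen_coords T x k).
Local Notation eigen_coord := (eigen_coord (cb := cb)).
Local Notation eigen_op := (eigen_op cb).

Lemma const_term_eigen_op phi a : phi 0 = 1 -> const_term (eigen_op phi a) = const_term a.
Proof.
move=> phi0; apply: const_term_unique; rewrite -[LHS]/(phiT cb phi 0 (calA_val a 0%N)).
rewrite (@phiT_eigen _ _ _ _ _ cb phi 0 _ 0) ?phi0 ?scale1r ?const_termE //; first by rewrite -const_termE; exact: calA_le.
by rewrite -scalerAl -scalerAr mul1r mulr1 subrr scale0r.
Qed.

(** An operator diagonal in eigen-coordinates agrees modulo E_n with a finite combination of
    rank-one projections, so a truncated functional on E sees finitely many eigenvalues. *)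
Lemma diag_trunc n (l : {scalar calE}) (X : calE) (d : forall k, 'I_(ec_dim (cb k)) -> C)
    (P : forall k, 'I_(ec_dim (cb k)) -> calE) :
  (forall k i a, P k i a = eigen_coord i a *: eigen_vec i) ->
  (forall k (i : 'I_(ec_dim (cb k))) a, eigen_coord i (X a) = d k i * eigen_coord i a) ->
  trunc_functional filE n l -> l X = \sum_(k < n) \sum_i d k i * l (P k i).
Proof.
move=> PE dE ln; have : filE n (X - \sum_(k < n) \sum_i d k i *: P k i).
  move=> a; change (filA n (X a - (\sum_(k < n) \sum_i d k i *: P k i) a)).
  have -> : (\sum_(k < n) \sum_i d k i *: P k i) a = \sum_(k < n) \sum_(i < ec_dim (cb k)) eigen_coord i (X a) *: eigen_vec i.
    rewrite sumEE; apply: eq_bigr => k _; rewrite sumEE; apply: eq_bigr => i _.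
    by rewrite scaleEE PE dE scalerA.
  exact: eigen_coord_decomp.
move=> /ln; rewrite linearB => /eqP; rewrite subr_eq0 => /eqP ->.
rewrite linear_sum; apply: eq_bigr => k _; rewrite linear_sum; apply: eq_bigr => i _.
by rewrite linearZ.
Qed.

Lemma proj_subproof k (i : 'I_(ec_dim (cb k))) : (fun a => eigen_coord i a *: eigen_vec i) \in @calE_pred _ _ _ T.
Proof.
apply/asboolP; split=> [s a b|n a an].
  by rewrite eigen_coord_scalar scalerDl -scalerA.
have [kn|nk] := ltnP k n.
  by rewrite -[eigen_coord i a]/(ec_c i (calA_val a k)) (an k kn) ec_c0 scale0r.
apply: filAZ; apply: filA_le nk _; exact: eigen_vec_fil.
Qed.

Definition eigen_projX k i : calE := CalE (@proj_subproof k i).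

Definition exp_ad (z : C) : calE := eigen_op (fun r => cexp (z * r%:C)).

(** The partial sums are diagonal and converge, eigenvalue by eigenvalue, to the scalar exponential.
    As [expE] picks an unspecified limit, uniqueness of the limit matters too: evaluations followed
    by eigen-coordinates separate operators. *)
Lemma expE_exp_ad (z : C) : expE (z *: adE T x) = exp_ad z.
Proof.
have cv : converges filE \oo (fun N : nat => \sum_(j < N) (j`!%:R : C)^-1 *: (z *: adE T x) ^+ j) (exp_ad z).
  move=> n l ln.
  have PE k (i : 'I_(ec_dim (cb k))) a : eigen_projX i a = eigen_coord i a *: eigen_vec i by [].
  rewrite (diag_trunc PE (fun k i a => eigen_coord_eigen_op _ i a) ln).
  have SE N : l (\sum_(j < N) (j`!%:R : C)^-1 *: (z *: adE T x) ^+ j) =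
      \sum_(k < n) \sum_i (\sum_(j < N) (j`!%:R : C)^-1 * (z * (ec_a i)%:C) ^+ j) * l (@eigen_projX k i).
    apply: (diag_trunc PE (d := fun k i => \sum_(j < N) (j`!%:R : C)^-1 * (z * (ec_a i)%:C) ^+ j)) => // k i a.
    rewrite sumEE -[LHS]/(eigen_coordl i _) linear_sum mulr_suml; apply: eq_bigr => j _.
    rewrite scaleEE linearZ /= -mulrA; congr (_ * _).
    elim: (nat_of_ord j) => [|m IH]; first by rewrite !expr0 oneEE mul1r.
    by rewrite !exprS mulEE scaleEE -[LHS]/(eigen_coordl i _) linearZ /= eigen_coord_ad IH !mulrA.
  under eq_fun do rewrite SE.
  apply: cvg_sum_C => k; apply: cvg_sum_C => i.
  by apply: cvgM; [exact: cexp_series | exact: cvg_cst].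
rewrite /expE; case: xgetP => [Y _ Yc|/(_ (exp_ad z))//].
apply: calE_ext => a; apply: (@eigen_coord_inj _ _ _ _ _ cb) => k i.
have h := ev_trunc a (@eigen_coord_trunc _ _ _ _ _ cb k i).
exact: (cvg_unique (@norm_hausdorff _ _) (Yc _ _ h) (cv _ _ h)).
Qed.

Lemma eigen_coord_exp_ad z k (i : 'I_(ec_dim (cb k))) a : eigen_coord i (exp_ad z a) = cexp (z * (ec_a i)%:C) * eigen_coord i a.
Proof. exact: eigen_coord_eigen_op. Qed.

Lemma exp_adM z a b : exp_ad z (a * b) = exp_ad z a * exp_ad z b.
Proof. by apply: eigen_opM => r s; rewrite rmorphD mulrDr cexpD. Qed.

Lemma exp_adK z a : exp_ad z (exp_ad (- z) a) = a.
Proof.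
rewrite -mulEE eigen_opK // => r; by rewrite mulNr cexpVK.
Qed.

Lemma exp_ad_fix z a : adE T x a = 0 -> exp_ad z a = a.
Proof. by move=> /(eigen_op0 _ (fun r => cexp (z * r%:C))) ->; rewrite mulr0 cexp0 scale1r. Qed.

Lemma exp_ad_flip z a : ad_diag x a = 0 -> flipX (exp_ad z (flipX a)) = exp_ad (- z) a.
Proof.
move=> xa; rewrite /exp_ad eigen_op_flip //; congr (eigen_op _ a); apply/funext => r.
by rewrite rmorphN mulrN mulNr.
Qed.

Lemma const_term_exp_ad z a : const_term (exp_ad z a) = const_term a.
Proof. by apply: const_term_eigen_op; rewrite mulr0 cexp0. Qed.

(** Induction on the filtration: the equation at level n has to be known only once X lies in A_n
    along the ray, and its frequency may vary with the coordinate. The smallness hypothesis serves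
    for decay at either end of the ray. *)
Lemma uniqueness (X : R -> calA) :
  (forall n, (forall t, 0 < t -> filA n (X t)) -> forall i : 'I_(ec_dim (cb n)),
     exists r : R, forall t, 0 < t -> rderive (fun s => eigen_coord i (X s)) t ('i%C * r%:C * eigen_coord i (X t))) ->
  (forall n (l : {scalar calA}), trunc_functional filA n l ->
     forall e : R, 0 < e -> exists2 t, 0 < t & cabs (l (X t)) < e) ->
  forall t, 0 < t -> X t = 0.
Proof.
move=> Xd X0; suff H n : forall t, 0 < t -> filA n (X t).
  by move=> t t0; apply: filA_eq => n; rewrite subr0; exact: H.
elim: n => [t _ //|n IH] t t0; apply: (@filA_eigen_coord _ _ _ _ _ cb); first exact: IH.
move=> i; have [r Hr] := Xd n IH i.
apply: (oscillation_eq0 Hr) => //.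
exact: (X0 _ (eigen_coordl i) (@eigen_coord_trunc _ _ _ _ _ _ n i)).
Qed.

Lemma eigen_coord_unip n a u (i : 'I_(ec_dim (cb n))) : filA n a -> filA 1 (1 - u) -> eigen_coord i (a * u) = eigen_coord i a.
Proof.
move=> an u1; apply/eqP; rewrite eq_sym -subr_eq0 -[eigen_coord i a]/(eigen_coordl i a) -[eigen_coord i (a * u)]/(eigen_coordl i (a * u)) -linearB.
apply/eqP; apply: eigen_coord_trunc.
have -> : a - a * u = a * (1 - u) by rewrite mulrBr mulr1.
by rewrite -addn1; exact: filA_mul.
Qed.

Lemma eigen_coord_raise n a u (i : 'I_(ec_dim (cb n))) : filA n a -> filA 1 u -> eigen_coord i (u * a) = 0.
Proof.
move=> an u1; apply: (@eigen_coord_trunc _ _ _ _ _ _ n i); rewrite -add1n; exact: filA_mul.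
Qed.

Variable hO : calA.
Hypothesis hO1 : filA 1 hO.

(** The equation holds for X u, with u standing for z^(h Omega_0), while the limit is known for X.
    Both have the same leading coordinates since u is 1 modulo A_1. The term in [hO] raises the
    filtration, which leaves the frequency s a, with a an eigenvalue of ad x^(1). *)
Lemma uniqueness_infty (s : R) (X u : R -> calA) : (forall t, 0 < t -> filA 1 (1 - u t)) ->
  (forall t, 0 < t -> weak_derive (fun t => X t * u t) t
     (t%:C^-1 *: (hO * (X t * u t)) + ('i%C * s%:C) *: adE T x (X t * u t))) ->
  (forall n (l : {scalar calA}), trunc_functional filA n l ->
     forall e : R, 0 < e -> exists2 t, 0 < t & cabs (l (X t)) < e) ->
  forall t, 0 < t -> X t = 0.
Proof.
move=> u1 Wd; apply: uniqueness => n Xn i; exists (s * ec_a i) => t t0.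
have := Wd t t0 _ (eigen_coordl i) (@eigen_coord_trunc _ _ _ _ _ _ n i).
rewrite linearD !linearZ /= eigen_coord_raise ?mulr0 ?add0r //; last exact/filAMr/Xn.
rewrite eigen_coord_ad (eigen_coord_unip _ (Xn t t0) (u1 t t0)).
rewrite rmorphM !mulrA; apply: rderive_near; near=> r.
have r0 : 0 < r by near: r; exact: lt_nbhsr.
exact: eigen_coord_unip (Xn r r0) (u1 r r0).
Unshelve. all: by end_near.
Qed.

(** Once ad x^(1) has been conjugated away, the whole right-hand side raises the filtration, so the
    leading coordinates are constant: the frequency is 0. *)
Lemma uniqueness_zero (X u m : R -> calA) : (forall t, 0 < t -> filA 1 (1 - u t)) ->
  (forall t, filA 1 (m t)) ->
  (forall t, 0 < t -> weak_derive (fun t => X t * u t) t (t%:C^-1 *: (m t * (X t * u t)))) ->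
  (forall n (l : {scalar calA}), trunc_functional filA n l ->
     forall e : R, 0 < e -> exists2 t, 0 < t & cabs (l (X t)) < e) ->
  forall t, 0 < t -> X t = 0.
Proof.
move=> u1 m1 Wd; apply: uniqueness => n Xn i; exists 0 => t t0.
have := Wd t t0 _ (eigen_coordl i) (@eigen_coord_trunc _ _ _ _ _ _ n i).
rewrite linearZ /= eigen_coord_raise; [rewrite mulr0 | | exact: m1]; last by apply/filAMr/Xn.
rewrite mulr0 mul0r; apply: rderive_near; near=> r.
have r0 : 0 < r by near: r; exact: lt_nbhsr.
exact: eigen_coord_unip (Xn r r0) (u1 r r0).
Unshelve. all: by end_near.
Qed.

End Coordinates.
End ConstantTerm.

(** * Symmetries of the canonical solutions *)

Section ComplexLog.
Variable R : realType.
Local Notation C := R[i].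

Lemma clog_arc (r th : R) : 0 < r -> 0 <= th <= pi ->
  clog (r%:C * (cos th +i* sin th)) = (ln r)%:C + th%:C * 'i%C.
Proof.
move=> r0 th0; have s0 : 0 <= sin th by apply: sin_ge0_pi.
have cabsE : cabs (r%:C * (cos th +i* sin th)) = r.
  rewrite /cabs /= !mul0r subr0 addr0 !exprMn -mulrDr cos2Dsin2 mulr1.
  by rewrite sqrtr_sqr gtr0_norm.
rewrite /clog /carg cabsE; congr (_ + _%:C * _).
rewrite ImMc /= mul0r addr0 mulr_ge0 ?(ltW r0) // mul0r subr0.
by rewrite mulrAC divff ?gt_eqF // mul1r cosK // in_itv.
Qed.

Lemma clog_arcN (r th : R) : 0 < r -> 0 < th < pi ->
  clog (r%:C * (cos th -i* sin th)) = (ln r)%:C - th%:C * 'i%C.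
Proof.
move=> r0 /andP[th0 th1]; have s0 : 0 < sin th by apply: sin_gt0_pi; rewrite th0.
have cabsE : cabs (r%:C * (cos th -i* sin th)) = r.
  rewrite /cabs /= !mul0r subr0 addr0 !exprMn sqrrN -mulrDr cos2Dsin2 mulr1.
  by rewrite sqrtr_sqr gtr0_norm.
rewrite /clog /carg cabsE; congr (_ + _).
rewrite ImMc /= mul0r addr0 mulrN oppr_ge0 leNgt mulr_gt0 //= mul0r subr0.
rewrite mulrAC divff ?gt_eqF // mul1r cosK ?in_itv /= ?ltW //.
by rewrite rmorphN mulNr.
Qed.

Lemma clog_pi (t : R) : 0 < t -> clog (t%:C * 'i%C) = (ln t)%:C + (pi / 2)%:C * 'i%C.
Proof.
move=> t0; rewrite -(@clog_arc t (pi / 2)) //.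
  by rewrite cos_pihalf sin_pihalf.
by rewrite divr_ge0 ?pi_ge0 //= ler_pdivrMr // ler_peMr ?pi_ge0 // ler1n.
Qed.

Lemma clog_piN (t : R) : 0 < t -> clog (t%:C * - 'i%C) = (ln t)%:C - (pi / 2)%:C * 'i%C.
Proof.
move=> t0; rewrite -(@clog_arcN t (pi / 2)) //.
  by rewrite cos_pihalf sin_pihalf; congr (clog (_ * _)); apply: complex_eqP; rewrite /= ?oppr0.
by rewrite divr_gt0 ?pi_gt0 //= ltr_pdivrMr // ltr_pMr ?pi_gt0 // ltr1n.
Qed.

Lemma slitL_ray (z : C) (t : R) : slitL z -> 0 < t -> slitL (t%:C * z).
Proof.
move=> zs t0 [+ +]; rewrite ImMc ReMc /= !mul0r addr0 subr0 => /eqP.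
rewrite mulf_eq0 (gt_eqF t0) /= => /eqP z0; rewrite pmulr_rle0 // => z1.
exact: zs.
Qed.

Lemma slitL_neq0 (z : C) : slitL z -> z != 0.
Proof. by move=> zs; apply/eqP => z0; apply: zs; rewrite z0 /=. Qed.

Lemma carg_imag (z : C) : complex.Re z = 0 -> `|carg z| = pi / 2.
Proof.
move=> z0; have p2 : 0 <= pi / 2 :> R by rewrite divr_ge0 ?pi_ge0.
by rewrite /carg z0 mul0r acos0; case: ifP => _; rewrite ?normrN ger0_norm.
Qed.

Lemma cvg_small (F : set_system R) {FF : ProperFilter F} (f : R -> C^o) (z : C^o) :
  (\forall t \near F, 0 < t) -> f @ F --> z ->
  forall e : R, 0 < e -> exists2 t : R, 0 < t & cabs (f t - z) < e.
Proof.
move=> F0 /cvgCP H e e0; have [t [t0 te]] := filter_ex (filterI F0 (H e e0)).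
by exists t.
Qed.

Lemma cvg_small2 (F : set_system R) {FF : ProperFilter F} (f f' : R -> C^o) (z : C^o) :
  (\forall t \near F, 0 < t) -> f @ F --> z -> f' @ F --> z ->
  forall e : R, 0 < e -> exists2 t : R, 0 < t & cabs (f t - f' t) < e.
Proof.
move=> F0 fz f'z e e0; have [t t0] := cvg_small F0 (cvgB fz f'z) e0.
by rewrite subrr subr0; exists t.
Qed.

Lemma nbhs_pinfty_gt0 : \forall t \near (+oo : set_system R), 0 < t.
Proof. exact: nbhs_pinfty_gt. Qed.

Lemma nbhs_right0_gt0 : \forall t \near (0 : R)^'+, 0 < t.
Proof. exact: nbhs_right_gt. Qed.

Lemma cvg_ray0 (z : C) : (fun t : R => (t%:C * z : C^o)) @ 0^'+ --> (0 : C^o).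
Proof.
have K (k : R) : (fun t : R => t * k) @ 0^'+ --> (0 : R).
  rewrite -[X in _ --> X](mul0r k); apply: cvg_at_right_filter.
  exact: mulrr_continuous.
apply: cvg_ReIm.
  by under eq_fun do rewrite ReMc /= mul0r subr0; exact: K.
by under eq_fun do rewrite ImMc /= mul0r addr0; exact: K.
Qed.

End ComplexLog.

(** * The DKZ equation along rays *)

Section DKZ.
Variables (R : realType) (g : lieAlgebra R[i]) (h : {vspace g}).
Variables (U : envelopingAlgebra g) (T : tensorSquare U).
Variables (B : g -> g -> R[i]) (p : 'End(g)) (mu : subvs_of h).
Hypotheses (hB : invariant_form B) (hab : forall x y, x \in h -> y \in h -> br x y = 0).
Hypothesis ph : forall x, p x \in h.
Variable cb : forall k, eigen_coords T (vsval mu) k.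
Local Notation C := R[i].
Local Notation calA := (calA T).
Local Notation calE := (calE T).
Local Notation filA := (@filA _ _ _ T).
Local Notation filE := (@filE _ _ _ T).
Local Notation flipX := (flipX T).
Local Notation x := (vsval mu).
Local Notation ad_diag := (ad_diag T x).
Local Notation ad := (adE T x).
Local Notation hO := (hOmega T B).
Local Notation hO0 := (hOmega0 T B p).
Local Notation cX := (exp_ad cb).
Local Notation ipi := ((pi : R)%:C * 'i%C).
Implicit Types (a b : calA) (X Y : calE).

Lemma eigen_coordD k (i : 'I_(ec_dim (cb k))) a b : eigen_coord i (a + b) = eigen_coord i a + eigen_coord i b.
Proof. by have := eigen_coord_scalar i 1 a b; rewrite scale1r mul1r. Qed.

Lemma eigen_coordZ k (i : 'I_(ec_dim (cb k))) s a : eigen_coord i (s *: a) = s * eigen_coord i a.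
Proof.
have := eigen_coord_scalar i s a 0; rewrite addr0 => ->.
by rewrite [eigen_coord i 0]ec_c0 addr0.
Qed.

Lemma charC0 j : (j`!%:R : C) != 0.
Proof. by rewrite pnatr_eq0 -lt0n fact_gt0. Qed.

Lemma hbarA_filA (Y : T) (Y1 : ts_le 1 Y) : filA 1 (hbarA Y1).
Proof. by move=> [|k] //= _. Qed.

Lemma hO_filA : filA 1 hO. Proof. exact/filAZ/hbarA_filA. Qed.
Lemma hO0_filA : filA 1 hO0. Proof. exact/filAZ/hbarA_filA. Qed.

Lemma flip_hbarA (Y : T) (Y1 : ts_le 1 Y) : flip T Y = Y -> flipX (hbarA Y1) = hbarA Y1.
Proof.
move=> YE; apply: calA_ext => k; rewrite /= /fps_flip /= /fps_hbar.
by case: eqP; rewrite ?linear0.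
Qed.

Lemma flip_hO : flipX hO = hO.
Proof. by rewrite /hOmega /sfh calEZ flip_hbarA // flip_Omega_map. Qed.

Lemma flip_hO0 : flipX hO0 = hO0.
Proof. by rewrite /hOmega0 /sfh calEZ flip_hbarA // flip_Omega_map. Qed.

Lemma ad_hO0 : ad hO0 = 0.
Proof.
rewrite /hOmega0 /sfh calEZ; suff -> : ad (hbarOmega0 T B p) = 0 by rewrite scaler0.
apply: calA_ext => k.
rewrite -[LHS]/(tens T (ue_in U x) 1 * fps_hbar (Omega_map T B p) k - fps_hbar (Omega_map T B p) k * tens T (ue_in U x) 1).
rewrite /fps_hbar; case: eqP => _; last by rewrite mulr0 mul0r subrr.
by apply: Omega_map_ad0 => y; apply: hab; [exact: subvsP | exact: ph].
Qed.

Lemma ad_diag_hO0 : ad_diag hO0 = 0.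
Proof. by rewrite addEE !mulEE flip_hO0 ad_hO0 calE0 addr0. Qed.

Lemma ad_diag_hO : ad_diag hO = 0.
Proof.
rewrite /hOmega /sfh calEZ; suff -> : ad_diag (hbarOmega T B) = 0 by rewrite scaler0.
apply: calA_ext => k; rewrite ad_diagE.
rewrite -[calA_val (hbarOmega T B) k]/(fps_hbar (Omega_map T B id) k).
rewrite /fps_hbar; case: eqP => _; last by rewrite !(mulr0, mul0r, subrr) addr0.
exact: Omega_invariant.
Qed.

Lemma ad_diag_flip a : ad_diag (flipX a) = flipX (ad_diag a).
Proof. by rewrite !addEE !mulEE flipAK calED flipAK addrC. Qed.

Lemma Upsilon0_1 (H0 : C -> calA) z a :
  Upsilon0 B mu H0 z a = cX z (H0 z * cpow z hO * a).
Proof. by rewrite /Upsilon0 /ad_mu (expE_exp_ad cb) !mulEE !lmulEE mulrA. Qed.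

Lemma Upsilon_infty_1 (H : C -> calA) z : Upsilon_infty B p mu H z 1 = H z * cpow z hO0.
Proof.
rewrite /Upsilon_infty /ad_mu (expE_exp_ad cb) !mulEE !lmulEE exp_ad_fix ?mulr1 //.
exact: adE1.
Qed.

Lemma cpow_eps z a : filA 1 a -> filA 1 (1 - cpow z a).
Proof. by move=> a1; apply: expA_unip; exact: filAZ. Qed.

Lemma const_term_expA s a : filA 1 a -> const_term (expA (s *: a)) = 1.
Proof. by move=> a1; apply/const_term_unip/expA_unip; exact: filAZ. Qed.

Lemma expA_inv s a : filA 1 a -> expA (s *: a) * expA (- s *: a) = 1.
Proof. by move=> a1; rewrite (expAD charC0) // subrr scale0r expA0. Qed.

Lemma flip_expA s a : filA 1 a -> flipX a = a -> flipX (expA (s *: a)) = expA (s *: a).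
Proof.
by move=> a1 fa; rewrite flipA_exp ?calEZ ?fa //; exact: filAZ.
Qed.

(** On the positive imaginary axis log z = log (-z) + pi i; this jump produces the factors e^(pi i h
    Omega) and e^(pi i h Omega_0) in the flip relations. *)
Lemma cpow_ray (t : R) a : filA 1 a -> 0 < t ->
  cpow (t%:C * 'i%C) a = cpow (t%:C * - 'i%C) a * expA (ipi *: a).
Proof.
move=> a1 t0; rewrite /cpow clog_pi // clog_piN // (expAD charC0) //.
congr (expA (_ *: _)); rewrite -addrA; congr (_ + _).
by rewrite -mulNr -mulrDl; congr (_ * _); apply: complex_eqP => /=; [lra | rewrite !oppr0; lra].
Qed.

(* The DKZ equation for operators, applied to the element 1. *)
Lemma ray_ode (D : set C) (Y : C -> calE) (z : C) (t : R) : z != 0 -> 0 < t -> D (t%:C * z) ->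
  dkz_solution B mu D Y ->
  weak_derive (fun s => Y (s%:C * z) 1) t
    (t%:C^-1 *: (hO * Y (t%:C * z) 1) + z *: ad (Y (t%:C * z) 1)).
Proof.
move=> z0 t0 Dt /(_ _ Dt) Yd n l ln; have := Yd n _ (ev_trunc 1 ln).
move/(rderive_ray z0); set e := z * _; suff -> : e = l (t%:C^-1 *: (hO * Y (t%:C * z) 1) + z *: ad (Y (t%:C * z) 1)) by [].
rewrite /e ev_scalarE mulEE addEE scaleEE lmulEE !linearD !linearZ /=.
rewrite mulrDr !mulrA; congr (_ * _ + _).
rewrite invfM mulrCA mulrV ?mulr1 // unitfE //.
Qed.

Section Infinity.
Variables (D : set C) (H : C -> calA) (s : R) (z : C).
Hypothesis hH : canonical_at_infty B p mu D H.
Hypotheses (s1 : `|s| = 1) (zE : z = 'i%C * s%:C) (Dz : forall t : R, 0 < t -> D (t%:C * z)).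

Lemma infty_limit n (l : {scalar calA}) X : trunc_functional filA n l ->
  (fun t : R => (l (X (H (t%:C * z))) : C^o)) @ +oo --> (l (X 1) : C^o).
Proof.
move=> ln; have [_ lim _] := hH.
(* The imaginary axis has |arg z| = pi / 2, which is strictly inside the sector for delta = pi /
   4. *)
have p4 : 0 < pi / 4 :> R by rewrite divr_gt0 ?pi_gt0.
move=> A /(lim _ p4 _ _ (comp_trunc X ln)) [M HM].
suff : \forall t \near (+oo : set_system R), A (l (X (H (t%:C * z)))) by [].
near=> t; have t0 : 0 < t by near: t; exact: nbhs_pinfty_gt0.
apply: HM; first exact: Dz.
  rewrite carg_imag; first by have := pi_gt0 R => p0; apply/andP; split; lra.
  by rewrite zE !(ReMc, ImMc) /=; ring.
suff -> : cabs (t%:C * z) = t by near: t; apply: nbhs_pinfty_gt; rewrite num_real.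
apply: complexI; rewrite -normcE_cabs zE !normrM !normcE_cabs.
rewrite /cabs /= !expr0n /= add0r expr1n sqrtr1 !addr0 !sqrtr_sqr s1.
by rewrite gtr0_norm // !mulr1.
Unshelve. all: by end_near.
Qed.

Lemma infty_ode (t : R) : 0 < t -> weak_derive (fun r => H (r%:C * z) * cpow (r%:C * z) hO0) t
   (t%:C^-1 *: (hO * (H (t%:C * z) * cpow (t%:C * z) hO0)) + z *: ad (H (t%:C * z) * cpow (t%:C * z) hO0)).
Proof.
move=> t0; have [_ _ sol] := hH; have z0 : z != 0.
  rewrite zE; apply: mulf_neq0; first by rewrite eq_complex /= oner_eq0 andbF.
  by rewrite fmorph_eq0 -normr_gt0 s1.
have := ray_ode z0 t0 (Dz t0) sol; rewrite (Upsilon_infty_1 H).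
by apply: weak_derive_ext => // r _; rewrite Upsilon_infty_1.
Qed.

(** The derivation [ad_diag] kills Omega and Omega_0 and commutes with ad mu^(1), so its value on H
    satisfies the same kind of equation and tends to its value on 1, which is 0. *)
Lemma ad_diag_infty (t : R) : 0 < t -> ad_diag (H (t%:C * z)) = 0.
Proof.
pose u (r : R) := cpow (r%:C * z) hO0.
have du r : ad_diag (u r) = 0.
  by apply: ad_diag_exp; [exact/filAZ/hO0_filA | rewrite calEZ ad_diag_hO0 scaler0].
move: t; apply: (uniqueness_infty cb hO_filA (s := s) (u := u)).
- by move=> t _; apply: cpow_eps; exact: hO0_filA.
- move=> t t0; have := weak_derive_op ad_diag (infty_ode t0).
  rewrite calED !calEZ ad_diag_mul ad_diag_hO mul0r add0r ad_diag_adC.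
  have E r : ad_diag (H (r%:C * z) * cpow (r%:C * z) hO0) = ad_diag (H (r%:C * z)) * u r.
    by rewrite ad_diag_mul -/(u r) du mulr0 addr0.
  by rewrite E -zE; apply: weak_derive_ext => // r _; rewrite E.
- move=> n l ln e e0; have [t t0 te] := cvg_small (@nbhs_pinfty_gt0 R) (infty_limit (X := ad_diag) ln) e0.
  by exists t => //; move: te; rewrite ad_diag1 linear0 subr0.
Qed.

(** Modulo A_1 the right-hand side of the equation vanishes, so the constant term does not move and
    equals its limit 1. *)
Lemma const_term_infty (t : R) : 0 < t -> const_term (H (t%:C * z)) = 1.
Proof.
move=> t0; apply/eqP; rewrite -subr_eq0; apply/eqP.
move: t t0; apply: (@oscillation_eq0 _ (fun t => const_term (H (t%:C * z)) - 1) 0) => [t t0|e e0].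
  have := infty_ode t0 (@const_term_trunc _ _ _ T).
  rewrite linearD !linearZ /= const_term_ad const_termM (const_term_filA hO_filA) mul0r !mulr0 addr0 mul0r.
  move=> /rderiveD /(_ (rderive_cst (-1) t)); rewrite addr0.
  apply: rderive_ext => r; rewrite /= const_termM; congr (_ - _).
  by rewrite /cpow const_term_expA ?mulr1 //; exact: hO0_filA.
have [t t0 te] := cvg_small (@nbhs_pinfty_gt0 R) (infty_limit (X := 1) (@const_term_trunc _ _ _ T)) e0.
by exists t => //; move: te; rewrite !oneEE /= const_term1.
Qed.

End Infinity.

Section Zero.
Variable H0 : C -> calA.
Hypothesis hH0 : canonical_at_0 B mu H0.
Local Notation G z := (H0 z * cpow z hO).

Lemma zero_limit (z : C) n (l : {scalar calA}) X : trunc_functional filA n l ->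
  (fun t : R => (l (X (H0 (t%:C * z))) : C^o)) @ 0^'+ --> (l (X 1) : C^o).
Proof.
move=> ln; have [hol H00 _] := hH0; rewrite -H00.
exact: (cvg_comp _ _ (cvg_ray0 z) (cderivable_cvg (hol _ _ (comp_trunc X ln) 0 I))).
Qed.

Lemma zero_ode (z : C) (t : R) : slitL z -> 0 < t ->
  weak_derive (fun r => cX (r%:C * z) (G (r%:C * z))) t
   (t%:C^-1 *: (hO * cX (t%:C * z) (G (t%:C * z))) + z *: ad (cX (t%:C * z) (G (t%:C * z)))).
Proof.
move=> zs t0; have [_ _ sol] := hH0.
have := ray_ode (slitL_neq0 zs) t0 (slitL_ray zs t0) sol; rewrite !Upsilon0_1 mulr1.
by apply: weak_derive_ext => // r _; rewrite Upsilon0_1 mulr1.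
Qed.

(** The argument is run along the ray from 0 through z and read at t = 1. *)
Lemma const_term_zero z : slitL z -> const_term (H0 z) = 1.
Proof.
move=> zs; apply/eqP; rewrite -subr_eq0; apply/eqP.
have := @oscillation_eq0 _ (fun t => const_term (H0 (t%:C * z)) - 1) 0.
move=> /(_ _ _ 1 ltr01); rewrite mul1r; apply=> [t t0|e e0].
  have := zero_ode zs t0 (@const_term_trunc _ _ _ T).
  rewrite linearD !linearZ /= const_term_ad const_termM (const_term_filA hO_filA) mul0r !mulr0 addr0 mul0r.
  move=> /rderiveD /(_ (rderive_cst (-1) t)); rewrite addr0.
  apply: rderive_ext => r; congr (_ - _).
  rewrite -[LHS]/(const_term (cX (r%:C * z) (G (r%:C * z)))) const_term_exp_ad const_termM.
  by rewrite /cpow const_term_expA ?mulr1 //; exact: hO_filA.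
have [t t0 te] := cvg_small (@nbhs_right0_gt0 R) (zero_limit z (X := 1) (@const_term_trunc _ _ _ T)) e0.
by exists t => //; move: te; rewrite !oneEE /= const_term1.
Qed.

(* Conjugating away the factor exp (z ad mu^(1)), one eigenfunctional at a time. *)
Lemma zero_gauge_ode (z : C) (t : R) : slitL z -> 0 < t ->
  weak_derive (fun r => G (r%:C * z)) t (t%:C^-1 *: (cX (- (t%:C * z)) hO * G (t%:C * z))).
Proof.
move=> zs t0.
have K k (i : 'I_(ec_dim (cb k))) : rderive (fun r => eigen_coord i (G (r%:C * z))) t
    (eigen_coord i (t%:C^-1 *: (cX (- (t%:C * z)) hO * G (t%:C * z)))).
  set a := (ec_a i)%:C.
  have E r : eigen_coord i (G (r%:C * z)) = cexp (r%:C * - (z * a)) * eigen_coord i (cX (r%:C * z) (G (r%:C * z))).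
    by rewrite eigen_coord_exp_ad mulrA -cexpD mulrN mulrA addNr cexp0 mul1r.
  have := rderiveM (rderive_cexp (- (z * a)) t) (zero_ode zs t0 (@eigen_coord_trunc _ _ _ _ _ _ k i)).
  move=> h1; have h2 := rderive_ext (fun r => esym (E r)) h1; move: h2.
  set e := (X in rderive _ _ X -> _); suff -> : e = eigen_coord i (t%:C^-1 *: (cX (- (t%:C * z)) hO * G (t%:C * z))) by [].
  have -> : cX (- (t%:C * z)) hO * G (t%:C * z) = cX (- (t%:C * z)) (hO * cX (t%:C * z) (G (t%:C * z))).
    rewrite exp_adM; congr (_ * _).
    by have := exp_adK cb (- (t%:C * z)) (G (t%:C * z)); rewrite opprK => ->.
  rewrite eigen_coordZ eigen_coord_exp_ad -/a.
  rewrite /e; move: (cX (t%:C * z) (G (t%:C * z))) => v.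
  rewrite -[eigen_coordl i v]/(eigen_coord i v) -[eigen_coordl i (_ + _)]/(eigen_coord i (_ + _)) eigen_coordD !eigen_coordZ eigen_coord_ad -/a.
  have -> : - (t%:C * z) * a = t%:C * - (z * a) by rewrite mulNr mulrN mulrA.
  move: (cexp _) (eigen_coord i _) (eigen_coord i _) (t%:C^-1) => q1 q2 q3 q4.
  by rewrite mulrDr !mulNr [q1 * (z * _)]mulrCA -!mulrA; ring.
move=> n l ln; rewrite (trunc_decomp cb _ ln).
have := rderive_sum (fun k : 'I_n => rderive_sum (fun i : 'I_(ec_dim (cb k)) => rderiveZ (l (eigen_vec i)) (K k i))).
set e := (X in rderive _ _ X -> _); set e' := (X in _ -> rderive _ _ X).
have -> : e = e' by apply: eq_bigr => k _; apply: eq_bigr => i _; rewrite mulrC.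
apply: rderive_ext => r; rewrite [RHS](trunc_decomp cb _ ln).
by apply: eq_bigr => k _; apply: eq_bigr => i _; rewrite mulrC.
Qed.

(** The coefficient of the conjugated equation is exp (-z ad mu^(1)) applied to h Omega; since Omega
    is symmetric and of weight zero, the flip changes z into -z in it. So both sides, multiplied by
    z^(h Omega), satisfy one equation, the constant right factor e^(pi i h Omega) matching the
    branches of log, and both tend to 1 at 0. *)
Lemma zero_symmetry (t : R) : 0 < t -> flipX (H0 (t%:C * - 'i%C)) = H0 (t%:C * 'i%C).
Proof.
move=> t0; apply/eqP; rewrite -subr_eq0; apply/eqP; move: t t0.
have i0 : slitL ('i%C : C) by move=> [/= /eqP]; rewrite oner_eq0.
have iN0 : slitL (- 'i%C : C) by move=> [/= /eqP]; rewrite oppr_eq0 oner_eq0.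
apply: (uniqueness_zero cb (u := fun t => cpow (t%:C * 'i%C) hO) (m := fun t => cX (- (t%:C * 'i%C)) hO)).
- by move=> t _; apply: cpow_eps; exact: hO_filA.
- by move=> t; apply: calE_fil; exact: hO_filA.
- move=> t t0; have E r : 0 < r -> flipX (H0 (r%:C * - 'i%C)) * cpow (r%:C * 'i%C) hO =
      flipX (G (r%:C * - 'i%C)) * expA (ipi *: hO).
    move=> r0; rewrite cpow_ray //; last exact: hO_filA.
    by rewrite flipAM mulrA /cpow (flip_expA _ hO_filA flip_hO).
  have d1 := weak_derive_op (rmulX (expA (ipi *: hO))) (weak_derive_op flipX (zero_gauge_ode iN0 t0)).
  have := weak_deriveB d1 (zero_gauge_ode i0 t0).
  have M : flipX (cX (- (t%:C * - 'i%C)) hO) = cX (- (t%:C * 'i%C)) hO.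
    by rewrite mulrN opprK -{1}flip_hO exp_ad_flip // ad_diag_hO.
  rewrite rmulXE calEZ flipAM M -scalerAl -scalerBr -mulrA -E // -mulrBr -mulrBl.
  by apply: weak_derive_ext => // r r0; rewrite rmulXE -E // mulrBl.
- move=> n l ln e e0.
  have c1 := zero_limit (- 'i%C) (X := flipX) ln; rewrite flipA1 in c1.
  have c2 := zero_limit 'i%C (X := 1) ln.
  have [t t0 te] := cvg_small2 (@nbhs_right0_gt0 R) c1 c2 e0; exists t => //.
  by rewrite linearB.
Qed.

End Zero.

Section TwoSolutions.
Variables H0 Hp Hm : C -> calA.
Hypothesis hH0 : canonical_at_0 B mu H0.
Hypothesis hHp : canonical_at_infty B p mu (@upper R) Hp.
Hypothesis hHm : canonical_at_infty B p mu (@lower R) Hm.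

Let iE : 'i%C = 'i%C * 1%:C :> C. Proof. by rewrite rmorph1 mulr1. Qed.
Let iNE : - 'i%C = 'i%C * (- 1)%:C :> C. Proof. by rewrite rmorphN rmorph1 mulrN1. Qed.
Let n1 : `|1| = 1 :> R. Proof. exact: normr1. Qed.
Let nN1 : `|- 1| = 1 :> R. Proof. by rewrite normrN1. Qed.
Let upi (t : R) : 0 < t -> upper (t%:C * 'i%C).
Proof. by move=> t0; rewrite /upper /= mulr1 mul0r addr0. Qed.
Let lowi (t : R) : 0 < t -> lower (t%:C * - 'i%C).
Proof. by move=> t0; rewrite /lower /= mulrN1 mul0r addr0 oppr_lt0. Qed.

(** The flip turns ad mu^(1) into ad mu^(2), which is - ad mu^(1) on the weight-zero solution, and
    evaluation at -z restores the sign. The two branches of z^(h Omega_0) differ by a constant right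
    factor killed by ad mu^(1), so the equation is preserved. *)
Lemma infty_symmetry (t : R) : 0 < t -> flipX (Hm (t%:C * - 'i%C)) = Hp (t%:C * 'i%C).
Proof.
move=> t0; apply/eqP; rewrite -subr_eq0; apply/eqP; move: t t0.
pose c := expA (ipi *: hO0).
have adc : ad c = 0.
  by apply: adE_exp; [exact/filAZ/hO0_filA | rewrite calEZ ad_hO0 scaler0].
apply: (uniqueness_infty cb hO_filA (s := 1) (u := fun t => cpow (t%:C * 'i%C) hO0)).
- by move=> t _; apply: cpow_eps; exact: hO0_filA.
- move=> t t0; pose Gm r := Hm (r%:C * - 'i%C) * cpow (r%:C * - 'i%C) hO0.
  have E r : 0 < r -> flipX (Hm (r%:C * - 'i%C)) * cpow (r%:C * 'i%C) hO0 = flipX (Gm r) * c.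
    move=> r0; rewrite cpow_ray //; last exact: hO0_filA.
    by rewrite /Gm flipAM mulrA /cpow (flip_expA _ hO0_filA flip_hO0).
  have DG : flipX (ad (Gm t)) = - ad (flipX (Gm t)).
    have : ad_diag (flipX (Gm t)) = 0.
      rewrite ad_diag_flip ad_diag_mul (ad_diag_infty hHm nN1 iNE lowi t0) mul0r add0r.
      rewrite ad_diag_exp ?mulr0 ?calE0 //; first exact/filAZ/hO0_filA.
      by rewrite calEZ ad_diag_hO0 scaler0.
    rewrite addEE !mulEE flipAK => /eqP; rewrite addrC addr_eq0 => /eqP ->.
    by [].
  have d1 := weak_derive_op (rmulX c) (weak_derive_op flipX (infty_ode hHm nN1 iNE lowi t0)).
  have := weak_deriveB d1 (infty_ode hHp n1 iE upi t0).
  have [w wE] : exists w, w = hO by exists hO.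
  rewrite -/(Gm t) rmulXE calED !calEZ flipAM flip_hO DG scaleNr scalerN opprK -wE.
  rewrite mulrDl -!scalerAl -mulrA.
  have -> : ad (flipX (Gm t)) * c = ad (flipX (Gm t) * c) by rewrite adE_mul adc mulr0 addr0.
  rewrite -(E t) // opprD addrACA -!scalerBr -mulrBr -calEB -mulrBl rmorph1 mulr1.
  by apply: weak_derive_ext => // r r0; rewrite rmulXE -/(Gm r) -E // mulrBl.
- move=> n l ln e e0.
  have c1 := infty_limit hHm nN1 iNE lowi (X := flipX) ln; rewrite flipA1 in c1.
  have c2 := infty_limit hHp n1 iE upi (X := 1) ln.
  have [t t0 te] := cvg_small2 (@nbhs_pinfty_gt0 R) c1 c2 e0; exists t => //.
  by rewrite linearB.
Qed.

End TwoSolutions.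
End DKZ.

(** * Twists and Stokes matrices *)

Section CircleArc.
Variable R : realType.
Local Notation C := R[i].

Lemma cvg_at_pi (f : R -> R) : continuous f -> (fun s => f (pi - s)) @ 0^'+ --> f pi.
Proof.
move=> fc; rewrite -[X in _ --> f X]subr0.
apply: (cvg_at_right_filter (f := fun s => f (pi - s))).
apply: (@continuous_comp _ _ _ (fun s => pi - s) f); last exact: fc.
by apply: cvgB; [exact: cvg_cst | exact: cvg_id].
Qed.

Lemma cvg_arc : (fun s : R => (1%:C * (cos (pi - s) +i* sin (pi - s)) : C^o)) @ 0^'+ --> (- 1 : C^o).
Proof.
have c1 := cvg_at_pi (@continuous_cos R); rewrite cospi in c1.
have c2 := cvg_at_pi (@continuous_sin R); rewrite sinpi in c2.
apply: cvg_ReIm; under eq_fun do rewrite mul1r /=; first exact: c1.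
by rewrite /= oppr0; exact: c2.
Qed.

Lemma cvg_arcN : (fun s : R => (1%:C * (cos (pi - s) -i* sin (pi - s)) : C^o)) @ 0^'+ --> (- 1 : C^o).
Proof.
have c1 := cvg_at_pi (@continuous_cos R); rewrite cospi in c1.
have c2 := cvg_at_pi (@continuous_sin R); rewrite sinpi in c2.
apply: cvg_ReIm; under eq_fun do rewrite mul1r /=; first exact: c1.
by rewrite /=; apply: cvgN; exact: c2.
Qed.

Lemma cvg_cexp (F : set_system R) {FF : Filter F} (f : R -> C^o) (z : C^o) :
  f @ F --> z -> (fun s => cexp (f s) : C^o) @ F --> (cexp z : C^o).
Proof.
move=> fz.
have re : (fun s => complex.Re (f s)) @ F --> complex.Re z by exact: cvg_Re.
have im : (fun s => complex.Im (f s)) @ F --> complex.Im z by exact: cvg_Im.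
have e : (fun s => expR (complex.Re (f s))) @ F --> expR (complex.Re z).
  exact: (cvg_comp _ _ re (@continuous_expR R _)).
have c : (fun s => cos (complex.Im (f s))) @ F --> cos (complex.Im z).
  exact: (cvg_comp _ _ im (@continuous_cos R _)).
have s : (fun s => sin (complex.Im (f s))) @ F --> sin (complex.Im z).
  exact: (cvg_comp _ _ im (@continuous_sin R _)).
by apply: cvg_ReIm; apply: cvgM.
Qed.

Lemma cvg_powC (F : set_system R) {FF : Filter F} (f : R -> C^o) (z : C^o) n :
  f @ F --> z -> (fun s => f s ^+ n : C^o) @ F --> (z ^+ n : C^o).
Proof.
move=> fz; elim: n => [|n IH]; first exact: cvg_cst.
have -> : (fun s => f s ^+ n.+1 : C^o) = (fun s => f s * (f s ^+ n : C^o)).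
  by apply/funext => s; exact: exprS.
rewrite [z ^+ _]exprS; exact: cvgM fz IH.
Qed.

End CircleArc.

(** * Relations between twists and Stokes matrices *)

Section Twists.
Variables (R : realType) (g : lieAlgebra R[i]) (h : {vspace g}).
Variables (U : envelopingAlgebra g) (T : tensorSquare U).
Variables (B : g -> g -> R[i]) (p : 'End(g)) (mu : subvs_of h).
Hypotheses (hB : invariant_form B) (hab : forall x y, x \in h -> y \in h -> br x y = 0).
Hypothesis ph : forall x, p x \in h.
Variable cb : forall k, eigen_coords T (vsval mu) k.
Local Notation C := R[i].
Local Notation calA := (calA T).
Local Notation calE := (calE T).
Local Notation filA := (@filA _ _ _ T).
Local Notation filE := (@filE _ _ _ T).
Local Notation flipX := (flipX T).
Local Notation x := (vsval mu).
Local Notation ad_diag := (ad_diag T x).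
Local Notation ad := (adE T x).
Local Notation hO := (hOmega T B).
Local Notation hO0 := (hOmega0 T B p).
Local Notation cX := (exp_ad cb).
Local Notation ipi := ((pi : R)%:C * 'i%C).
Implicit Types (a b : calA) (X Y : calE).

Variables (H0 Hp Hm : C -> calA) (Yp Ym Ym' : C -> calE) (Jp Jm Sp Sm : calA).
Hypothesis hH0 : canonical_at_0 B mu H0.
Hypothesis hHp : canonical_at_infty B p mu (@upper R) Hp.
Hypothesis hHm : canonical_at_infty B p mu (@lower R) Hm.
Hypothesis hYp : continued_solution B p mu (@upper R) (@slitL R) Hp Yp.
Hypothesis hYm : continued_solution B p mu (@lower R) (@slitL R) Hm Ym.
Hypothesis hYm' : continued_solution B p mu (@lower R) (@slitR R) Hm Ym'.
Hypotheses (hJp : twist B mu H0 Yp Jp) (hJm : twist B mu H0 Ym Jm).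
Hypotheses (hSp : stokes_plus Yp Ym Sp) (hSm : stokes_minus B p Yp Ym' Sm).

Let c := expA (ipi *: hO0).
Let e := expA (ipi *: hO).
Let e' := expA (- ipi *: hO).

Lemma exp_ad_inj z : injective (cX z).
Proof.
move=> a b /(congr1 (cX (- z))).
by have := exp_adK cb (- z); rewrite opprK => K; rewrite !K.
Qed.

(** In [twist] the inverse of a non-unit would be the element itself, so invertibility has to be
    proved. Upsilon_0 is the product of an invertible exponential and of two factors with constant
    term 1. *)
Lemma Upsilon0_unit z : slitL z -> Upsilon0 B mu H0 z \is a GRing.unit.
Proof.
move=> zs; have [b [b1 b2 _]] := const_term_unit (const_term_zero cb hH0 zs).
have := const_term_expA (clog z) (hO_filA T B).
move=> /const_term_unit [d [d1 d2 _]].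
apply/unitrP; exists (lmulE d * lmulE b * cX (- z)); split; apply: calE_ext => a.
  rewrite [LHS]mulEE oneEE (Upsilon0_1 B cb) !mulEE !lmulEE.
  have := exp_adK cb (- z); rewrite opprK => ->.
  by rewrite !mulrA -[d * b * H0 z]mulrA b2 mulr1 -[d * cpow _ _]/(d * expA (clog z *: hO)) d2 mul1r.
rewrite [LHS]mulEE oneEE (Upsilon0_1 B cb) !mulEE !lmulEE !mulrA.
rewrite -[H0 z * cpow z hO * d]mulrA -[cpow _ _ * d]/(expA (clog z *: hO) * d) d1 mulr1 b1 mul1r.
exact: exp_adK.
Qed.

Lemma twistE (Y : C -> calE) J z a : twist B mu H0 Y J -> slitL z ->
  Y z a = cX z (H0 z * cpow z hO * (J * a)).
Proof.
move=> YJ zs; have := YJ z zs => /(congr1 (fun X => Upsilon0 B mu H0 z * X)).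
rewrite mulVKr ?Upsilon0_unit // => ->.
by rewrite mulEE lmulEE (Upsilon0_1 B cb).
Qed.

(** As J does not depend on z, one point in each half-plane is enough; these two are exchanged by z
    |-> -z and are the points t = 1 of the rays used above. *)
Let zu : C := 1%:C * 'i%C.
Let zl : C := 1%:C * - 'i%C.

Let zuE : zu = - zl. Proof. by rewrite /zl mulrN opprK. Qed.
Let zu_upper : upper zu. Proof. by rewrite /zu /upper /= mul0r mulr1 addr0. Qed.
Let zl_lower : lower zl. Proof. by rewrite /zl /lower /= mulrN mul0r mulr1 addr0 oppr_lt0. Qed.
Let zu_slit : slitL zu. Proof. by move=> [+ _]; move: zu_upper; rewrite /upper /= => + e0; rewrite e0 ltxx. Qed.
Let zl_slit : slitL zl. Proof. by move=> [+ _]; move: zl_lower; rewrite /lower /= => + e0; rewrite e0 ltxx. Qed.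

Lemma const_term_G z a : slitL z -> const_term (H0 z * cpow z hO * a) = const_term a.
Proof.
move=> zs; rewrite !const_termM (const_term_zero cb hH0 zs) mul1r /cpow const_term_expA ?mul1r //.
exact: hO_filA.
Qed.

Lemma G_cancel z a b : slitL z -> H0 z * cpow z hO * a = H0 z * cpow z hO * b -> a = b.
Proof. by move=> zs; apply: const_term_cancel; have := const_term_G 1 zs; rewrite mulr1 const_term1. Qed.

Lemma upper_eq : Hp zu * cpow zu hO0 = cX zu (H0 zu * cpow zu hO * Jp).
Proof.
have [_ YE] := hYp; have := twistE 1 hJp zu_slit.
by rewrite YE // (Upsilon_infty_1 _ _ cb) mulr1.
Qed.

Lemma lower_eq : Hm zl * cpow zl hO0 = cX zl (H0 zl * cpow zl hO * Jm).
Proof.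
have [_ YE] := hYm; have := twistE 1 hJm zl_slit.
by rewrite YE // (Upsilon_infty_1 _ _ cb) mulr1.
Qed.

Lemma const_term_Jp : const_term Jp = 1.
Proof.
have := congr1 (@const_term _ _ _ T) upper_eq; rewrite const_term_exp_ad const_term_G // => <-.
rewrite const_termM /cpow const_term_expA ?mulr1; last exact: hO0_filA.
have up (t : R) : 0 < t -> upper (t%:C * 'i%C).
  by move=> t0; rewrite /upper /= mulr1 mul0r addr0.
by apply: (const_term_infty cb hHp (s := 1)); rewrite ?normr1 ?rmorph1 ?mulr1.
Qed.

Lemma twist_flip : flipX Jm * c = e * Jp.
Proof.
(* Both products combine a value at i with the branch of log at -i: their flips are the
   corresponding products at -i, and returning to the branch at i costs a right factor c for [K] and
   e for [V]. *)
pose K := Hp zu * cpow zl hO0; pose V := H0 zu * cpow zl hO.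
have fe a : filA 1 a -> flipX a = a -> flipX (cpow zl a) = cpow zl a by move=> *; exact: flip_expA.
have FK : flipX K = cX zl (H0 zl * cpow zl hO * Jm).
  rewrite /K flipAM fe ?flip_hO0 //; last exact: hO0_filA.
  by rewrite -(infty_symmetry hB hab ph cb hHp hHm ltr01) flipAK lower_eq.
(* Weight zero is what makes conjugation by the flip invert exp (z ad mu^(1)) on [K]. *)
have DK : ad_diag K = 0.
  rewrite ad_diag_mul.
  have -> : ad_diag (cpow zl hO0) = 0.
    by apply: ad_diag_exp; [exact/filAZ/hO0_filA | rewrite calEZ ad_diag_hO0 // scaler0].
  rewrite mulr0 addr0 -(infty_symmetry hB hab ph cb hHp hHm ltr01) ad_diag_flip.
  rewrite (ad_diag_infty hB hab ph cb hHm (s := - 1)) ?calE0 ?mul0r //.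
  - by rewrite normrN1.
  - by rewrite rmorphN rmorph1 mulrN1.
  - by move=> t t0; rewrite /lower /= mulrN1 mul0r addr0 oppr_lt0.
have E1 : cX zl K = V * flipX Jm.
  have := exp_adK cb zu (H0 zl * cpow zl hO * Jm); rewrite zuE opprK -FK => /(congr1 flipX).
  rewrite exp_ad_flip // opprK => ->; rewrite !flipAM fe ?flip_hO //; last exact: hO_filA.
  by rewrite (zero_symmetry hB cb hH0 ltr01).
have E2 : cX zl K * c = V * (e * Jp).
  have := upper_eq; rewrite {2}/zu cpow_ray //; last exact: hO0_filA.
  rewrite {4}/zu cpow_ray //; last exact: hO_filA.
  rewrite -/zl -/c -/e mulrA -/K => /(congr1 (cX zl)).
  have := exp_adK cb zl; rewrite -zuE => -> ; rewrite exp_adM.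
  have -> : cX zl c = c.
    by apply/exp_ad_fix/adE_exp; [exact/filAZ/hO0_filA | rewrite calEZ ad_hO0 // scaler0].
  by rewrite /V !mulrA.
apply: (@const_term_cancel _ _ _ _ V); last by rewrite mulrA -E1.
rewrite const_termM /V (const_term_zero cb hH0 zu_slit) /cpow const_term_expA ?mulr1 //; exact: hO_filA.
Qed.

(** Both solutions are Upsilon_0 times their twist on the slit plane, which contains the half-plane
    where S_+ is defined. *)
Lemma stokes_plusE : Jp = Jm * Sp.
Proof.
have := congr1 (fun X : calE => X 1) (hSp zl_lower); rewrite mulEE lmulEE mulr1.
rewrite (twistE _ hJp) // (twistE _ hJm) // mulr1 => /exp_ad_inj.
exact: G_cancel.
Qed.

Let arc (s : R) : C := 1%:C * (cos (pi - s) +i* sin (pi - s)).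
Let arcN (s : R) : C := 1%:C * (cos (pi - s) -i* sin (pi - s)).

Let arc_upper s : 0 < s < pi -> upper (arc s).
Proof.
move=> /andP[s0 s1]; rewrite /upper /= mul0r addr0 mul1r sin_gt0_pi //.
by rewrite subr_gt0 s1 gtrBl.
Qed.

Let arcN_lower s : 0 < s < pi -> lower (arcN s).
Proof.
move=> /andP[s0 s1]; rewrite /lower /= mul0r addr0 mul1r oppr_lt0 sin_gt0_pi //.
by rewrite subr_gt0 s1 gtrBl.
Qed.

(* Ym' is only known to be holomorphic off the positive half-line; it is
   compared with Upsilon0 on the two sides of the cut by letting z tend to -1
   along the unit circle. *)
Lemma zero_factor_limit (f : R -> C) (r : C) a k (i : 'I_(ec_dim (cb k))) :
  (f : R -> C^o) @ 0^'+ --> (- 1 : C^o) ->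
  (fun s : R => (eigen_coord i (H0 (f s) * expA ((s%:C * r) *: hO) * a) : C^o)) @ 0^'+ --> (eigen_coord i (H0 (- 1) * a) : C^o).
Proof.
move=> f1; have hO1 := hO_filA T B.
(* In a coordinate of level k the terms of the exponential with j > k vanish; what remains is
   polynomial in s, with coefficients given by right multiples of H0. *)
have E s : eigen_coord i (H0 (f s) * expA ((s%:C * r) *: hO) * a) =
    \sum_(j < k.+1) ((j`!%:R)^-1 * (s%:C * r) ^+ j) * eigen_coord i (H0 (f s) * (hO ^+ j * a)).
  have s1 : filA 1 ((s%:C * r) *: hO) by exact: filAZ.
  have := expA_trunc (n := k.+1) s1; set S := \sum_(_ < _) _ => eS.
  transitivity (eigen_coordl i (H0 (f s) * S * a)).
    apply/eqP; rewrite -[eigen_coord i _]/(eigen_coordl i _) -subr_eq0 -linearB -mulrBl -mulrBr; apply/eqP.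
    by apply: (@eigen_coord_trunc _ _ _ _ _ cb k i); exact/filAMr/filAM.
  rewrite /S mulr_sumr mulr_suml linear_sum; apply: eq_bigr => j _.
  rewrite exprZn scalerA -scalerAr -scalerAl linearZ /=; congr (_ * _).
  by rewrite mulrA.
under eq_fun do rewrite E.
have -> : eigen_coord i (H0 (- 1) * a) =
    \sum_(j < k.+1) ((j`!%:R)^-1 * (0 : C) ^+ j) * eigen_coord i (H0 (- 1) * (hO ^+ j * a)).
  rewrite big_ord_recl big1 ?addr0 => [|j _]; last by rewrite exprS mul0r mulr0 mul0r.
  by rewrite !expr0 fact0 invr1 !mul1r.
apply: cvg_sum_C => j; apply: cvgM.
  by apply: cvgM; [exact: cvg_cst | apply: cvg_powC; exact: cvg_ray0].
have [hol _ _] := hH0.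
have t := comp_trunc (rmulX (hO ^+ j * a)) (@eigen_coord_trunc _ _ _ _ _ cb k i).
exact: (cvg_comp _ _ f1 (cderivable_cvg (hol _ _ t (- 1) I))).
Qed.

(** The right-hand side depends neither on the arc nor on its branch of log, so descriptions of the
    continuation from the two sides of the cut have the same left-hand side. The factor [cexp] is
    the limit at z = -1 of exp (-z ad mu^(1)) in the given coordinate. *)
Lemma continued_factor_limit (f : R -> C) (r : C) a b k (i : 'I_(ec_dim (cb k))) :
  (f : R -> C^o) @ 0^'+ --> (- 1 : C^o) ->
  (forall s, 0 < s < pi -> Ym' (f s) b = cX (f s) (H0 (f s) * expA ((s%:C * r) *: hO) * a)) ->
  eigen_coord i (H0 (- 1) * a) = cexp ((ec_a i)%:C) * eigen_coord i (Ym' (- 1) b).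
Proof.
move=> f1 E; have [hol _] := hYm'.
have m1 : slitR (- 1 : C) by move=> [_ /=]; rewrite lerNr oppr0 ler10.
have t := ev_trunc b (@eigen_coord_trunc _ _ _ _ _ cb k i).
have l1 := cvg_comp _ _ f1 (cderivable_cvg (hol _ _ t _ m1)).
have l2 : (fun s => cexp (- f s * (ec_a i)%:C) : C^o) @ 0^'+ --> (cexp (- - 1 * (ec_a i)%:C) : C^o).
  apply: cvg_cexp.
  exact: (@cvgM C _ _ _ (fun s => - f s) (fun=> (ec_a i)%:C) (- - 1) (ec_a i)%:C (cvgN f1) (cvg_cst _)).
have l3 : (fun s => cexp (- f s * (ec_a i)%:C) * eigen_coord i (Ym' (f s) b) : C^o) @ 0^'+ -->
    (cexp (- - 1 * (ec_a i)%:C) * eigen_coord i (Ym' (- 1) b) : C^o).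
  exact: (@cvgM C _ _ _ _ (fun s => eigen_coord i (Ym' (f s) b)) _ _ l2 l1).
rewrite opprK mul1r in l3.
have l4 : (fun s : R => (eigen_coord i (H0 (f s) * expA ((s%:C * r) *: hO) * a) : C^o)) @ 0^'+ -->
    (cexp ((ec_a i)%:C) * eigen_coord i (Ym' (- 1) b) : C^o); last first.
  exact: (cvg_unique (@norm_hausdorff C C^o) (zero_factor_limit r f1) l4).
apply: cvg_trans l3; apply: near_eq_cvg; near=> s.
have sb : 0 < s < pi.
  by apply/andP; split; near: s; [exact: nbhs_right_gt | apply: nbhs_right_lt; exact: pi_gt0].
rewrite E // eigen_coord_exp_ad mulrA -cexpD.
by rewrite mulNr addNr cexp0 mul1r.
Unshelve. all: by end_near.
Qed.

(** Since hbar = 2 pi i h, this exponential is the square of e^(pi i h Omega_0). *)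
Lemma expA_hbarOmega0 : expA (hbarOmega0 T B p) = c * c.
Proof.
rewrite /c (expAD (@charC0 R)); last exact: hO0_filA.
congr expA; rewrite /hOmega0 /sfh scalerA -[LHS]scale1r; congr (_ *: _).
have ip0 : ipi != 0.
  apply: mulf_neq0; first by rewrite fmorph_eq0 gt_eqF // pi_gt0.
  by rewrite eq_complex /= oner_eq0 andbF.
rewrite -mulrA; have -> : ipi + ipi = 2 * ipi by rewrite mulr_natl mulr2n.
by rewrite divff // mulf_neq0 // pnatr_eq0.
Qed.

(** The point -1 lies on the cut, so the value is obtained by continuity of the entire function
    H0. *)
Lemma const_term_H0N1 : const_term (H0 (- 1)) = 1.
Proof.
have [hol _ _] := hH0.
have l1 := cvg_comp _ _ (@cvg_arc R) (cderivable_cvg (hol _ _ (@const_term_trunc _ _ _ T) (- 1) I)).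
have l2 : (fun s : R => (1 : C^o)) @ 0^'+ --> (1 : C^o) by exact: cvg_cst.
have l3 : (fun s : R => (const_term (H0 (arc s)) : C^o)) @ 0^'+ --> (1 : C^o); last first.
  exact: (cvg_unique (@norm_hausdorff C C^o) l1 l3).
apply: cvg_trans l2; apply: near_eq_cvg; near=> s.
have sb : 0 < s < pi.
  by apply/andP; split; near: s; [exact: nbhs_right_gt | apply: nbhs_right_lt; exact: pi_gt0].
rewrite /= (const_term_zero cb hH0) // => -[+ _].
by have := arc_upper sb; rewrite /upper /= => + e0; rewrite e0 ltxx.
Unshelve. all: by end_near.
Qed.

(** On the upper arc log z = i (pi - s), so z^(h Omega) = e^(-i s h Omega) e; on the lower arc log z
    = -i (pi - s) gives e^(i s h Omega) e'. As s tends to 0 both descriptions meet at -1, and H0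
    (-1) cancels. *)
Lemma stokes_minusE : e * (Jp * Sm) = e' * (Jm * (c * c)).
Proof.
have hO1 := hO_filA T B.
apply: (const_term_cancel const_term_H0N1); apply: (@eigen_coord_inj _ _ _ _ _ cb) => k i.
rewrite (continued_factor_limit (r := - 'i%C) (b := c * c) i (@cvg_arc R)); last first.
  move=> s sb; have up := arc_upper sb.
  have := congr1 (fun X : calE => X 1) (hSm up); rewrite !mulEE !lmulEE !mulr1 expA_hbarOmega0 => ->.
  rewrite (twistE _ hJp); last by move=> [+ _]; move: up; rewrite /upper /= => + e0; rewrite e0 ltxx.
  congr (cX _ _); rewrite -!mulrA; congr (_ * _); rewrite [RHS]mulrA; congr (_ * _).
  rewrite /e (expAD (@charC0 R)) // /cpow clog_arc //; last first.
    by have /andP[s0 s1] := sb; rewrite subr_ge0 ltW //= gerBl ltW.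
  congr (expA (_ *: _)); rewrite ln1 add0r rmorphB mulrBl mulrN addrC //.
rewrite (continued_factor_limit (r := 'i%C) (b := c * c) i (@cvg_arcN R)) // => s sb.
have lo := arcN_lower sb.
have zs : slitL (arcN s) by move=> [+ _]; move: lo; rewrite /lower /= => + e0; rewrite e0 ltxx.
have [_ Y1] := hYm'; have [_ Y2] := hYm; rewrite Y1 // -Y2 //.
rewrite (twistE _ hJm) //.
congr (cX _ _); rewrite -!mulrA; congr (_ * _); rewrite [RHS]mulrA; congr (_ * _).
rewrite /e' (expAD (@charC0 R)) // /cpow clog_arcN //; last first.
  by have /andP[s0 s1] := sb; rewrite subr_gt0 s1 gtrBl.
congr (expA (_ *: _)); rewrite ln1 add0r rmorphB mulrBl opprB addrC //.
Qed.

Lemma eNK : e' * e = 1.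
Proof.
rewrite /e' /e; have := expA_inv (- ipi) (hO_filA T B); by rewrite opprK.
Qed.

Lemma flip_Jp : flipX Jp = e' * (Jm * c).
Proof.
have := congr1 flipX twist_flip; rewrite !flipAM flipAK.
have f0 : flipX hO0 = hO0 by exact: flip_hO0.
have f1 : flipX hO = hO by exact: flip_hO.
rewrite (flip_expA _ (hO0_filA _ _ _) f0) (flip_expA _ (hO_filA _ _) f1).
by rewrite -/c -/e => ->; rewrite mulrA eNK mul1r.
Qed.

(** The flipped twist and S are invertible inside A because their constant terms are 1, so the
    relation rearranges to (J^21)^-1 e J = c S^-1. Here e is e^(hbar Omega / 2), as hbar / 2 = pi i
    h. *)
Lemma Rmatrix_eq J S : const_term (flipX J) = 1 -> const_term S = 1 ->
  e * J * S = flipX J * c ->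
  Rmatrix B J = (expA (ipi *: hO0) : fps T) * (S : fps T)^-1.
Proof.
move=> /const_term_unit[b [b1 b2 _]] /const_term_unit[d [d1 d2 _]] E.
have eE : expA (2^-1 *: hbarOmega T B) = e.
  rewrite /e /hOmega /sfh scalerA; congr (expA (_ *: _)).
  have ip0 : ipi != 0.
    apply: mulf_neq0; first by rewrite fmorph_eq0 gt_eqF // pi_gt0.
    by rewrite eq_complex /= oner_eq0 andbF.
  by rewrite -[2 * _ * _]mulrA invfM mulrCA divff ?mulr1.
rewrite /Rmatrix eE -/c.
have inv (u v : calA) : u * v = 1 -> v * u = 1 -> (calA_val u : fps T)^-1 = calA_val v.
  move=> uv vu; have uu : (calA_val u : fps T) \is a GRing.unit.
    by apply/unitrP; exists (calA_val v); split; rewrite -[_ * _]/(calA_val (_ * _)) ?uv ?vu.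
  by apply: (mulrI uu); rewrite mulrV // -[RHS]/(calA_val (u * v)) uv.
rewrite -[fps_flip J]/(calA_val (flipX J)) (inv _ _ b1 b2) (inv _ _ d1 d2).
rewrite -[LHS]/(calA_val (b * e * J)) -[RHS]/(calA_val (c * d)); congr calA_val.
transitivity (b * (e * J * S) * d); last by rewrite E !mulrA b2 mul1r.
by rewrite -!mulrA d1 mulr1.
Qed.

Lemma const_term_c : const_term c = 1. Proof. by apply: const_term_expA; exact: hO0_filA. Qed.
Lemma const_term_e : const_term e = 1. Proof. by apply: const_term_expA; exact: hO_filA. Qed.
Lemma const_term_e' : const_term e' = 1. Proof. by apply: const_term_expA; exact: hO_filA. Qed.

Lemma const_term_Jm : const_term Jm = 1.
Proof.
have := congr1 (@const_term _ _ _ T) twist_flip.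
by rewrite !const_termM const_term_flip const_term_c const_term_e const_term_Jp !mulr1.
Qed.

(** The relation e J S = J^21 c comes from [stokes_minusE] and [flip_Jp] for J_+, and from
    [stokes_plusE] and [twist_flip] for J_-. The constant terms of the Stokes matrices are read off
    the two Stokes relations. *)
Lemma Rmatrix_twists :
  Rmatrix B Jp = (expA (ipi *: hO0) : fps T) * (Sm : fps T)^-1 /\
  Rmatrix B Jm = (expA (ipi *: hO0) : fps T) * (Sp : fps T)^-1.
Proof.
split; apply: Rmatrix_eq; rewrite ?const_term_flip ?const_term_Jp ?const_term_Jm //.
- have := congr1 (@const_term _ _ _ T) stokes_minusE.
  by rewrite !const_termM const_term_c const_term_e const_term_e' const_term_Jp const_term_Jm !mul1r => ->.
- by rewrite flip_Jp -!mulrA stokes_minusE.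
- have := congr1 (@const_term _ _ _ T) stokes_plusE.
  by rewrite const_termM const_term_Jp const_term_Jm mul1r => <-.
- by rewrite -mulrA -stokes_plusE twist_flip.
Qed.

End Twists.

Theorem mainTheorem1 (R : realType) (g : lieAlgebra R[i]) (h : {vspace g})
  (hred : reductive g) (hcartan : cartan h)
  (B : g -> g -> R[i]) (hB : invariant_form B)
  (p : 'End(g)) (hp : cartan_projection h p)
  (U : envelopingAlgebra g) (T : tensorSquare U)
  (Ch : set (subvs_of h)) (hCh : chamber Ch)
  (mu : subvs_of h) (hmu : Ch mu)
  (H0 Hp Hm : R[i] -> calA T)
  (hH0 : canonical_at_0 B mu H0)
  (hHp : canonical_at_infty B p mu (@upper R) Hp)
  (hHm : canonical_at_infty B p mu (@lower R) Hm)
  (Yp Ym Ym' : R[i] -> calE T)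
  (hYp : continued_solution B p mu (@upper R) (@slitL R) Hp Yp)
  (hYm : continued_solution B p mu (@lower R) (@slitL R) Hm Ym)
  (hYm' : continued_solution B p mu (@lower R) (@slitR R) Hm Ym')
  (Jp Jm : calA T) (hJp : twist B mu H0 Yp Jp) (hJm : twist B mu H0 Ym Jm)
  (Sp Sm : calA T)
  (hSp : stokes_plus Yp Ym Sp) (hSm : stokes_minus B p Yp Ym' Sm) :
  Rmatrix B Jp =
    (expA (((pi : R)%:C * 'i%C) *: hOmega0 T B p) : fps T) * (Sm : fps T)^-1
  /\
  Rmatrix B Jm =
    (expA (((pi : R)%:C * 'i%C) *: hOmega0 T B p) : fps T) * (Sp : fps T)^-1.
Proof.
have hreg := chamber_hR_reg hCh hmu.
have [s ss sE] := cartan_eigenbasis hcartan hp hreg.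
(* The eigenbases are data, so a witness is chosen at each level k. *)
have cb k : eigen_coords T (vsval mu) k.
  apply: inhabited_witness; apply: eigen_coords_exist ss _ => y /sE[_].
  exact.
have [hab _ _] := hcartan.
exact: (Rmatrix_twists hB hab (cartan_projection_mem hcartan hp hreg) cb hH0 hHp hHm
  hYp hYm hYm' hJp hJm hSp hSm).
Qed.
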